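(* Let $\Psi$ be a branching mechanism with $\Psi'(0+)\ge0$, $\mathbf d=\lim_{u\to\infty}\Psi(u)/u=+\infty$ and $\int^{\infty}\frac{du}{\Psi(u)}=+\infty$ (i.e. $\int_a^\infty du/\Psi(u)=\infty$ for $a>0$). Let $(X_t(x),t\ge0,x\ge0)$ be the flow of CSBPs($\Psi$) given by the Poisson construction (infinite variation case). Fix $\lambda_0\in(0,\infty)$ and set $G(y)=\exp\left(-\int_{\lambda_0}^{y}\frac{du}{\Psi(u)}\right)$ for $y\in(0,\infty)$. Then almost surely, for every $i\in I$ the limit $Z_i:=\lim_{t\to\infty}e^{t}G(1/X^i_t)$ exists; $\mathcal M=\sum_{i\in I}\delta_{(x_i,Z_i)}$ is a Poisson point process on $\mathbb R_+\times(0,\infty)$ with intensity $dx\otimes\mu(dz)$ where $\mu((z,\infty))=G^{-1}(z)=v_{\log z}(\lambda_0)$ for $z>0$; and almost surely, for all $x\ge0$, $$e^{t}G\left(\frac{1}{X_t(x)}\right)\xrightarrow[t\to\infty]{}Z(x):=\sup_{x_i\le x}Z_i.$$ Moreover, almost surely $\mathcal S=\{x>0:\Delta Z(x)>0\}$.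
   Context: Branching mechanism: $\Psi(q)=\frac{\sigma^2}{2}q^2+\gamma q+\int_0^\infty(e^{-qr}-1+qr1_{\{r\le1\}})\pi(dr)$, $q\ge0$, with $\sigma\ge0$, $\gamma\in\mathbb R$, $\pi$ a measure on $(0,\infty)$ with $\int(1\wedge r^2)\pi(dr)<\infty$. $\Psi'(0+)=\lim_{u\to0}\Psi(u)/u$. The cumulant $v_t(\lambda)$ ($t\ge0$) is the unique solution of $\int_{v_t(\lambda)}^{\lambda}\frac{du}{\Psi(u)}=t$; $v_{s+t}=v_s\circ v_t$, and for $t>0$, $v_{-t}$ denotes the inverse of $\lambda\mapsto v_t(\lambda)$ (so $v_{\log z}$ for $z<1$ means $v_{-\log(1/z)}$). A CSBP($\Psi$) from $x$ is a Markov process $(X_t)$ in $[0,\infty]$ with $X_0=x$ and $E[e^{-\lambda X_t}]=e^{-xv_t(\lambda)}$; $P^\Psi_r$ its law from $r$. Poisson construction (infinite variation case): $v_t(\lambda)=\int_{(0,\infty]}\ell_t(dr)(1-e^{-\lambda r})$ for measures $\ell_t$, and there is a $\sigma$-finite measure $N_\Psi$ on the space $\mathcal D$ of càdlàg paths $(0,\infty)\to[0,\infty]$ with $N_\Psi(F(X_{t+\cdot});X_t>0)=\int_{(0,\infty]}\ell_t(dr)E^\Psi_r[F]$ for all $t>0$, $F\ge0$, and satisfying the Markov property; $\sum_{i\in I}\delta_{(x_i,X^i)}$ is a Poisson point process on $\mathbb R_+\times\mathcal D$ with intensity $dx\otimes N_\Psi$ and $X_t(x)=\sum_{x_i\le x}X^i_t$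 ($t>0$), $X_0(x)=x$. $\Delta X_t(x)=X_t(x)-X_t(x-)$. Super-individuals: $\mathcal S=\{x>0:\lim_{t\to\infty}\Delta X_t(x)/X_t(x-)=+\infty\}$. $\Delta Z(x)=Z(x)-Z(x-)$. *)

(* Defs.v *)
From HB Require Import structures.
From mathcomp Require Import all_boot all_order all_algebra.
From mathcomp Require Import all_classical all_reals all_analysis.
From mathcomp Require Import measurable_realfun lebesgue_measure.
Set Implicit Arguments. Unset Strict Implicit. Unset Printing Implicit Defensive.
Import Order.TTheory GRing.Theory Num.Theory.
Import numFieldNormedType.Exports.
Local Open Scope classical_set_scope.
Local Open Scope ring_scope.

Section defs.
Context {R : realType}.

Definition bmech (sigma gamma : R) (pi : {measure set (measurableTypeR R) -> \bar R})
  (q : R) : R :=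
  sigma ^+ 2 / 2 * q ^+ 2 + gamma * q +
  Rintegral pi `]0, +oo[ (fun r : R => expR (- (q * r)) - 1 + q * r * (if r <= 1 then 1 else 0)).

(** [is_cum Psi t lam v] : v = v_t(lam), i.e. int_v^lam du/Psi(u) = t (with 0 < v <= lam). *)
Definition is_cum (Psi : R -> R) (t lam v : R) : Prop :=
  0 < v /\ v <= lam /\
  Rintegral (@lebesgue_measure R) `[v, lam] (fun u => (Psi u)^-1) = t.

Definition oint (Psi : R -> R) (a b : R) : R :=
  if a <= b then Rintegral (@lebesgue_measure R) `[a, b] (fun u => (Psi u)^-1)
  else - Rintegral (@lebesgue_measure R) `[b, a] (fun u => (Psi u)^-1).

Definition Gfun (Psi : R -> R) (lam0 y : R) : R := expR (- oint Psi lam0 y).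

(** y |-> G(1/y) on [0,oo], with the boundary conventions G(1/0)=G(oo)=0, G(1/oo)=G(0+)=+oo *)
Definition Ginv_of (Psi : R -> R) (lam0 : R) (X : \bar R) : \bar R :=
  match X with
  | r%:E => if 0 < r then (Gfun Psi lam0 r^-1)%:E else 0%E
  | +oo%E => +oo%E
  | -oo%E => 0%E
  end.

Definition scaledG (Psi : R -> R) (lam0 t : R) (X : \bar R) : \bar R :=
  ((expR t)%:E * Ginv_of Psi lam0 X)%E.

Definition elap (lam : R) (z : \bar R) : R :=
  match z with
  | r%:E => expR (- (lam * r))
  | _ => 0
  end.

Definition pois (m : R) (k : nat) : R := expR (- m) * m ^+ k / k`!%:R.

Definition cnt {T : Type} (a : nat -> T) (A : set T) : \bar R :=
  (\sum_(0 <= n <oo) (\1_A (a n))%:E)%E.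

Definition is_PPP {dO} {Om : measurableType dO} (P : probability Om R)
  {dS} {S : measurableType dS} (atoms : Om -> nat -> S) (nu : set S -> \bar R) : Prop :=
  forall (n : nat) (A : 'I_n -> set S) (k : 'I_n -> nat),
    (forall i, measurable (A i)) ->
    (forall i j, i != j -> A i `&` A j = set0) ->
    (forall i, (nu (A i) < +oo)%E) ->
    let E := \bigcap_(i in [set: 'I_n]) [set w | cnt (atoms w) (A i) = (k i)%:R%:E] in
    measurable E /\ P E = (\prod_(i < n) pois (fine (nu (A i))) (k i))%:E.

(** Path space: functions (0,oo) -> [0,oo] (values at t <= 0 are irrelevant),
    with the sigma-algebra generated by the coordinates X_t, t > 0. *)
Definition cylG : set (set (R -> \bar R)) :=
  [set A : set (R -> \bar R) | exists (t : R) (B : set (\bar R)),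
    0 < t /\ measurable B /\ A = (fun w : R -> \bar R => w t) @^-1` B].

Definition Dpath := g_sigma_algebraType cylG.

Definition cadlag_pos (w : R -> \bar R) : Prop :=
  forall t, 0 < t ->
    (0 <= w t)%E /\ (w x @[x --> t^'+] --> w t) /\ cvg (w x @[x --> t^'-]).

(** iterated transition kernels: for a list [(s_1,B_1);...;(s_n,B_n)] of time increments and
    sets, int_{B_1} K_{s_1}(y,dy_1) int_{B_2} K_{s_2}(y_1,dy_2) ... 1 *)
Fixpoint fdd_iter (K : R -> \bar R -> {measure set (\bar R) -> \bar R})
  (y : \bar R) (l : seq (R * set (\bar R))) : \bar R :=
  match l with
  | [::] => 1%E
  | (s, B) :: l' => (\int[K s y]_(z in B) fdd_iter K z l')%E
  end.

Fixpoint cyl (t : R) (l : seq (R * set (\bar R))) : set (R -> \bar R) :=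
  match l with
  | [::] => setT
  | (s, B) :: l' => ((fun w => w (t + s)) @^-1` B) `&` cyl (t + s) l'
  end.

Definition flow (xs : nat -> R) (Xs : nat -> R -> \bar R) (t x : R) : \bar R :=
  (\sum_(0 <= n <oo) (if (xs n <= x)%R then Xs n t else 0))%E.

(** left limit of a nondecreasing function f : R -> \bar R at x *)
Definition lft (f : R -> \bar R) (x : R) : \bar R := ereal_sup (f @` `]-oo, x[).

Definition Zlim (Psi : R -> R) (lam0 : R) (w : R -> \bar R) : \bar R :=
  lim (scaledG Psi lam0 t (w t) @[t --> +oo%R]).

(** Z(x) = sup_{x_i <= x} Z_i  (sup of the empty family taken to be 0) *)
Definition Zfun (Z : nat -> \bar R) (xs : nat -> R) (x : R) : \bar R :=
  ereal_sup (0%E |` [set Z n | n in [set n | xs n <= x]]).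

Definition superind (xs : nat -> R) (Xs : nat -> R -> \bar R) : set R :=
  [set x | 0 < x /\
    (fine (flow xs Xs t x - lft (flow xs Xs t) x)%E / fine (lft (flow xs Xs t) x)
       @[t --> +oo%R] --> +oo%R)].

End defs.

(* Main.v *)
Require Import Defs.
From HB Require Import structures.
From mathcomp Require Import all_boot all_order all_algebra.
From mathcomp Require Import finmap.
From mathcomp Require Import all_classical all_reals all_analysis.
From mathcomp Require Import measurable_realfun lebesgue_measure.
From mathcomp Require Import ring lra.

(** Write v_{-t} for the inverse flow, so that e^t G(1/z) >= G(lam) means z >= 1/v_{-t}(lam).
    Since v_{-t}(lam')/v_{-t}(lam) tends to infinity for lam < lam', a path that is above
    1/v_{-q}(lam) at some late time q satisfies e^{-v_{-T}(lam') X_T} ~ 0 with high probability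
    at all later T, and a path below it satisfies e^{-v_{-T}(lam') X_T} ~ 1 for lam' < lam.
    As e^{-v_{-t}(lam) X_t} is a martingale, this gives
      N(X_t in C, e^t G(1/X_t) >= G(lam) infinitely often) = int_C (1 - e^{-v_{-t}(lam) X_t}) dN,
    hence the convergence of e^t G(1/X_t) to a limit zeta in (0, oo), N-almost everywhere, and
    N(zeta > G(lam)) = lam.  The mapping theorem turns this into the Poisson point process of
    marks.  For the flow, e^{-v_{-t}(lam) X_t(x)} is the conditional probability that no atom up
    to x has mark above G(lam); a first-passage bound then shows that the sum of all the atoms
    with mark below G(lam) is eventually below 1/v_{-t}(lam') for lam' < lam.  So the largest mark
    governs e^t G(1/X_t(x)), and comparing 1/v_{-t} at different levels identifies the
    super-individuals, the marks being pairwise distinct. *)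

Set Implicit Arguments.
Unset Strict Implicit.
Unset Printing Implicit Defensive.
Import Order.TTheory GRing.Theory Num.Theory.
Import numFieldNormedType.Exports.
Local Open Scope classical_set_scope.
Local Open Scope ring_scope.

Section branching_mechanism.
Context {R : realType}.
Implicit Types (a b q r x : R).

Lemma expRN_quad_bound x : 0 <= x -> 0 <= expR (- x) - 1 + x <= x ^+ 2.
Proof.
move=> x0; have h1 := expR_ge1Dx (- x).
apply/andP; split; first lra.
have h2 := expR_ge1Dx x.
have e0 := expR_gt0 (- x).
have e1 : expR (- x) * expR x = 1 by rewrite -expRD addNr expR0.
have h3 : expR (- x) * (1 + x) <= 1 by rewrite -[X in _ <= X]e1 ler_pM2l.
have h4 : 0 <= x ^+ 3 by exact: exprn_ge0.
have h5 : (1 + x) * (expR (- x) - 1 + x) <= (1 + x) * x ^+ 2.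
  have -> : (1 + x) * (expR (- x) - 1 + x) = expR (- x) * (1 + x) - 1 + x ^+ 2 by ring.
  have -> : (1 + x) * x ^+ 2 = x ^+ 2 + x ^+ 3 by ring.
  lra.
by rewrite ler_pM2l in h5 => //; lra.
Qed.

Lemma expR_chord_lt a b r : 0 < a -> a < b -> 0 < r ->
  0 < a * (expR (- (b * r)) - 1) - b * (expR (- (a * r)) - 1).
Proof.
move=> a0 ab r0.
have ea := expR_gt0 (- (a * r)).
have h1 : expR (- (a * r)) * (1 + a * r) < 1.
  have e1 : expR (- (a * r)) * expR (a * r) = 1 by rewrite -expRD addNr expR0.
  by rewrite -[X in _ < X]e1 ltr_pM2l// expR_gt1Dx// gt_eqF// mulr_gt0.
have h2 : expR (- (a * r)) * (1 - (b - a) * r) < expR (- (b * r)).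
  have -> : - (b * r) = - (a * r) + - ((b - a) * r) by ring.
  rewrite expRD ltr_pM2l// expR_gt1Dx// oppr_eq0 gt_eqF// mulr_gt0//; lra.
have h3 : (b - a) * (expR (- (a * r)) * (1 + a * r)) < (b - a) * 1.
  by rewrite ltr_pM2l// subr_gt0.
have h4 : a * (expR (- (a * r)) * (1 - (b - a) * r)) < a * expR (- (b * r)).
  by rewrite ltr_pM2l.
have h5 : (b - a) * (expR (- (a * r)) * (1 + a * r)) +
    a * (expR (- (a * r)) * (1 - (b - a) * r)) = b * expR (- (a * r)) by ring.
lra.
Qed.

Variables (sigma gamma : R) (pi : {measure set (measurableTypeR R) -> \bar R}).
Hypothesis hpi : (\int[pi]_(r in `]0%R, +oo[) (Num.min 1 (r ^+ 2))%:E < +oo)%E.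

Let k q r : R := expR (- (q * r)) - 1 + q * r * (if r <= 1 then 1 else 0).

Let mE (D : set R) q : measurable_fun D (fun r : R => expR (- (q * r))).
Proof.
apply: measurable_funTS; apply: continuous_measurable_fun => x.
apply: continuous_comp; last exact: continuous_expR.
by apply: cvgN; apply: cvgM; [exact: cvg_cst|exact: cvg_id].
Qed.

Let mk (D : set R) q : measurable_fun D (k q).
Proof.
apply: measurable_funTS; apply: measurable_funD.
  by apply: measurable_funB => //; exact: mE.
apply: measurable_funM; first exact: measurable_funM.
by apply: measurable_fun_ifT => //; exact: measurable_fun_ler.
Qed.

Let mkE (D : set (measurableTypeR R)) q :
  measurable_fun D (fun r : measurableTypeR R => (k q r)%:E).
Proof. by apply/measurable_EFinP; exact: mk. Qed.

Let iZ (D : set (measurableTypeR R)) (f : measurableTypeR R -> R) q : measurable D -> pi.-integrable D (EFin \o f) ->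
  pi.-integrable D (EFin \o (fun r => q * f r)).
Proof.
by move=> mD fi; have := integrableZl mD q fi; apply: eq_integrable => // r _; rewrite /= EFinM.
Qed.

Lemma integrable_bmech q : 0 < q -> pi.-integrable `]0, +oo[ (EFin \o k q).
Proof.
move=> q0.
have mm : measurable_fun (`]0, +oo[%classic : set R) (fun r : R => Num.min 1 (r ^+ 2)).
  by apply: measurable_funTS; apply: measurable_minr => //; exact: measurable_funX.
have im : pi.-integrable `]0, +oo[ (fun r => ((1 + q ^+ 2) * Num.min 1 (r ^+ 2))%:E).
  apply: (@iZ _ (fun r => Num.min 1 (r ^+ 2))) => //.
  apply/integrableP; split; first exact/measurable_EFinP.
  under eq_integral => r _ do rewrite gee0_abs ?lee_fin ?le_min ?ler01 ?sqr_ge0//.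
  exact: hpi.
apply: le_integrable im => //; first exact: mkE.
move=> r /=; rewrite in_itv/= andbT => r0.
have q2 : 0 <= q ^+ 2 by exact: sqr_ge0.
have qr0 : 0 < q * r by exact: mulr_gt0.
rewrite lee_fin [X in _ <= X]ger0_norm; last first.
  by rewrite mulr_ge0// ?le_min ?ler01 ?sqr_ge0//; lra.
rewrite /k; case: ifPn => r1.
  have /andP[h1 h2] := expRN_quad_bound (ltW qr0).
  rewrite mulr1 ger0_norm//.
  rewrite (le_trans h2)// min_r; last by rewrite expr_le1// ltW.
  by rewrite exprMn ler_pM2r ?exprn_gt0// lerDr.
rewrite -ltNge in r1.
rewrite mulr0 addr0 min_l; last by rewrite exprn_ege1// ltW.
rewrite mulr1 ler0_norm; last by rewrite subr_le0 expR_le1 oppr_le0 ltW.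
by have := expR_gt0 (- (q * r)); lra.
Qed.

Lemma bmech_ratio a b : 0 < a -> 0 < b ->
  a * bmech sigma gamma pi b - b * bmech sigma gamma pi a =
  sigma ^+ 2 / 2 * (a * b * (b - a)) +
  Rintegral pi `]0, +oo[
    (fun r => a * (expR (- (b * r)) - 1) - b * (expR (- (a * r)) - 1)).
Proof.
move=> a0 b0; rewrite /bmech -/(k a) -/(k b).
have -> : Rintegral pi `]0, +oo[
    (fun r => a * (expR (- (b * r)) - 1) - b * (expR (- (a * r)) - 1)) =
    a * Rintegral pi `]0, +oo[ (k b) - b * Rintegral pi `]0, +oo[ (k a).
  rewrite -!RintegralZl//; [|exact: integrable_bmech..].
  rewrite -RintegralB//; last 2 first.
    - by apply: (@iZ _ (k b)) => //; exact: integrable_bmech.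
    - by apply: (@iZ _ (k a)) => //; exact: integrable_bmech.
  by apply: eq_Rintegral => r _; rewrite /k; ring.
by ring.
Qed.

Hypothesis hd : (bmech sigma gamma pi u / u)%:E @[u --> +oo%R] --> +oo%E.

Lemma bmech_nondegenerate : sigma = 0 -> pi `]0, +oo[%classic != 0%E.
Proof.
move=> s0; apply/eqP => p0.
have h u : 0 < u -> bmech sigma gamma pi u / u = gamma.
  move=> u0; rewrite /bmech s0 expr0n/= !mul0r add0r.
  rewrite /Rintegral null_set_integral// ?addr0 ?mulfK ?gt_eqF//.
  exact: mkE.
move/cvgeyPgt : hd => /(_ gamma) hd'.
near (+oo%R : set_system R) => u.
suff : (gamma%:E < gamma%:E)%E by rewrite ltxx.
have u0 : 0 < u by near: u; exact: nbhs_pinfty_gt.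
rewrite -{2}(h _ u0); near: u; exact: hd'.
Unshelve. all: by end_near. Qed.

Lemma bmech_ratio_lt a b : 0 < a -> a < b ->
  bmech sigma gamma pi a / a < bmech sigma gamma pi b / b.
Proof.
move=> a0 ab; have b0 := lt_trans a0 ab.
rewrite ltr_pdivrMr// mulrAC ltr_pdivlMr// -subr_gt0.
have -> : bmech sigma gamma pi b * a - bmech sigma gamma pi a * b =
  a * bmech sigma gamma pi b - b * bmech sigma gamma pi a by ring.
rewrite bmech_ratio//.
set f := fun r => _.
have f0 r : `]0, +oo[%classic r -> 0 < f r.
  by rewrite /= in_itv/= andbT => r0; exact: expR_chord_lt.
have I0 : 0 <= Rintegral pi `]0, +oo[ f.
  by apply: Rintegral_ge0 => r /f0/ltW.
have s0 : 0 <= sigma ^+ 2 by exact: sqr_ge0.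
have ab0 : 0 < a * b * (b - a) by rewrite !mulr_gt0// subr_gt0.
have [se|sn] := eqVneq sigma 0; last first.
  have s1 : 0 < sigma ^+ 2 by rewrite exprn_even_gt0.
  by rewrite ltr_pwDl// mulr_gt0// divr_gt0.
rewrite se expr0n/= !mul0r add0r lt_neqAle I0 andbT eq_sym.
apply: contra_neq (bmech_nondegenerate se) => If0.
have mf : measurable_fun (`]0, +oo[%classic : set R) f.
  apply: measurable_funB; apply: measurable_funM => //; apply: measurable_funB => //;
  exact: mE.
have fint : pi.-integrable `]0, +oo[ (EFin \o f).
  have := integrableB (mu := pi) (measurable_itv `]0, +oo[)
    (iZ a (measurable_itv `]0, +oo[) (integrable_bmech b0))
    (iZ b (measurable_itv `]0, +oo[) (integrable_bmech a0)).
  apply: eq_integrable => // r _ /=; rewrite -EFinB /f /k; congr EFin.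
  by ring.
have E0 : (\int[pi]_(r in `]0%R, +oo[) `|(f r)%:E| = 0)%E.
  transitivity (\int[pi]_(r in `]0%R, +oo[) (f r)%:E)%E.
    by apply: eq_integral => r /[!inE] /f0/ltW fr; rewrite gee0_abs.
  rewrite -[LHS]fineK; first by rewrite -/(Rintegral _ _ _) If0.
  exact: integrable_fin_num.
have mf' : measurable_fun (`]0, +oo[%classic : set R) (EFin \o f) by exact/measurable_EFinP.
have [+ _] := ae_eq_integral_abs pi (measurable_itv `]0, +oo[) mf'.
move=> /(_ E0) [A [mA A0 hA]].
apply/eqP; rewrite eq_le measure_ge0 andbT -A0; apply: le_measure; rewrite ?inE//.
move=> r hr; apply: hA => /= /(_ hr) [fr0].
by move: (f0 _ hr); rewrite fr0 ltxx.
Qed.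

Hypothesis hder : exists l : \bar R,
  (0 <= l)%E /\ ((bmech sigma gamma pi u / u)%:E @[u --> 0^'+] --> l).

Lemma bmech_gt0 a : 0 < a -> 0 < bmech sigma gamma pi a.
Proof.
move=> a0; rewrite -(pmulr_lgt0 _ (_ : 0 < a^-1)) ?invr_gt0//.
have [l [l0 hl]] := hder.
have a2 : 0 < a / 2 by rewrite divr_gt0.
have a2a : a / 2 < a by lra.
apply: le_lt_trans (bmech_ratio_lt a2 a2a).
rewrite -lee_fin (le_trans l0)//.
apply: cvge_le hl; near=> u.
by rewrite lee_fin ltW// bmech_ratio_lt.
Unshelve. all: by end_near. Qed.

End branching_mechanism.

Section cumulant_flow.
Context {R : realType}.
Local Notation mu := (@lebesgue_measure R).

Definition admissible (Psi : R -> R) : Prop :=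
  [/\ forall a b, 0 < a -> a < b -> Psi a / a < Psi b / b,
      forall a, 0 < a -> 0 < Psi a,
      (Psi u / u)%:E @[u --> +oo%R] --> +oo%E &
      forall a : R, 0 < a ->
        (\int[mu]_(u in `[a, +oo[) ((Psi u)^-1)%:E)%E = +oo%E].

Implicit Types a b c t s lam u : R.
Variables (Psi : R -> R) (lam0 : R).
Hypothesis hP : admissible Psi.
Hypothesis lam0_gt0 : 0 < lam0.

Let Psi_gt0 a : 0 < a -> 0 < Psi a. Proof. by case: hP => _ h _ _; exact: h. Qed.

Let Psi_le a b : 0 < a -> a <= b -> Psi a <= Psi b.
Proof.
move=> a0; rewrite le_eqVlt => /predU1P[->//|ab].
have b0 := lt_trans a0 ab.
case: hP => h _ _ _; have := h _ _ a0 ab.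
rewrite ltr_pdivrMr// mulrAC ltr_pdivlMr// => hab.
have : Psi a * b <= Psi b * b.
  by rewrite (le_trans (ltW hab))// ler_pM2l ?Psi_gt0// ltW.
by rewrite ler_pM2r.
Qed.

Let RI a b := Rintegral mu `[a, b] (fun u => (Psi u)^-1).

Let inv_measurable a : 0 < a -> measurable_fun (`[a, +oo[%classic : set R) (fun u : R => (Psi u)^-1).
Proof.
move=> a0; apply: (eq_measurable_fun (fun u : R => (Psi (Num.max a u))^-1)).
  by move=> u /[!inE]/=; rewrite in_itv/= andbT => au; rewrite max_r.
apply: nonincreasing_measurable => // x y xy.
have m0 z : 0 < Num.max a z by rewrite lt_max a0.
rewrite lef_pV2 ?posrE ?Psi_gt0//; apply: Psi_le => //.
by rewrite ge_max le_max lexx/= le_max xy orbT.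
Qed.

Let inv_measurableS a (i : interval R) : 0 < a -> [set` i] `<=` `[a, +oo[%classic ->
  measurable_fun [set` i] (fun u : R => (Psi u)^-1).
Proof. by move=> a0 ia; exact: measurable_funS (inv_measurable a0). Qed.

Let inv_integrable a b : 0 < a -> mu.-integrable `[a, b] (EFin \o (fun u => (Psi u)^-1)).
Proof.
move=> a0; apply: measurable_bounded_integrable => //.
- rewrite /= lebesgue_measure_itv/=; case: ifPn => // _; rewrite -EFinB; exact: ltry.
- by apply: inv_measurableS a0 _ => u /=; rewrite !in_itv/= => /andP[->].
- exists (Psi a)^-1; split; first exact: num_real.
  move=> x ax u /=; rewrite in_itv/= => /andP[au ub].
  rewrite ger0_norm; last by rewrite invr_ge0 ltW// Psi_gt0// (lt_le_trans a0).
  apply: le_trans (ltW ax).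
  by rewrite lef_pV2 ?posrE ?Psi_gt0 ?Psi_le// (lt_le_trans a0).
Qed.

Let RI_split a b c : 0 < a -> a <= b -> b <= c -> RI a c = RI a b + RI b c.
Proof.
move=> a0 ab bc; have b0 := lt_le_trans a0 ab.
have /= := @Rintegral_itvB R (fun u => (Psi u)^-1) (BLeft a) (BRight c) b
  (inv_integrable c a0).
rewrite !bnd_simp => /(_ ab bc) /eqP; rewrite subr_eq addrC => /eqP.
rewrite (@Rintegral_itv_obnd_cbnd R b (BRight c) (fun u => (Psi u)^-1)) //.
apply: integrableS (inv_integrable c b0) => //.
by move=> u /=; rewrite !in_itv/= => /andP[/ltW-> ->].
Qed.

Let RI_bounds a b : 0 < a -> a <= b -> (b - a) / Psi b <= RI a b <= (b - a) / Psi a.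
Proof.
move=> a0 ab; have b0 := lt_le_trans a0 ab.
have Icst c : Rintegral mu `[a, b] (fun=> c) = (b - a) * c.
  rewrite Rintegral_cst//= lebesgue_measure_itv/= lte_fin mulrC; case: ltP => ab'.
    by rewrite -EFinB.
  by have -> : a = b; [apply: le_anti; rewrite ab|rewrite subrr].
have ic c : mu.-integrable `[a, b] (EFin \o (fun=> c) : R -> \bar R).
  apply: measurable_bounded_integrable => //.
    by rewrite /= lebesgue_measure_itv/=; case: ifPn => // _; rewrite -EFinB; exact: ltry.
  by exists `|c|; split => [|x cx u _]; [exact: num_real|exact: ltW].
rewrite -(Icst (Psi b)^-1) -(Icst (Psi a)^-1).
apply/andP; split; apply: le_Rintegral => //; try exact: inv_integrable.
- move=> u /=; rewrite in_itv/= => /andP[au ub].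
  have u0 := lt_le_trans a0 au.
  by rewrite lef_pV2 ?posrE ?Psi_gt0 ?Psi_le.
- move=> u /=; rewrite in_itv/= => /andP[au ub].
  have u0 := lt_le_trans a0 au.
  by rewrite lef_pV2 ?posrE ?Psi_gt0 ?Psi_le.
Qed.

Local Notation H := (oint Psi lam0).

Let H_diff a b : 0 < a -> a <= b -> H b - H a = RI a b.
Proof.
move=> a0 ab; rewrite /oint -/(RI lam0 b) -/(RI b lam0) -/(RI lam0 a) -/(RI a lam0).
have [la|la] := lerP lam0 a; have [lb|lb] := lerP lam0 b.
- by rewrite (RI_split lam0_gt0 la ab) addrC addKr.
- by move: (lt_le_trans lb la); rewrite ltNge ab.
- by rewrite opprK addrC -RI_split// ltW.
- by rewrite opprK (RI_split a0 ab (ltW lb)) addrCA addNr addr0.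
Qed.

Lemma oint_lt a b : 0 < a -> a < b -> H a < H b.
Proof.
move=> a0 ab; rewrite -subr_gt0 (H_diff a0 (ltW ab)).
have /andP[h _] := RI_bounds a0 (ltW ab); apply: lt_le_trans h.
by rewrite divr_gt0 ?subr_gt0// Psi_gt0// (lt_trans a0).
Qed.

Lemma oint_le a b : 0 < a -> a <= b -> H a <= H b.
Proof. by move=> a0; rewrite le_eqVlt => /predU1P[->//|/(oint_lt a0)/ltW]. Qed.

Lemma le_oint a b : 0 < a -> 0 < b -> H a <= H b -> a <= b.
Proof. by move=> a0 b0; apply: contraTT; rewrite -!ltNge; exact: oint_lt. Qed.

Lemma oint_inj a b : 0 < a -> 0 < b -> H a = H b -> a = b.
Proof. by move=> a0 b0 e; apply: le_anti; apply/andP; split; apply: le_oint; rewrite // e. Qed.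

Let H_cont a : 0 < a -> continuous (fun u => H (Num.max a u)).
Proof.
move=> a0 x; apply/cvgrPdist_le => e e0.
have lip u v : u <= v -> `|H (Num.max a v) - H (Num.max a u)| <= (v - u) / Psi a.
  move=> uv; have m0 z : 0 < Num.max a z by rewrite lt_max a0.
  have muv : Num.max a u <= Num.max a v by rewrite ge_max !le_max lexx uv orbT.
  rewrite H_diff//; have /andP[h1 h2] := RI_bounds (m0 u) muv.
  rewrite ger0_norm; last first.
    by rewrite (le_trans _ h1)// divr_ge0 ?subr_ge0// ltW// Psi_gt0.
  rewrite (le_trans h2)// ler_pM ?subr_ge0// ?invr_ge0 ?(ltW (Psi_gt0 _))//.
    by have [au|au] := leP a u; have [av|av] := leP a v; lra.
  by rewrite lef_pV2 ?posrE ?Psi_gt0// Psi_le// le_max lexx.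
have lip2 u v : `|H (Num.max a v) - H (Num.max a u)| <= `|v - u| / Psi a.
  have [uv|uv] := leP u v; first by rewrite (le_trans (lip _ _ uv))// ger0_norm// subr_ge0.
  rewrite distrC (le_trans (lip _ _ (ltW uv)))// (distrC v u) ger0_norm//.
  by rewrite subr_ge0 ltW.
near=> u; rewrite (le_trans (lip2 _ _))// ler_pdivrMr ?Psi_gt0//.
near: u; apply: cvgr_dist_le => //; first exact: mulr_gt0 (Psi_gt0 a0).
Unshelve. all: by end_near. Qed.

Let H_unbounded_above c : exists2 b, 0 < b & c <= H b.
Proof.
pose F n := `[1, n.+1%:R : R]%classic.
have nF : nondecreasing_seq F.
  move=> m n mn; apply/subsetPset => u; rewrite /F /= !in_itv/= => /andP[-> um].
  by rewrite (le_trans um)// ler_nat.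
have UF : \bigcup_n F n = `[1, +oo[%classic.
  apply/seteqP; split=> u; rewrite /F.
    by move=> [n _] /=; rewrite !in_itv/= => /andP[->].
  rewrite /= in_itv/= andbT => u1; exists (Num.truncn u) => //=.
  by rewrite in_itv/= u1/= ltW// truncnS_gt.
have cv := @ge0_nondecreasing_set_cvg_integral _ (measurableTypeR R) R F (fun u : R => ((Psi u)^-1)%:E) mu nF.
have {cv} : (\int[mu]_(x in F i) ((Psi x)^-1)%:E @[i --> \oo] --> +oo)%E.
  case: hP => _ _ _ /(_ 1 ltr01) <-; rewrite -UF; apply: cv => //.
  - by move=> i; exact: measurable_itv.
  - move=> i; apply/measurable_EFinP; apply: (@inv_measurableS 1) => // u /=.
    by rewrite !in_itv/= => /andP[->].
  - move=> i u; rewrite /F /= in_itv/= => /andP[u1 _].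
    by rewrite lee_fin invr_ge0 ltW// Psi_gt0// (lt_le_trans ltr01).
move/cvgeyPge => /(_ (c - H 1)) [n _ /(_ n (leqnn n))]/=.
have e : (\int[mu]_(x in F n) ((Psi x)^-1)%:E = (RI 1 n.+1%:R)%:E)%E.
  rewrite /RI /Rintegral fineK//; apply: integrable_fin_num => //.
  exact: (inv_integrable _ ltr01).
rewrite e lee_fin -H_diff ?ler1n// lerD2r => h.
by exists n.+1%:R.
Qed.

Let H_unbounded_below c : exists2 a, 0 < a & H a <= c.
Proof.
have P1 := Psi_gt0 ltr01.
pose d := (2 * Psi 1)^-1.
have d0 : 0 < d by rewrite invr_gt0 mulr_gt0.
have step k : H (2^-1 ^+ k) <= H 1 - k%:R * d.
  elim: k => [|k IH]; first by rewrite expr0 mul0r subr0.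
  have h0 : 0 < 2^-1 ^+ k.+1 :> R by rewrite exprn_gt0// invr_gt0.
  have hk : 0 < 2^-1 ^+ k :> R by rewrite exprn_gt0// invr_gt0.
  have e2 : 2^-1 ^+ k = 2 * 2^-1 ^+ k.+1 :> R.
    by rewrite exprS mulrA divff ?mul1r// pnatr_eq0.
  have hle : 2^-1 ^+ k.+1 <= 2^-1 ^+ k :> R by rewrite e2; lra.
  have hd1 := H_diff h0 hle; have /andP[hb _] := RI_bounds h0 hle.
  have Pk : Psi (2^-1 ^+ k) <= 2^-1 ^+ k * Psi 1.
    have k1 : 2^-1 ^+ k <= 1 :> R by rewrite exprn_ile1// ?invr_ge0// invf_le1// ler1n.
    move: k1; rewrite le_eqVlt => /predU1P[->|k1]; first by rewrite mul1r.
    case: hP => h _ _ _; have := h _ _ hk k1.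
    by rewrite divr1 ltr_pdivrMr// mulrC => /ltW.
  have hdd : d <= (2^-1 ^+ k - 2^-1 ^+ k.+1) / Psi (2^-1 ^+ k).
    rewrite ler_pdivlMr ?Psi_gt0//.
    have : d * Psi (2^-1 ^+ k) <= d * (2^-1 ^+ k * Psi 1) by rewrite ler_pM2l.
    have -> : d * (2^-1 ^+ k * Psi 1) = 2^-1 ^+ k / 2.
      by rewrite /d; field; rewrite gt_eqF.
    by rewrite e2; lra.
  have -> : k.+1%:R = k%:R + 1 :> R by rewrite natr1.
  by rewrite mulrDl mul1r; lra.
have [k hk] : exists k : nat, (H 1 - c) / d <= k%:R.
  by exists (Num.truncn ((H 1 - c) / d)).+1; rewrite ltW// truncnS_gt.
exists (2^-1 ^+ k); first by rewrite exprn_gt0// invr_gt0.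
by move: hk (step k); rewrite ler_pdivrMr//; lra.
Qed.

Lemma oint_surj c : exists2 y, 0 < y & H y = c.
Proof.
have [a a0 ha] := H_unbounded_below c; have [b b0 hb] := H_unbounded_above c.
have ab : a <= b by apply: le_oint => //; exact: le_trans hb.
have cont : {within `[a, b], continuous (fun u => H (Num.max a u))}.
  exact/continuous_subspaceT/H_cont.
have := IVT ab cont; rewrite maxxx (max_r ab) => /(_ c).
rewrite ge_min ha le_max hb orbT => /(_ isT) [y].
rewrite in_itv/= => /andP[ay yb]; rewrite max_r// => hy.
by exists y => //; exact: lt_le_trans a0 ay.
Qed.

(* [vinv t lam] is the paper's v_{-t}(lam), for t of any sign. *)
Definition vinv (t lam : R) : R := xget 1 [set y | 0 < y /\ H y = H lam + t].

Let vinvP t lam : 0 < vinv t lam /\ H (vinv t lam) = H lam + t.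
Proof.
rewrite /vinv; case: xgetP => [y -> //|].
by have [y y0 hy] := oint_surj (H lam + t) => /(_ y) []; split.
Qed.

Lemma vinv_gt0 t lam : 0 < vinv t lam. Proof. by case: (vinvP t lam). Qed.

Lemma oint_vinv t lam : H (vinv t lam) = H lam + t. Proof. by case: (vinvP t lam). Qed.

Lemma vinvD s t lam : vinv s (vinv t lam) = vinv (t + s) lam.
Proof. by apply: oint_inj; rewrite ?vinv_gt0// !oint_vinv addrA. Qed.

Lemma vinv0 lam : 0 < lam -> vinv 0 lam = lam.
Proof. by move=> l0; apply: oint_inj; rewrite ?vinv_gt0// oint_vinv addr0. Qed.

Lemma vinv_lt t lam lam' : 0 < lam -> lam < lam' -> vinv t lam < vinv t lam'.
Proof.
move=> l0 ll; rewrite ltNge; apply/negP => /(oint_le (vinv_gt0 _ _)).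
by rewrite !oint_vinv lerD2r leNgt oint_lt.
Qed.

Lemma vinv_le t lam lam' : 0 < lam -> lam <= lam' -> vinv t lam <= vinv t lam'.
Proof. by move=> l0; rewrite le_eqVlt => /predU1P[->//|/(vinv_lt t l0)/ltW]. Qed.

Lemma vinv_le_time s t lam : s <= t -> vinv s lam <= vinv t lam.
Proof. by move=> st; apply: le_oint; rewrite ?vinv_gt0// !oint_vinv lerD2l. Qed.

Lemma vinv_is_cum s t lam : 0 <= s -> is_cum Psi s (vinv (t + s) lam) (vinv t lam).
Proof.
move=> s0; have tts : vinv t lam <= vinv (t + s) lam by apply: vinv_le_time; rewrite lerDl.
split; first exact: vinv_gt0.
split => //; rewrite -/(RI _ _) -H_diff ?vinv_gt0// !oint_vinv; ring.
Qed.

Lemma vinv_cvgy lam (M : R) : 0 < lam -> \forall t \near +oo, M <= vinv t lam.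
Proof.
move=> l0; near=> t.
have [M0|M0] := leP M 0; first by rewrite (le_trans M0)// ltW// vinv_gt0.
apply: le_oint; rewrite ?vinv_gt0// oint_vinv -lerBlDl.
by near: t; apply: nbhs_pinfty_ge; exact: num_real.
Unshelve. all: by end_near. Qed.

Lemma vinv_ratio_cvgy lam lam' (k : R) : 0 < lam -> lam < lam' ->
  \forall t \near +oo, k * vinv t lam <= vinv t lam'.
Proof.
move=> l0 ll.
have [k1|k1] := leP k 1.
  near=> t; rewrite (le_trans (_ : _ <= 1 * vinv t lam))//.
    by rewrite ler_pM2r// vinv_gt0.
  by rewrite mul1r vinv_le// ltW.
pose c := H lam' - H lam.
have c0 : 0 < c by rewrite subr_gt0 oint_lt.
case: hP => _ _ /cvgeyPgt/(_ ((k - 1) / c)) [U [_ hU]] _.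
have [t0 [_ ht0]] := vinv_cvgy (U + 1) l0.
near=> t.
set v := vinv t lam.
have v0 : 0 < v by exact: vinv_gt0.
have Uv : U < v.
  by rewrite (lt_le_trans (_ : U < U + 1)) ?ltrDl//; apply: ht0; near: t; apply: nbhs_pinfty_gt; exact: num_real.
have vkv : v <= k * v by rewrite ler_peMl// ltW.
have kv0 : 0 < k * v by rewrite mulr_gt0// (lt_trans ltr01).
apply: le_oint; rewrite ?vinv_gt0// oint_vinv.
have /andP[_ hb] := RI_bounds v0 vkv.
have := H_diff v0 vkv; rewrite oint_vinv => hd1.
have : (k * v - v) / Psi v <= c.
  have -> : k * v - v = (k - 1) * v by ring.
  rewrite ler_pdivrMr ?Psi_gt0//.
  have := hU _ Uv; rewrite lte_fin ltr_pdivlMr// mulrAC ltr_pdivrMr//.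
  by rewrite mulrC => /ltW/le_trans; apply; rewrite mulrC.
by rewrite /c; lra.
Unshelve. all: by end_near. Qed.

End cumulant_flow.

Section lower_integral.
Local Open Scope ereal_scope.
Context {d : measure_display} {T : measurableType d} {R : realType}.
Variables (m : {measure set T -> \bar R}) (D : set T).
Implicit Types f g : T -> \bar R.
Import HBNNSimple.

(* The integral of a non-measurable nonnegative function is its lower integral,
   which is still monotone, homogeneous and superadditive. *)
Lemma le_lower_integral f g : (forall x, D x -> 0 <= f x) ->
  (forall x, D x -> f x <= g x) ->
  \int[m]_(x in D) f x <= \int[m]_(x in D) g x.
Proof.
move=> f0 fg; have g0 x : D x -> 0 <= g x by move=> Dx; exact: le_trans (f0 _ Dx) (fg _ Dx).
rewrite !ge0_integralE//; apply: le_ereal_sup => _ [h hf <-]; exists h => // x.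
apply: le_trans (hf x) _; rewrite /patch; case: ifPn => // /set_mem Dx; exact: fg.
Qed.

Lemma lower_integralZl_ge f (c : R) : (0 <= c)%R -> (forall x, D x -> 0 <= f x) ->
  c%:E * \int[m]_(x in D) f x <= \int[m]_(x in D) (c%:E * f x).
Proof.
rewrite le_eqVlt => /predU1P[<- f0|c0 f0].
  by rewrite mul0e; apply: integral_ge0 => x Dx; rewrite mul0e.
have cf0 x : D x -> 0 <= c%:E * f x by move=> Dx; rewrite mule_ge0 ?f0// lee_fin ltW.
rewrite -lee_pdivlMl// [X in X <= _]ge0_integralE//.
apply: ge_ereal_sup => _ [h hf <-]; rewrite lee_pdivlMl// ge0_integralE//.
apply: ereal_sup_ubound; exists (scale_nnsfun h (ltW c0)); last by rewrite sintegralrM.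
move=> x /=; have := hf x; rewrite /patch; case: ifPn => // _ hx.
  by rewrite EFinM lee_pmul2l.
have -> : h x = 0%R by apply/eqP; rewrite eq_le fun_ge0 -lee_fin hx.
by rewrite mulr0.
Qed.

Lemma lower_integralZl f (c : R) : (0 <= c)%R -> (forall x, D x -> 0 <= f x) ->
  \int[m]_(x in D) (c%:E * f x) = c%:E * \int[m]_(x in D) f x.
Proof.
move=> c0 f0; apply/eqP; rewrite eq_le lower_integralZl_ge// andbT.
have [->|cn0] := eqVneq c 0%R.
  by under eq_integral do rewrite mul0e; rewrite mul0e integral0.
have {cn0}c0 : (0 < c)%R by rewrite lt_neqAle eq_sym cn0.
have cf0 x : D x -> 0 <= c%:E * f x by move=> Dx; rewrite mule_ge0 ?f0// lee_fin ltW.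
rewrite -lee_pdivrMl//.
apply: le_trans (lower_integralZl_ge _ cf0) _; first by rewrite invr_ge0 ltW.
apply: le_lower_integral => x Dx.
  by rewrite mule_ge0 ?cf0// lee_fin invr_ge0 ltW.
by rewrite muleA -EFinM mulVf ?gt_eqF// mul1e.
Qed.

Lemma lower_integralD_ge f g : (forall x, D x -> 0 <= f x) ->
  (forall x, D x -> 0 <= g x) ->
  \int[m]_(x in D) f x + \int[m]_(x in D) g x <= \int[m]_(x in D) (f x + g x).
Proof.
move=> f0 g0; have fg0 x : D x -> 0 <= f x + g x by move=> Dx; rewrite adde_ge0 ?f0 ?g0.
have lef : \int[m]_(x in D) f x <= \int[m]_(x in D) (f x + g x).
  by apply: le_lower_integral => // x Dx; rewrite leeDl// g0.
have leg : \int[m]_(x in D) g x <= \int[m]_(x in D) (f x + g x).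
  by apply: le_lower_integral => // x Dx; rewrite leeDr// f0.
have [If|If] := eqVneq (\int[m]_(x in D) f x) +oo.
  by move: lef; rewrite If leye_eq => /eqP ->; rewrite leey.
have [Ig|Ig] := eqVneq (\int[m]_(x in D) g x) +oo.
  by move: leg; rewrite Ig leye_eq => /eqP ->; rewrite leey.
have Ff : \int[m]_(x in D) f x \is a fin_num by rewrite ge0_fin_numE ?ltey// integral_ge0.
have Fg : \int[m]_(x in D) g x \is a fin_num by rewrite ge0_fin_numE ?ltey// integral_ge0.
apply/lee_addgt0Pr => e e0.
have e2 : (0 < e / 2)%R by rewrite divr_gt0.
have Ff' := Ff; have Fg' := Fg; rewrite ge0_integralE// in Ff'; rewrite ge0_integralE// in Fg'.
move: Ff' Fg'.
move=> /(ub_ereal_sup_adherent e2) [_ [h1 h1f <-] hh1].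
move=> /(ub_ereal_sup_adherent e2) [_ [h2 h2f <-] hh2].
rewrite -ge0_integralE// in hh1; rewrite -ge0_integralE// in hh2.
have h12 : sintegral m h1 + sintegral m h2 <= \int[m]_(x in D) (f x + g x).
  rewrite -sintegralD// [leRHS]ge0_integralE//.
  apply: ereal_sup_ubound; exists (add_nnsfun h1 h2) => // x /=.
  rewrite EFinD; apply: le_trans (leeD (h1f x) (h2f x)) _.
  by rewrite /patch; case: ifPn => //; rewrite adde0.
rewrite lteBlDr// in hh1; rewrite lteBlDr// in hh2.
apply: le_trans (leeD (ltW hh1) (ltW hh2)) _.
by rewrite addeACA -EFinD -splitr leeD2r.
Qed.

End lower_integral.

Section integral_simple_comp.
Local Open Scope ereal_scope.
Context {d d' : measure_display} {T : measurableType d} {Y : measurableType d'}.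
Context {R : realType}.
Variable (m : {measure set T -> \bar R}).
Variables (C : set T) (X : T -> Y).
Hypotheses (mC : measurable C) (mX : measurable_fun [set: T] X).
Import HBNNSimple.

Variable a : T -> R.
Hypotheses (ma : measurable_fun [set: T] a) (a0 : forall x, (0 <= a x)%R).

Let mP (h : {nnsfun Y >-> R}) y : measurable (X @^-1` (h @^-1` [set y])).
Proof. by rewrite -[_ @^-1` _]setTI; apply: mX. Qed.

Lemma integral_nnsfun_comp (h : {nnsfun Y >-> R}) :
  \int[m]_(w in C) (h (X w) * a w)%:E =
  \sum_(y <- fset_set (range h)) y%:E *
     \int[m]_(w in C `&` X @^-1` (h @^-1` [set y])) (a w)%:E.
Proof.
pose A y := X @^-1` (h @^-1` [set y]).
pose f y w := if y \in fset_set (range h) then (y * (a w * \1_(A y) w))%:E else 0.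
have mf y : measurable_fun C (f y).
  rewrite /f; case: (y \in _) => //; apply/measurable_EFinP.
  apply: measurable_funM => //; apply: measurable_funM; first exact: measurable_funTS.
  by apply: measurable_indic; exact: mP.
have f0 y w : 0 <= f y w.
  rewrite /f; case: ifPn => //; rewrite in_fset_set// => /set_mem [z _ <-].
  by rewrite lee_fin !mulr_ge0 ?fun_ge0.
transitivity (\int[m]_(w in C) (\sum_(y <- fset_set (range h)) f y w)).
  apply: eq_integral => w _; rewrite fimfunE fsbig_finite//= mulr_suml -sumEFin.
  rewrite big_seq [RHS]big_seq; apply: eq_bigr => y hy; rewrite /f hy; congr EFin.
  by rewrite !indicE -mulrA; congr (_ * _)%R; rewrite mulrC.
rewrite ge0_integral_sum//.
rewrite big_seq [RHS]big_seq; apply: eq_bigr => y hy; rewrite /f hy.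
have y0 : (0 <= y)%R.
  by move: hy; rewrite in_fset_set// => /set_mem [z _ <-]; exact: fun_ge0.
under eq_integral do rewrite EFinM.
rewrite ge0_integralZl//; last 2 first.
- apply/measurable_EFinP; apply: measurable_funM; first exact: measurable_funTS.
  by apply: measurable_indic; exact: mP.
- by move=> w _; rewrite lee_fin mulr_ge0.
congr (_ * _); rewrite integral_mkcondr; apply: eq_integral => w _.
rewrite /patch indicE /A; case: ifPn => hw; first by rewrite mulr1.
by rewrite mulr0.
Qed.

Lemma integral_comp_ub (g : Y -> \bar R) (M : \bar R) :
  measurable_fun [set: Y] g -> (forall y, 0 <= g y) ->
  (forall h : {nnsfun Y >-> R}, (forall y, (h y)%:E <= g y) ->
    \int[m]_(w in C) (h (X w) * a w)%:E <= M) ->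
  \int[m]_(w in C) (g (X w) * (a w)%:E) <= M.
Proof.
move=> mg g0 hM.
pose gm := nnsfun_approx measurableT mg.
have cv w : C w -> (gm n (X w) * a w)%:E @[n --> \oo] --> g (X w) * (a w)%:E.
  move=> Cw.
  have cg : (gm n (X w))%:E @[n --> \oo] --> g (X w) by apply: cvg_nnsfun_approx.
  by under eq_fun do rewrite EFinM; exact: cvgeZr.
have mgm n : measurable_fun C (fun w => (gm n (X w) * a w)%:E).
  apply: measurable_funTS; apply/measurable_EFinP; apply: measurable_funM => //.
  exact: measurableT_comp.
have gm0 n w : C w -> 0 <= (gm n (X w) * a w)%:E by move=> _; rewrite lee_fin mulr_ge0 ?fun_ge0.
have ndg w : C w -> nondecreasing_seq (fun n => (gm n (X w) * a w)%:E).
  move=> _ p q pq; rewrite lee_fin ler_wpM2r//.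
  by have /lefP := nd_nnsfun_approx measurableT mg pq; exact.
have := @cvg_monotone_convergence _ _ _ m _ mC _ mgm gm0 ndg.
have -> : \int[m]_(w in C) limn (fun n => (gm n (X w) * a w)%:E) =
    \int[m]_(w in C) (g (X w) * (a w)%:E).
  by apply: eq_integral => w /set_mem Cw; apply/cvg_lim => //; exact: cv.
move/cvg_lim => <- //; apply: lime_le.
  apply: ereal_nondecreasing_is_cvgn => p q pq; apply: ge0_le_integral => //.
  - by move=> w; exact: gm0.
  - by move=> w Cw; exact: ndg.
by apply: nearW => n; apply: hM => y; rewrite /gm nnsfun_approxE; exact: le_approx.
Qed.

End integral_simple_comp.

Section integral_comp_le.
Local Open Scope ereal_scope.
Import HBNNSimple.

Lemma integral_comp_le {d d' : measure_display} {T : measurableType d}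
    {Y : measurableType d'} {R : realType} (m : {measure set T -> \bar R})
    (C : set T) (X : T -> Y) (a b : T -> R) (g : Y -> \bar R) :
  measurable C -> measurable_fun [set: T] X ->
  measurable_fun [set: T] a -> (forall x, (0 <= a x)%R) ->
  measurable_fun [set: T] b -> (forall x, (0 <= b x)%R) ->
  measurable_fun [set: Y] g -> (forall y, 0 <= g y) ->
  (forall D, measurable D -> \int[m]_(w in C `&` X @^-1` D) (a w)%:E <=
    \int[m]_(w in C `&` X @^-1` D) (b w)%:E) ->
  \int[m]_(w in C) (g (X w) * (a w)%:E) <= \int[m]_(w in C) (g (X w) * (b w)%:E).
Proof.
move=> mC mX ma a0 mb b0 mg g0 hab; apply: integral_comp_ub => // h hg.
apply: (@le_trans _ _ (\int[m]_(w in C) (h (X w) * b w)%:E)); last first.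
  apply: ge0_le_integral => //.
  - by move=> w _; rewrite lee_fin mulr_ge0 ?fun_ge0.
  - apply: measurable_funTS; apply/measurable_EFinP; apply: measurable_funM => //.
    exact: measurableT_comp.
  - apply: measurable_funTS; apply: emeasurable_funM; first exact: measurableT_comp.
    exact/measurable_EFinP.
  - by move=> w _; rewrite EFinM lee_wpmul2r ?lee_fin.
rewrite !integral_nnsfun_comp//.
rewrite big_seq [leRHS]big_seq; apply: lee_sum => y hy.
apply: lee_wpmul2l; last exact: hab.
by move: hy; rewrite in_fset_set// => /set_mem [z _ <-]; rewrite lee_fin fun_ge0.
Qed.

End integral_comp_le.

Section cylinders.
Context {R : realType}.
Implicit Types (K : R -> \bar R -> {measure set (\bar R) -> \bar R}).
Implicit Types (l : seq (R * set (\bar R))) (y : \bar R) (t s : R).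

Fixpoint fdd_fun K y l (F : \bar R -> \bar R) : \bar R :=
  match l with
  | [::] => F y
  | (s, B) :: l' => (\int[K s y]_(z in B) fdd_fun K z l' F)%E
  end.

Lemma fdd_iter_cat K y l l' :
  fdd_iter K y (l ++ l') = fdd_fun K y l (fun z => fdd_iter K z l').
Proof.
elim: l y => [//|[s B] l IH] y /=.
by apply: eq_integral => z _; exact: IH.
Qed.

Lemma fdd_fun_ge0 K y l F : (forall z, 0 <= F z)%E -> (0 <= fdd_fun K y l F)%E.
Proof.
move=> F0; elim: l y => [|[s B] l IH] y //=.
by apply: integral_ge0 => z _; exact: IH.
Qed.

Lemma fdd_fun_le K y l F F' (D : set (\bar R)) : D y -> (forall z, 0 <= F z)%E ->
  (forall z, last D (map snd l) z -> F z <= F' z)%E ->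
  (fdd_fun K y l F <= fdd_fun K y l F')%E.
Proof.
move=> Dy F0; elim: l y D Dy => [|[s B] l IH] y D Dy /= FF'; first exact: FF'.
apply: le_lower_integral => z Bz; first exact: fdd_fun_ge0.
exact: (IH z B).
Qed.

Lemma fdd_funZl K y l F (c : R) : 0 <= c -> (forall z, 0 <= F z)%E ->
  fdd_fun K y l (fun z => (c%:E * F z)%E) = (c%:E * fdd_fun K y l F)%E.
Proof.
move=> c0 F0; elim: l y => [//|[s B] l IH] y /=.
under eq_integral do rewrite IH.
by rewrite lower_integralZl// => z _; exact: fdd_fun_ge0.
Qed.

Lemma fdd_funD_ge K y l F F' : (forall z, 0 <= F z)%E -> (forall z, 0 <= F' z)%E ->
  (fdd_fun K y l F + fdd_fun K y l F' <= fdd_fun K y l (fun z => F z + F' z))%E.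
Proof.
move=> F0 F'0; elim: l y => [//|[s B] l IH] y /=.
apply: le_trans (lower_integralD_ge _ _ _) _; try by move=> z _; exact: fdd_fun_ge0.
apply: le_lower_integral => z _; last exact: IH.
by apply: adde_ge0; exact: fdd_fun_ge0.
Qed.

Definition end_time t l := foldl (fun u (p : R * set (\bar R)) => u + p.1) t l.

Lemma cyl_cat t l l' : cyl t (l ++ l') = cyl t l `&` cyl (end_time t l) l'.
Proof.
elim: l t => [|[s B] l IH] t /=; first by rewrite setTI.
by rewrite IH setIA.
Qed.

Lemma end_time_gt0 t l : 0 < t -> all (fun p => 0 < p.1) l -> 0 < end_time t l.
Proof.
elim: l t => [//|[s B] l IH] t t0 /= /andP[s0 hl].
by apply: IH => //; rewrite addr_gt0.
Qed.

Lemma coord_measurable t (B : set (\bar R)) : 0 < t -> measurable B ->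
  measurable ((fun w : Dpath => w t) @^-1` B : set (@Dpath R)).
Proof. by move=> t0 mB; apply: sub_sigma_algebra; exists t, B. Qed.

Lemma measurable_coord t : 0 < t -> measurable_fun [set: @Dpath R] (fun w : Dpath => w t).
Proof. by move=> t0 _ B mB; rewrite setTI; exact: coord_measurable. Qed.

Lemma cyl_measurable t l : 0 < t -> all (fun p => 0 < p.1) l ->
  (forall p, p \in l -> measurable p.2) -> measurable (cyl t l : set (@Dpath R)).
Proof.
elim: l t => [|[s B] l IH] t t0 /=; first by move=> _ _; exact: measurableT.
move=> /andP[s0 hl] ml; apply: measurableI.
  by apply: coord_measurable; [rewrite addr_gt0|apply: (ml (s, B)); rewrite mem_head].
apply: IH => //; first by rewrite addr_gt0.
by move=> p pl; apply: ml; rewrite in_cons pl orbT.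
Qed.

(* [C] is a finite-dimensional cylinder event ending with [w t \in E]. *)
Definition pcyl t (C : set (@Dpath R)) (E : set (\bar R)) : Prop :=
  exists t0 B0 l, [/\ [/\ 0 < t0, measurable B0 & B0 `<=` [set z | (0 < z)%E]],
    all (fun p => 0 < p.1) l, (forall p, p \in l -> measurable p.2),
    t = end_time t0 l /\ E = last B0 (map snd l) &
    C = ((fun w : R -> \bar R => w t0) @^-1` B0) `&` cyl t0 l].

Lemma pcyl_gt0 t C E : pcyl t C E -> 0 < t.
Proof. by move=> [t0 [B0 [l [[t00 _ _] hl _ [-> _] _]]]]; exact: end_time_gt0. Qed.

Lemma pcyl_measurable t C E : pcyl t C E -> measurable C.
Proof.
move=> [t0 [B0 [l [[t00 mB0 _] hl ml _ ->]]]].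
by apply: measurableI; [exact: coord_measurable|exact: cyl_measurable].
Qed.

Lemma pcyl_init t B : 0 < t -> measurable B -> B `<=` [set z | (0 < z)%E] ->
  pcyl t ((fun w : R -> \bar R => w t) @^-1` B) B.
Proof. by move=> t0 mB hB; exists t, B, [::]; split => //=; rewrite setIT. Qed.

Lemma pcyl_step t s C E B : pcyl t C E -> t < s -> measurable B ->
  pcyl s (C `&` (fun w : R -> \bar R => w s) @^-1` B) B.
Proof.
move=> [t0 [B0 [l [hB0 hl ml [-> _] ->]]]] ts mB.
set t' := end_time t0 l in ts *.
have e : s = t' + (s - t') by rewrite addrC subrK.
exists t0, B0, (rcons l (s - t', B)); split => //.
- by rewrite all_rcons /= subr_gt0 ts.
- by move=> p; rewrite mem_rcons in_cons => /predU1P[-> //|]; exact: ml.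
- split; last by rewrite map_rcons last_rcons.
  by rewrite /end_time foldl_rcons -/(end_time t0 l) -/t' -e.
- by rewrite -cats1 cyl_cat setIA/= -/t' -e setIT.
Qed.

Lemma pcyl_restrict t C E D : pcyl t C E -> measurable D ->
  pcyl t (C `&` (fun w : R -> \bar R => w t) @^-1` D) (E `&` D).
Proof.
move=> [t0 [B0 [l [[t00 mB0 hB0] hl ml [-> ->] ->]]]] mD.
case/lastP: l hl ml => [|l [s B]] hl ml.
  exists t0, (B0 `&` D), [::]; split => //=.
  - by split => //; [exact: measurableI|move=> z [/hB0]].
  - by rewrite !setIT.
have [hs hl'] : 0 < s /\ all (fun p => 0 < p.1) l.
  by move: hl; rewrite all_rcons => /andP[].
exists t0, B0, (rcons l (s, B `&` D)); split => //.
- by rewrite all_rcons/= hs.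
- move=> p; rewrite mem_rcons in_cons => /predU1P[->/=|pl].
    by apply: measurableI => //; apply: (ml (s, B)); rewrite mem_rcons mem_head.
  by apply: ml; rewrite mem_rcons in_cons pl orbT.
- by rewrite !map_rcons !last_rcons; split => //; rewrite /end_time !foldl_rcons.
- rewrite -!cats1 !cyl_cat/= !setIT.
  have -> : end_time t0 (l ++ [:: (s, B)]) = end_time t0 l + s.
    by rewrite /end_time foldl_cat.
  by rewrite -!setIA; congr (_ `&` (_ `&` _)); rewrite preimage_setI.
Qed.

End cylinders.

Lemma measurable_ereal_ge {R : realType} (a : \bar R) : measurable [set z | (a <= z)%E].
Proof.
rewrite (_ : [set z | (a <= z)%E] = `[a, +oo[%classic); first exact: emeasurable_itv.
by apply/seteqP; split=> z /=; rewrite in_itv/= ?andbT.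
Qed.

Lemma measurable_ereal_lt {R : realType} (a : \bar R) : measurable [set z | (z < a)%E].
Proof.
rewrite (_ : [set z | (z < a)%E] = `]-oo, a[%classic); first exact: emeasurable_itv.
by apply/seteqP; split=> z /=; rewrite in_itv/= ?andbT.
Qed.

Lemma measurable_ereal_gt {R : realType} (a : \bar R) : measurable [set z | (a < z)%E].
Proof.
rewrite (_ : [set z | (a < z)%E] = `]a, +oo[%classic); first exact: emeasurable_itv.
by apply/seteqP; split=> z /=; rewrite in_itv/= ?andbT.
Qed.

Lemma measurable_ereal_le {R : realType} (a : \bar R) : measurable [set z | (z <= a)%E].
Proof.
rewrite (_ : [set z | (z <= a)%E] = `]-oo, a]%classic); first exact: emeasurable_itv.
by apply/seteqP; split=> z /=; rewrite in_itv/= ?andbT.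
Qed.

Section markov.
Context {R : realType}.
Variables (ell : R -> {measure set (\bar R) -> \bar R}).
Variables (K : R -> \bar R -> {measure set (\bar R) -> \bar R}).
Variable N : {measure set (@Dpath R) -> \bar R}.
Hypothesis hNfdd : forall (t : R) (B : set (\bar R)) (l : seq (R * set (\bar R))),
  0 < t -> measurable B -> B `<=` [set z | (0 < z)%E] ->
  all (fun p => 0 < p.1) l -> (forall p, p \in l -> measurable p.2) ->
  N (((fun w : R -> \bar R => w t) @^-1` B) `&` cyl t l) =
    (\int[ell t]_(y in B) fdd_iter K y l)%E.
Local Open Scope ereal_scope.
Import HBNNSimple.

(* Sub-Markov inequality. Since the kernels are not assumed measurable, only
   superadditivity of the lower integral is available. *)
Lemma markov_le t C E s (g : \bar R -> \bar R) (c : R) : pcyl t C E -> (t < s)%R ->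
  measurable_fun [set: \bar R] g -> (forall z, 0 <= g z) -> (0 <= c)%R ->
  (forall z, E z -> \int[K (s - t) z]_x g x <= c%:E) ->
  \int[N]_(w in C) g (w s) <= c%:E * N C.
Proof.
move=> pC ts mg g0 c0 hc.
have t0 := pcyl_gt0 pC; have mC := pcyl_measurable pC.
have mX : measurable_fun [set: @Dpath R] (fun w : Dpath => w s).
  by apply: measurable_coord; exact: lt_trans ts.
suff : \int[N]_(w in C) (g (w s) * (cst 1%R w)%:E) <= c%:E * N C.
  by under eq_integral do rewrite mule1.
apply: (integral_comp_ub mC mX) => // h hg.
rewrite integral_nnsfun_comp//.
case: pC => [u [B0 [l [[u0 mB0 hB0] hl ml [te Ee] Ce]]]].
pose J (F : \bar R -> \bar R) := \int[ell u]_(y in B0) fdd_fun K y l F.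
have J_le F F' : (forall z, 0 <= F z) -> (forall z, E z -> F z <= F' z) -> J F <= J F'.
  move=> F0 FF'; apply: le_lower_integral => y By; first exact: fdd_fun_ge0.
  by apply: (@fdd_fun_le _ _ _ _ _ _ B0) => //; rewrite -Ee.
have JZ F (a : R) : (0 <= a)%R -> (forall z, 0 <= F z) ->
    J (fun z => a%:E * F z) = a%:E * J F.
  move=> a0 F0; rewrite /J; under eq_integral do rewrite fdd_funZl//.
  by rewrite lower_integralZl// => y _; exact: fdd_fun_ge0.
have JD F F' : (forall z, 0 <= F z) -> (forall z, 0 <= F' z) ->
    J F + J F' <= J (fun z => F z + F' z).
  move=> F0 F'0; apply: le_trans (lower_integralD_ge _ _ _) _;
    try by move=> z _; exact: fdd_fun_ge0.
  apply: le_lower_integral => z _; last exact: fdd_funD_ge.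
  by apply: adde_ge0; exact: fdd_fun_ge0.
have NJ D : measurable D -> N (C `&` (fun w : Dpath => w s) @^-1` D) =
    J (fun z => K (s - t) z D).
  move=> mD; have := @hNfdd u B0 (l ++ [:: ((s - t)%R, D)]) u0 mB0 hB0.
  rewrite all_cat hl/= subr_gt0 ts => /(_ isT) hh.
  rewrite cyl_cat setIA -Ce/= -te setIT in hh.
  have e : (t + (s - t) = s)%R by rewrite addrC subrK.
  rewrite e in hh; rewrite hh; last first.
    by move=> p; rewrite mem_cat mem_seq1 => /orP[/ml//|/eqP ->].
  apply: eq_integral => y _; rewrite fdd_iter_cat/=; congr fdd_fun; apply/funext => z.
  by rewrite integral_cst// mul1e.
have NJ1 : N C = J (cst 1).
  have := @hNfdd u B0 l u0 mB0 hB0 hl ml; rewrite -Ce => ->.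
  by apply: eq_integral => y _; rewrite -[l in LHS]cats0 fdd_iter_cat.
have mh y : measurable (h @^-1` [set y]) by exact: measurable_sfunP.
apply: (@le_trans _ _ (J (fun z => sintegral (K (s - t) z) h))); last first.
  rewrite NJ1 -JZ//; apply: J_le => z; first exact: sintegral_ge0.
  move=> Ez; rewrite mule1; apply: le_trans (hc _ Ez).
  rewrite -integralT_nnsfun; apply: ge0_le_integral => //.
    by move=> x _; rewrite lee_fin.
  exact/measurable_EFinP.
have -> : (fun z => sintegral (K (s - t) z) h) =
    (fun z => \sum_(y <- fset_set (range h)) y%:E * K (s - t) z (h @^-1` [set y])).
  by apply/funext => z; rewrite sintegralE fsbig_finite.
have : forall y, y \in enum_fset (fset_set (range h)) -> (0 <= y)%R.
  move=> y yh; have : y \in fset_set (range h) by [].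
  by rewrite in_fset_set// => /set_mem [z _ <-]; exact: fun_ge0.
move: (enum_fset (fset_set (range h))) => r.
elim: r => [_|y r IH hr].
  by rewrite big_nil; apply: integral_ge0 => ? _; apply: fdd_fun_ge0 => z; rewrite big_nil.
have y0 : (0 <= y)%R by apply: hr; exact: mem_head.
have r0 x : x \in r -> (0 <= x)%R by move=> xr; apply: hr; rewrite in_cons xr orbT.
rewrite big_cons; apply: le_trans (leeD2l _ (IH r0)) _.
have mA : measurable (C `&` (fun w : Dpath => w s) @^-1` (h @^-1` [set y])).
  by apply: measurableI => //; rewrite -[_ @^-1` _]setTI; apply: mX.
have -> : \int[N]_(w in C `&` (fun w : Dpath => w s) @^-1` (h @^-1` [set y])) (cst 1%R w)%:E =
    N (C `&` (fun w : Dpath => w s) @^-1` (h @^-1` [set y])).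
  exact: etrans (integral_cst N mA 1) (mul1e _).
rewrite NJ// -JZ//.
apply: le_trans (JD _ _ _ _) _.
- by move=> z; rewrite mule_ge0 ?lee_fin.
- by move=> z; rewrite big_seq; apply: sume_ge0 => x /r0 x0; rewrite mule_ge0 ?lee_fin.
apply: J_le => z.
  rewrite adde_ge0 ?mule_ge0 ?lee_fin//.
  by rewrite big_seq; apply: sume_ge0 => x /r0 x0; rewrite mule_ge0 ?lee_fin.
by rewrite big_cons.
Qed.

Hypothesis Npos : forall t : R, (0 < t)%R -> N [set w : Dpath | w t < 0] = 0.

Lemma markov_comp_le t C E s (g : \bar R -> \bar R) (h : \bar R -> R) :
  pcyl t C E -> (t < s)%R -> N C < +oo ->
  measurable_fun [set: \bar R] g -> (forall z, 0 <= g z) ->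
  measurable_fun [set: \bar R] h -> (forall z, 0 <= h z <= 1)%R ->
  (forall z, 0 <= z -> \int[K (s - t) z]_x g x <= (h z)%:E) ->
  \int[N]_(w in C) g (w s) <= \int[N]_(w in C) (h (w t))%:E.
Proof.
move=> pC ts NC mg g0 mh h01 hgh.
have t0 := pcyl_gt0 pC; have mC := pcyl_measurable pC.
have mX u : (0 < u)%R -> measurable_fun [set: @Dpath R] (fun w : Dpath => w u).
  by move=> u0; apply: measurable_coord.
have s0 := lt_trans t0 ts.
have NCf : N C \is a fin_num by rewrite ge0_fin_numE.
apply/lee_addgt0Pr => e e0.
pose n := (Num.truncn (fine (N C) / e)).+1.
have n0 : (0 < n%:R :> R)%R by rewrite ltr0n.
have ne : n%:R^-1%:E * N C <= e%:E.
  rewrite -(fineK NCf) -EFinM lee_fin mulrC ler_pdivrMr//.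
  rewrite -ler_pdivrMl// mulrC ltW//; exact: truncnS_gt.
pose D (i : nat) : set (\bar R) :=
  [set z | 0 <= z] `&` [set z | (i%:R / n%:R <= h z < i.+1%:R / n%:R)%R].
have mD i : measurable (D i).
  apply: measurableI.
    exact: measurable_ereal_ge.
  have := mh measurableT _ (measurable_itv `[(i%:R / n%:R : R)%R, (i.+1%:R / n%:R)%R[).
  rewrite setTI (_ : h @^-1` _ = [set z | (i%:R / n%:R <= h z < i.+1%:R / n%:R)%R])//.
pose F i : set (@Dpath R) := C `&` (fun w : Dpath => w t) @^-1` (D i).
have pF i : pcyl t (F i) (E `&` D i) by exact: pcyl_restrict.
have mF i : measurable (F i) by exact: pcyl_measurable (pF i).
pose U := \big[setU/set0]_(i <- iota 0 n.+1) F i.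
have triv : trivIset [set` iota 0 n.+1] F.
  move=> i j _ _ [w [[_ [_ /= /andP[a1 a2]]] [_ [_ /= /andP[b1 b2]]]]].
  have hn k l : ((k%:R / n%:R : R) < l.+1%:R / n%:R)%R -> (k <= l)%N.
    by rewrite ltr_pM2r ?invr_gt0// ltr_nat.
  apply/eqP; rewrite eqn_leq; apply/andP; split; apply: hn.
    exact: le_lt_trans b2.
  exact: le_lt_trans a2.
have CU : C `<=` U `|` [set w : Dpath | w t < 0].
  move=> w Cw; have [wt|wt] := leP 0 (w t); last by right.
  left; rewrite /U -bigcup_seq.
  have /andP[h0 h1] := h01 (w t).
  have nh0 : (0 <= n%:R * h (w t))%R by rewrite mulr_ge0.
  have /andP[k1 k2] := truncn_itv nh0.
  exists (Num.truncn (n%:R * h (w t))).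
    suff : Num.truncn (n%:R * h (w t)) \in iota 0 n.+1 by [].
    rewrite mem_iota add0n leq0n/= truncn_lt_nat// (@le_lt_trans _ _ n%:R)//.
      by rewrite ler_piMr.
    by rewrite ltr_nat.
  by split => //; split => //=; rewrite ler_pdivrMr// ltr_pdivlMr// [(h _ * _)%R]mulrC k1.
have UC : U `<=` C by rewrite /U -bigcup_seq; move=> w [i _ []].
have mU : measurable U by apply: bigsetU_measurable => i _.
have mneg : measurable ([set w : Dpath | w t < 0] : set (@Dpath R)).
  exact: (coord_measurable t0 (measurable_ereal_lt 0)).
have mgs : measurable_fun [set: @Dpath R] (fun w : Dpath => g (w s)).
  by apply: (measurableT_comp mg); exact: mX.
have mht : measurable_fun [set: @Dpath R] (fun w : Dpath => (h (w t))%:E).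
  by apply/measurable_EFinP; apply: (measurableT_comp mh); exact: mX.
apply: (@le_trans _ _ (\int[N]_(w in U) g (w s))).
  apply: (@le_trans _ _ (\int[N]_(w in U `|` [set w : Dpath | w t < 0]) g (w s))).
    apply: ge0_subset_integral => //; first exact: measurableU.
    exact: measurable_funTS.
  rewrite ge0_integral_setU//; last 2 first.
  - exact: measurable_funTS.
  - apply/disj_setPS => w [Uw /= wt]; move: Uw; rewrite /U -bigcup_seq => -[i _ [_ [/=]]].
    by rewrite leNgt wt.
  rewrite [X in _ + X]null_set_integral ?adde0//; last exact: Npos.
  exact: measurable_funTS.
apply: (@le_trans _ _ (\int[N]_(w in U) ((h (w t))%:E + n%:R^-1%:E))); last first.
  rewrite ge0_integralD//; last 2 first.
  - by move=> w _; rewrite lee_fin; have /andP[] := h01 (w t).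
  - exact: measurable_funTS.
  apply: leeD.
    apply: ge0_subset_integral => //; first exact: measurable_funTS.
    by move=> w _; rewrite lee_fin; have /andP[] := h01 (w t).
  rewrite integral_cst//; apply: le_trans ne; apply: lee_wpmul2l.
    by rewrite lee_fin invr_ge0.
  by apply: le_measure; rewrite ?inE.
rewrite /U ge0_integral_bigsetU//; last 2 first.
- exact: iota_uniq.
- exact: measurable_funTS.
rewrite [leRHS]ge0_integral_bigsetU//; last 3 first.
- exact: iota_uniq.
- by apply: emeasurable_funD => //; exact: measurable_funTS.
- by move=> w _; rewrite -EFinD lee_fin addr_ge0 ?invr_ge0//; have /andP[] := h01 (w t).
apply: lee_sum => i _.
have i0 : (0 <= i.+1%:R / n%:R :> R)%R by rewrite divr_ge0.
apply: (@le_trans _ _ ((i.+1%:R / n%:R)%:E * N (F i))).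
  apply: (markov_le (pF i) ts) => // z [_ [/= z0 /andP[_ hz]]].
  by apply: le_trans (hgh _ z0) _; rewrite lee_fin ltW.
rewrite -integral_cst//; apply: ge0_le_integral => //.
- by apply: emeasurable_funD => //; exact: measurable_funTS.
move=> w [_ [_ /= /andP[hw _]]].
by rewrite -EFinD lee_fin -natr1 mulrDl mul1r lerD2r.
Qed.

Definition hits (ts : seq R) (D : R -> set (\bar R)) : set (@Dpath R) :=
  [set w : Dpath | exists2 q, q \in ts & D q (w q)].

Lemma hits_measurable ts D : all (fun q => 0 < q)%R ts ->
  (forall q, measurable (D q)) -> measurable (hits ts D).
Proof.
move=> ts0 mD.
rewrite (_ : hits ts D = \big[setU/set0]_(q <- ts | (0 < q)%R) ((fun w : Dpath => w q) @^-1` (D q))).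
  by apply: bigsetU_measurable => q q0; exact: coord_measurable.
rewrite -bigcup_seq_cond; apply/seteqP; split => w.
  by move=> [q qts Dw]; exists q => //=; rewrite qts; exact: (allP ts0).
by move=> [q /= /andP[qts _] Dw]; exists q.
Qed.

Lemma first_hit_le t C E (ts : seq R) T D (g : \bar R -> \bar R) (e : R) :
  pcyl t C E -> path <%R t ts -> all (fun q => q < T)%R ts ->
  (forall q, measurable (D q)) ->
  measurable_fun [set: \bar R] g -> (forall z, 0 <= g z) -> (0 <= e)%R ->
  (forall q z, q \in ts -> D q z -> \int[K (T - q) z]_x g x <= e%:E) ->
  \int[N]_(w in C `&` hits ts D) g (w T) <= e%:E * N (C `&` hits ts D).
Proof.
move=> + + + mD mg g0 e0.
elim: ts t C E => [|q ts IH] t C E pC /=.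
  move=> _ _ _; rewrite (_ : C `&` _ = set0) ?integral_set0 ?measure0 ?mule0//.
  by apply/seteqP; split => w // [_ []].
move=> /andP[tq pts] /andP[qT tsT] hD.
have t0 := pcyl_gt0 pC; have q0 := lt_trans t0 tq; have T0 := lt_trans q0 qT.
have pA := pcyl_step pC tq (mD q).
have pB := pcyl_step pC tq (measurableC (mD q)).
set A := C `&` _ in pA; set B := C `&` _ in pB.
have mA := pcyl_measurable pA; have mB := pcyl_measurable pB.
have ts0 : all (fun q => 0 < q)%R ts.
  apply/allP => x xts; apply: lt_trans q0 _.
  by have /allP := order_path_min lt_trans pts; exact.
have mH := hits_measurable ts0 mD.
have -> : C `&` hits (q :: ts) D = A `|` (B `&` hits ts D).
  apply/seteqP; split => w.
    move=> [Cw [x]]; rewrite in_cons => /predU1P[-> Dw|xts Dw]; first by left; split.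
    have [Dq|nDq] := pselect (D q (w q)); first by left; split.
    by right; split; [split|exists x].
  move=> [[Cw Dq]|[[Cw _] [x xts Dx]]]; split => //.
    by exists q => //; rewrite mem_head.
  by exists x => //; rewrite in_cons xts orbT.
have dis : [disjoint A & B `&` hits ts D].
  by apply/disj_setPS => w [[_ /= Dw] [[_ /= nDw] _]].
have mgT : measurable_fun [set: @Dpath R] (fun w : Dpath => g (w T)).
  by apply: (measurableT_comp mg); apply: measurable_coord.
rewrite ge0_integral_setU//; [|exact: measurableI|exact: measurable_funTS].
rewrite measureU//; [|exact: measurableI|by apply/eqP].
rewrite ge0_muleDr//; apply: leeD.
  apply: (markov_le pA) => // z Dz; apply: hD => //; exact: mem_head.
apply: (IH q B _ pB pts tsT) => x z xts; apply: hD; by rewrite in_cons xts orbT.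
Qed.

End markov.

Section laplace.
Context {R : realType}.
Implicit Types (lam c v x : R) (z : \bar R).

(* [elap] is only meaningful on [0, oo]; [lap] extends it by 1 to the left of 0. *)
Definition lap lam z : R := if z == +oo%E then 0 else expR (- (lam * fine (maxe 0%E z))).

Lemma lap_elap lam z : (0 <= z)%E -> lap lam z = elap lam z.
Proof. by case: z => [r| |] //= r0; rewrite /lap/= max_r. Qed.

Lemma fine_max_ge0 z : 0 <= fine (maxe 0%E z).
Proof. by rewrite fine_ge0// le_max lexx. Qed.

Lemma fine_max_EFin (r : R) : fine (maxe 0%E r%:E) = Num.max 0 r.
Proof. by rewrite !maxEle lee_fin; case: ifP. Qed.

Lemma lap_ge0 lam z : 0 <= lap lam z.
Proof. by rewrite /lap; case: ifPn => // _; exact: expR_ge0. Qed.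

Lemma lap_le1 lam z : 0 <= lam -> lap lam z <= 1.
Proof.
move=> l0; rewrite /lap; case: ifPn => // _.
by rewrite expR_le1 oppr_le0 mulr_ge0// fine_max_ge0.
Qed.

Lemma measurable_fun_lap lam : measurable_fun [set: \bar R] (lap lam).
Proof.
apply: measurable_fun_ifT => //; first exact: measurable_fun_eqe.
apply: measurableT_comp => //; apply: measurableT_comp => //.
apply: measurable_funM => //; apply: measurableT_comp => //.
exact: measurable_maxe.
Qed.

Lemma measurable_fun_elap lam : measurable_fun [set: \bar R] (elap lam).
Proof.
rewrite (_ : elap lam = fun z => if z == +oo%E then 0 else
  if z == -oo%E then 0 else expR (- (lam * fine z))); last by apply/funext => -[].
apply: measurable_fun_ifT => //; first exact: measurable_fun_eqe.
apply: measurable_fun_ifT => //; first exact: measurable_fun_eqe.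
by apply: measurableT_comp => //; apply: measurableT_comp => //; exact: measurable_funM.
Qed.

Lemma lap_le_expR lam x z : 0 <= lam -> 0 <= x -> (x%:E <= z)%E -> lap lam z <= expR (- (lam * x)).
Proof.
move=> l0 x0; rewrite /lap; case: z => [r| |].
- rewrite lee_fin/= fine_max_EFin => xr; rewrite ler_expR lerN2 ler_wpM2l//.
  by rewrite max_r// (le_trans x0).
- by move=> _; rewrite eqxx expR_ge0.
- by rewrite leeNy_eq.
Qed.

Lemma lap_ge_linear lam x z : 0 <= lam -> 0 <= x -> (z <= x%:E)%E -> 1 - lap lam z <= lam * x.
Proof.
move=> l0 x0; rewrite /lap; case: z => [r| |]//=.
  rewrite lee_fin fine_max_EFin => rx.
  have := expR_ge1Dx (- (lam * Num.max 0 r)).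
  have : lam * Num.max 0 r <= lam * x by rewrite ler_wpM2l// ge_max x0.
  lra.
by move=> _; rewrite ?maxeNy/= mulr0 oppr0 expR0 subrr mulr_ge0.
Qed.

Lemma lap_lipschitz v c z : 0 < v -> v <= c -> lap v z <= lap c z + (c / v - 1).
Proof.
move=> v0 vc; have cv : 0 <= c / v - 1 by rewrite subr_ge0 ler_pdivlMr// mul1r.
rewrite /lap; case: ifPn => [_|_]; first by rewrite add0r.
set x := fine _; have x0 : 0 <= x := fine_max_ge0 z.
have h1 := expR_ge1Dx (- ((c - v) * x)).
have h2 : expR (- (c * x)) = expR (- (v * x)) * expR (- ((c - v) * x)).
  by rewrite -expRD; congr expR; ring.
have h3 : expR (- (v * x)) * (1 - (c - v) * x) <= expR (- (c * x)).
  by rewrite h2 ler_pM2l ?expR_gt0.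
have h4 : expR (- (v * x)) * (v * x) <= 1.
  have e1 : expR (- (v * x)) * expR (v * x) = 1 by rewrite -expRD addNr expR0.
  rewrite -[leRHS]e1 ler_pM2l ?expR_gt0//.
  by have := expR_ge1Dx (v * x); lra.
have h5 : (c / v - 1) * (expR (- (v * x)) * (v * x)) <= (c / v - 1) * 1.
  by rewrite ler_wpM2l.
have h6 : (c / v - 1) * (expR (- (v * x)) * (v * x)) = expR (- (v * x)) * ((c - v) * x).
  by field; rewrite gt_eqF.
by lra.
Qed.

Lemma integral_lapC (m : {measure set (\bar R) -> \bar R}) lam (r : R) : 0 <= lam ->
  m setT = 1%E -> (\int[m]_z (lap lam z)%:E = r%:E)%E ->
  (\int[m]_z (1 - lap lam z)%:E = (1 - r)%:E)%E.
Proof.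
move=> l0 m1 hr.
have ml : measurable_fun [set: \bar R] (EFin \o lap lam).
  by apply/measurable_EFinP; exact: measurable_fun_lap.
have : (\int[m]_z ((1 - lap lam z)%:E + (lap lam z)%:E) = 1)%E.
  under eq_integral do rewrite -EFinD subrK.
  by rewrite integral_cst// mul1e m1.
rewrite ge0_integralD//; last 3 first.
- by move=> z _; rewrite lee_fin subr_ge0 lap_le1.
- apply/measurable_EFinP; apply: measurable_funB => //; exact: measurable_fun_lap.
- by move=> z _; rewrite lee_fin lap_ge0.
rewrite hr => e; rewrite EFinB -e addeK//.
Qed.

End laplace.

Section grid.
Context {R : realType}.

Definition gr (s n j : nat) : R := s.+1%:R + j%:R / 2 ^+ n.

Definition grid (s n : nat) : seq R := [seq gr s n j | j <- iota 0 (n * 2 ^ n).+1].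

Lemma gr_ge s n j : s.+1%:R <= gr s n j.
Proof. by rewrite lerDl divr_ge0// exprn_ge0. Qed.

Lemma gr_gt0 s n j : 0 < gr s n j.
Proof. exact: lt_le_trans (gr_ge s n j). Qed.

Lemma gr_shift s s' n j : gr (s + s') n j = gr s n (s' * 2 ^ n + j).
Proof.
rewrite /gr -addSn natrD -addrA; congr (_ + _); rewrite natrD mulrDl natrM natrX.
by rewrite mulfK// expf_neq0// pnatr_eq0.
Qed.

Lemma gr_refine s n n' j : (n <= n')%N -> gr s n j = gr s n' (j * 2 ^ (n' - n)).
Proof.
move=> nn; rewrite /gr; congr (_ + _); rewrite natrM natrX.
rewrite -{2}(subnK nn) exprD.
have h k : (2 : R) ^+ k != 0 by rewrite expf_neq0// pnatr_eq0.
by field; rewrite !h.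
Qed.

Lemma grid_lt s n q : q \in grid s n -> q < (s + n).+2%:R.
Proof.
move=> /mapP [j]; rewrite mem_iota add0n ltnS => /andP[_ jn] ->.
rewrite /gr -[X in _ < X]natr1 (@le_lt_trans _ _ (s.+1%:R + n%:R))//.
  rewrite lerD2l ler_pdivrMr ?exprn_gt0// -natrX -natrM ler_nat//.
by rewrite -natrD addSn ltrDl.
Qed.

Lemma grid_ge s n q : q \in grid s n -> s.+1%:R <= q.
Proof. by move=> /mapP [j _ ->]; exact: gr_ge. Qed.

Lemma grid_path t s n : t < s.+1%:R -> path <%R t (grid s n).
Proof.
move=> ts; rewrite path_sortedE; last exact: lt_trans.
apply/andP; split.
  by apply/allP => q /grid_ge; exact: lt_le_trans.
rewrite /grid; apply: (homo_sorted (e := ltn)) (iota_ltn_sorted 0 _).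
by move=> i j ij; rewrite ltrD2l ltr_pM2r ?ltr_nat// invr_gt0 exprn_gt0.
Qed.

Lemma gr_grid s n j : exists2 n', (n <= n')%N & gr s n j \in grid s n'.
Proof.
exists (maxn n j); first exact: leq_maxl.
rewrite (@gr_refine _ _ (maxn n j)) ?leq_maxl//; apply: map_f.
rewrite mem_iota add0n leq0n/= ltnS leq_mul ?leq_maxr// leq_pexp2l//.
exact: leq_subr.
Qed.

Lemma grid_mono s n n' : (n <= n')%N -> {subset grid s n <= grid s n'}.
Proof.
move=> nn q /mapP [j]; rewrite mem_iota add0n ltnS => /andP[_ jn] ->.
rewrite (@gr_refine _ _ n')//; apply: map_f.
rewrite mem_iota add0n leq0n/= ltnS.
apply: (@leq_trans ((n * 2 ^ n) * 2 ^ (n' - n))); first by rewrite leq_mul2r jn orbT.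
by rewrite -mulnA -expnD subnKC// leq_mul2r nn orbT.
Qed.

Definition io (D : R -> set (\bar R)) : set (@Dpath R) :=
  [set w : Dpath | forall s, exists n j, D (gr s n j) (w (gr s n j))].

Definition hitall s (D : R -> set (\bar R)) : set (@Dpath R) :=
  \bigcup_n hits (grid s n) D.

Lemma grid_hits_measurable s n D : (forall q, measurable (D q)) ->
  measurable (hits (grid s n) D).
Proof.
move=> mD; apply: hits_measurable => //; apply/allP => q /grid_ge; exact: lt_le_trans.
Qed.

Lemma ioE D : io D = \bigcap_s hitall s D.
Proof.
apply/seteqP; split => w.
  move=> h s _; have [n [j hj]] := h s; have [n' nn hn'] := gr_grid s n j.
  by exists n' => //; exists (gr s n j).
move=> h s; have [n _ [q /mapP [j _ ->] hq]] := h s I; by exists n, j.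
Qed.

Lemma io_measurable D : (forall q, measurable (D q)) -> measurable (io D).
Proof.
move=> mD; rewrite ioE; apply: bigcapT_measurable => s.
by apply: bigcupT_measurable => n; exact: grid_hits_measurable.
Qed.

Lemma not_io D (w : Dpath) : ~ io D w -> exists s, forall s' n j, (s <= s')%N ->
  ~ D (gr s' n j) (w (gr s' n j)).
Proof.
move=> /existsNP [s hs]; exists s => s' n j ss hD; apply: hs.
by exists n, ((s' - s) * 2 ^ n + j)%N; rewrite -gr_shift subnKC.
Qed.

End grid.

Section io_bound.
Context {R : realType}.
Variables (ell : R -> {measure set (\bar R) -> \bar R}).
Variables (K : R -> \bar R -> {measure set (\bar R) -> \bar R}).
Variable N : {measure set (@Dpath R) -> \bar R}.
Hypothesis hNfdd : forall (t : R) (B : set (\bar R)) (l : seq (R * set (\bar R))),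
  0 < t -> measurable B -> B `<=` [set z | (0 < z)%E] ->
  all (fun p => 0 < p.1) l -> (forall p, p \in l -> measurable p.2) ->
  N (((fun w : R -> \bar R => w t) @^-1` B) `&` cyl t l) =
    (\int[ell t]_(y in B) fdd_iter K y l)%E.
Local Open Scope ereal_scope.
Hypothesis Npos : forall t : R, (0 < t)%R -> N [set w : Dpath | w t < 0] = 0.

Lemma io_le t C E D (g : R -> \bar R -> R) (h : \bar R -> R) :
  pcyl t C E -> N C < +oo -> (forall q, measurable (D q)) ->
  (forall T, measurable_fun [set: \bar R] (g T)) -> (forall T z, 0 <= g T z <= 1)%R ->
  measurable_fun [set: \bar R] h -> (forall z, 0 <= h z <= 1)%R ->
  (forall T z, (t < T)%R -> 0 <= z -> \int[K (T - t) z]_x (1 - g T x)%:E <= (h z)%:E) ->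
  (forall e, (0 < e)%R -> exists s0 : R, forall q T z, (s0 <= q)%R -> (t < q)%R -> (q < T)%R ->
     D q z -> \int[K (T - q) z]_x (g T x)%:E <= e%:E) ->
  N (C `&` io D) <= \int[N]_(w in C) (h (w t))%:E.
Proof.
move=> pC NC mD mg g01 mh h01 hgh hD.
have t0 := pcyl_gt0 pC; have mC := pcyl_measurable pC.
have NCf : N C \is a fin_num by rewrite ge0_fin_numE.
apply/lee_addgt0Pr => e e0.
pose e' := (e / (fine (N C) + 1))%R.
have NC0 : (0 <= fine (N C))%R by exact: fine_ge0.
have e'0 : (0 < e')%R by rewrite divr_gt0// ltr_wpDl.
have [s0 hs0] := hD _ e'0.
pose s := Num.truncn (Num.max s0 t).
have sS : (Num.max s0 t < s.+1%:R)%R by exact: truncnS_gt.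
have s0s : (s0 < s.+1%:R)%R by apply: le_lt_trans sS; rewrite le_max lexx.
have ts : (t < s.+1%:R)%R by apply: le_lt_trans sS; rewrite le_max lexx orbT.
have mH n := @grid_hits_measurable R s n D mD.
apply: (@le_trans _ _ (N (C `&` hitall s D))).
  apply: le_measure; rewrite ?inE//.
  - by apply: measurableI => //; exact: io_measurable.
  - by apply: measurableI => //; exact: bigcupT_measurable.
  - by move=> w [Cw]; rewrite ioE => /(_ s I).
rewrite /hitall setI_bigcupr.
have cv : N (C `&` hits (grid s n) D) @[n --> \oo] --> N (\bigcup_n (C `&` hits (grid s n) D)).
  apply: nondecreasing_cvg_mu.
  - by move=> n; exact: measurableI.
  - by apply: bigcupT_measurable => n; exact: measurableI.
  - move=> n n' nn; apply/subsetPset => w [Cw [q qg Dq]]; split => //.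
    by exists q => //; exact: grid_mono qg.
rewrite -(cvg_lim _ cv)//; apply: lime_le; first by apply/cvg_ex; eexists; exact: cv.
apply: nearW => n /=.
set T : R := (s + n).+2%:R.
have tT : (t < T)%R by apply: lt_trans ts _; rewrite ltr_nat !ltnS leq_addr.
have mgT : measurable_fun [set: @Dpath R] (fun w : Dpath => g T (w T)).
  by apply: (measurableT_comp (mg T)); apply: measurable_coord; exact: lt_trans tT.
have A1 : \int[N]_(w in C `&` hits (grid s n) D) (g T (w T))%:E <= e'%:E * N C.
  apply: le_trans (_ : e'%:E * N (C `&` hits (grid s n) D) <= _); last first.
    apply: lee_wpmul2l; first by rewrite lee_fin ltW.
    by apply: le_measure; rewrite ?inE//; exact: measurableI.
  apply: (first_hit_le hNfdd pC (grid_path n ts) (g := fun z => (g T z)%:E)) => //.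
  - by apply/allP => q; exact: grid_lt.
  - by apply/measurable_EFinP; exact: mg.
  - by move=> z; rewrite lee_fin; have /andP[] := g01 T z.
  - exact: ltW.
  - move=> q z qg; apply: hs0; last exact: grid_lt qg.
      exact: le_trans (ltW s0s) (grid_ge qg).
    exact: lt_le_trans ts (grid_ge qg).
have A2 : \int[N]_(w in C) (1 - g T (w T))%:E <= \int[N]_(w in C) (h (w t))%:E.
  apply: (markov_comp_le hNfdd Npos pC tT NC (g := fun z => (1 - g T z)%:E)) => //.
  - by apply/measurable_EFinP; apply: measurable_funB.
  - by move=> z; rewrite lee_fin subr_ge0; have /andP[] := g01 T z.
  - by move=> z; exact: hgh.
have mCH : measurable (C `&` hits (grid s n) D) by exact: measurableI.
have -> : N (C `&` hits (grid s n) D) =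
    \int[N]_(w in C `&` hits (grid s n) D) ((1 - g T (w T))%:E + (g T (w T))%:E).
  under eq_integral do rewrite -EFinD subrK.
  by rewrite integral_cst// mul1e.
rewrite ge0_integralD//; last 4 first.
- by move=> w _; rewrite lee_fin subr_ge0; have /andP[] := g01 T (w T).
- by apply: measurable_funTS; apply/measurable_EFinP; exact: measurable_funB.
- by move=> w _; rewrite lee_fin; have /andP[] := g01 T (w T).
- by apply: measurable_funTS; apply/measurable_EFinP.
apply: leeD.
  apply: le_trans A2; apply: ge0_subset_integral => //.
  - by apply: measurable_funTS; apply/measurable_EFinP; exact: measurable_funB.
  - by move=> w _; rewrite lee_fin subr_ge0; have /andP[] := g01 T (w T).
apply: le_trans A1 _; rewrite -(fineK NCf) -EFinM lee_fin /e' mulrAC ler_pdivrMr ?ltr_wpDl//.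
by rewrite ler_pM2l// lerDl.
Qed.

End io_bound.

Section excursion_limits.
Context {R : realType}.
Variables (Psi : R -> R) (lam0 : R).
Hypotheses (hP : admissible Psi) (hlam0 : 0 < lam0).
Variables (ell : R -> {measure set (\bar R) -> \bar R}).
Hypothesis hell0 : forall t, 0 < t -> ell t [set z | (z <= 0)%E] = 0%E.
Hypothesis hell : forall t lam v, 0 < t -> 0 < lam -> is_cum Psi t lam v ->
  (\int[ell t]_z (1 - elap lam z)%:E)%E = v%:E.
Variables (K : R -> \bar R -> {measure set (\bar R) -> \bar R}).
Hypothesis hK0 : forall s y, 0 < s -> (0 <= y)%E ->
  K s y [set z | (z < 0)%E] = 0%E /\ K s y setT = 1%E.
Hypothesis hK : forall s y lam v, 0 < s -> (0 <= y)%E -> 0 < lam -> is_cum Psi s lam v ->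
  (\int[K s y]_z (elap lam z)%:E)%E = (elap v y)%:E.
Variable N : {measure set (@Dpath R) -> \bar R}.
Hypothesis hNfdd : forall (t : R) (B : set (\bar R)) (l : seq (R * set (\bar R))),
  0 < t -> measurable B -> B `<=` [set z | (0 < z)%E] ->
  all (fun p => 0 < p.1) l -> (forall p, p \in l -> measurable p.2) ->
  N (((fun w : R -> \bar R => w t) @^-1` B) `&` cyl t l) =
    (\int[ell t]_(y in B) fdd_iter K y l)%E.
Hypothesis Npos : forall t : R, (0 < t)%R -> N [set w : Dpath | (w t < 0)%E] = 0%E.

Local Notation V := (vinv Psi lam0).

(* [up lam q] is {z >= 1/v_{-q}(lam)}, i.e. {e^q G(1/z) >= G(lam)}. *)
Definition up (lam q : R) : set (\bar R) := [set z | ((V q lam)^-1%:E <= z)%E].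
Definition dn (lam q : R) : set (\bar R) := [set z | (0 <= z)%E /\ (z <= (V q lam)^-1%:E)%E].

Lemma up_measurable lam q : measurable (up lam q).
Proof. exact: measurable_ereal_ge. Qed.

Lemma dn_measurable lam q : measurable (dn lam q).
Proof.
rewrite (_ : dn lam q = [set z | (0 <= z)%E] `&` [set z | (z <= (V q lam)^-1%:E)%E])//.
by apply: measurableI; [exact: measurable_ereal_ge|exact: measurable_ereal_le].
Qed.

Lemma kernel_lap s t z lam : s < t -> (0 <= z)%E -> 0 < lam ->
  (\int[K (t - s) z]_x (lap (V t lam) x)%:E = (lap (V s lam) z)%:E)%E.
Proof.
move=> st z0 l0; have ts0 : 0 < t - s by rewrite subr_gt0.
have Vt0 := vinv_gt0 hP hlam0 t lam.
have cum : is_cum Psi (t - s) (V t lam) (V s lam).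
  have := vinv_is_cum hP hlam0 s lam (ltW ts0).
  by rewrite [s + _]addrC subrK.
rewrite lap_elap// -(hK ts0 z0 Vt0 cum).
apply: ge0_ae_eq_integral => //.
- by apply/measurable_EFinP; exact: measurable_fun_lap.
- by apply/measurable_EFinP; exact: measurable_fun_elap.
- by move=> x _; rewrite lee_fin lap_ge0.
- by move=> [r| |] _; rewrite lee_fin//= expR_ge0.
exists [set x | (x < 0)%E]; split; first exact: measurable_ereal_lt.
  by have [] := hK0 ts0 z0.
move=> x /= /not_implyP [_ hx]; rewrite ltNge; apply/negP => x0; apply: hx.
by rewrite lap_elap.
Qed.

Lemma kernel_lapC s t z lam : s < t -> (0 <= z)%E -> 0 < lam ->
  (\int[K (t - s) z]_x (1 - lap (V t lam) x)%:E = (1 - lap (V s lam) z)%:E)%E.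
Proof.
move=> st z0 l0; apply: integral_lapC.
- by rewrite ltW// vinv_gt0.
- by have [] := hK0 (_ : 0 < t - s) z0; rewrite ?subr_gt0.
- exact: kernel_lap.
Qed.

Local Notation A lam := (io (up lam)).
Local Notation B lam := (io (dn lam)).

Let V_gt0 t lam : 0 < V t lam. Proof. exact: vinv_gt0. Qed.

Let Vinv t c : 0 < c -> V t (V (- t) c) = c.
Proof. by move=> c0; rewrite vinvD// addNr vinv0. Qed.

Let lap01 t lam z : 0 <= lap (V t lam) z <= 1.
Proof. by rewrite lap_ge0 lap_le1// ltW. Qed.

Let lapC01 t lam z : 0 <= 1 - lap (V t lam) z <= 1.
Proof. by have /andP[? ?] := lap01 t lam z; apply/andP; split; lra. Qed.

Let mlapC lam : measurable_fun [set: \bar R] (fun z => 1 - lap lam z).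
Proof. by apply: measurable_funB => //; exact: measurable_fun_lap. Qed.

Let ratio_ge lam lam' (k : R) : 0 < lam -> lam < lam' -> exists s0 : R,
  forall q, s0 <= q -> k * V q lam <= V q lam'.
Proof.
move=> l0 ll; have [M [_ hM]] := vinv_ratio_cvgy hP hlam0 k l0 ll.
by exists (M + 1) => q Mq; apply: hM; rewrite (lt_le_trans _ Mq)// ltrDl.
Qed.

Lemma N_up_le_aux t C E lam c : pcyl t C E -> (N C < +oo)%E -> 0 < lam -> V t lam < c ->
  (N (C `&` A lam) <= \int[N]_(w in C) (1 - lap c (w t))%:E)%E.
Proof.
move=> pC NC l0 Vc; have c0 : 0 < c := lt_trans (V_gt0 _ _) Vc.
set lam' := V (- t) c.
have l'0 : 0 < lam' by exact: V_gt0.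
have ce : c = V t lam' by rewrite Vinv.
have ll : lam < lam'.
  rewrite ltNge; apply/negP => /(vinv_le hP hlam0 t l'0).
  by rewrite -ce leNgt Vc.
rewrite ce.
apply: (io_le hNfdd Npos pC NC (up_measurable lam)
  (g := fun T z => lap (V T lam') z) (h := fun z => 1 - lap (V t lam') z)) => //.
- by move=> T; exact: measurable_fun_lap.
- by move=> T z tT z0; rewrite kernel_lapC.
move=> e e0.
have [s0 hs0] := ratio_ge (e^-1) l0 ll.
exists s0 => q T z sq tq qT; rewrite /up /= => zq.
have Vq := V_gt0 q lam.
have z0 : (0 <= z)%E by apply: le_trans zq; rewrite lee_fin invr_ge0 ltW.
rewrite kernel_lap// lee_fin.
apply: le_trans (lap_le_expR (ltW (V_gt0 _ _)) _ zq) _; first by rewrite invr_ge0 ltW.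
have h : e^-1 <= V q lam' / V q lam by rewrite ler_pdivlMr// hs0.
apply: le_trans (_ : expR (- e^-1) <= _); first by rewrite ler_expR lerN2.
rewrite expRN -[leRHS]invrK lef_pV2 ?posrE ?expR_gt0 ?invr_gt0//.
by have := expR_ge1Dx e^-1; lra.
Qed.

Lemma N_dn_le_aux t C E lam c : pcyl t C E -> (N C < +oo)%E -> 0 < c -> c < V t lam ->
  0 < lam ->
  (N (C `&` B lam) <= \int[N]_(w in C) (lap c (w t))%:E)%E.
Proof.
move=> pC NC c0 Vc l0.
set lam' := V (- t) c.
have l'0 : 0 < lam' by exact: V_gt0.
have ce : c = V t lam' by rewrite Vinv.
have ll : lam' < lam.
  rewrite ltNge; apply/negP => /(vinv_le hP hlam0 t l0).
  by rewrite -ce leNgt Vc.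
rewrite ce.
apply: (io_le hNfdd Npos pC NC (dn_measurable lam)
  (g := fun T z => 1 - lap (V T lam') z) (h := fun z => lap (V t lam') z)) => //.
- exact: measurable_fun_lap.
- move=> T z tT z0; under eq_integral do rewrite opprB addrC subrK.
  by rewrite kernel_lap.
move=> e e0.
have [s0 hs0] := ratio_ge (e^-1) l'0 ll.
exists s0 => q T z sq tq qT; rewrite /dn /= => -[z0 zq].
have Vq := V_gt0 q lam.
rewrite kernel_lapC// lee_fin.
apply: le_trans (lap_ge_linear (ltW (V_gt0 _ _)) _ zq) _; first by rewrite invr_ge0 ltW.
rewrite ler_pdivrMr//; have := hs0 _ sq.
by rewrite -ler_pdivlMl ?invr_gt0// invrK.
Qed.

Let mcoord t : 0 < t -> measurable_fun [set: @Dpath R] (fun w : Dpath => w t).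
Proof. exact: measurable_coord. Qed.

Let mlapw t lam D : 0 < t ->
  measurable_fun D (fun w : Dpath => (lap lam (w t))%:E : \bar R).
Proof.
move=> t0; apply: measurable_funTS; apply/measurable_EFinP.
by apply: measurableT_comp (mcoord t0); exact: measurable_fun_lap.
Qed.

Let mlapCw t lam D : 0 < t ->
  measurable_fun D (fun w : Dpath => (1 - lap lam (w t))%:E : \bar R).
Proof.
move=> t0; apply: measurable_funTS; apply/measurable_EFinP; apply: measurable_funB => //.
by apply: measurableT_comp (mcoord t0); exact: measurable_fun_lap.
Qed.

Lemma N_up_le t C E lam : pcyl t C E -> (N C < +oo)%E -> 0 < lam ->
  (N (C `&` A lam) <= \int[N]_(w in C) (1 - lap (V t lam) (w t))%:E)%E.
Proof.
move=> pC NC l0; have t0 := pcyl_gt0 pC; have mC := pcyl_measurable pC.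
have NCf : N C \is a fin_num by rewrite ge0_fin_numE.
have NC0 : 0 <= fine (N C) by exact: fine_ge0.
apply/lee_addgt0Pr => e e0; set v := V t lam; have v0 : 0 < v by exact: V_gt0.
pose d := e / (fine (N C) + 1).
have d0 : 0 < d by rewrite divr_gt0// ltr_wpDl.
have vc : v < v * (1 + d) by rewrite ltr_pMr// ltrDl.
apply: le_trans (N_up_le_aux pC NC l0 vc) _.
apply: le_trans (_ : _ <= \int[N]_(w in C) ((1 - lap v (w t))%:E + d%:E))%E _.
  apply: ge0_le_integral => //.
  - by move=> w _; rewrite lee_fin subr_ge0 lap_le1// mulr_ge0 ?addr_ge0// ltW.
  - exact: mlapCw.
  - by apply: emeasurable_funD => //; exact: mlapCw.
  move=> w _; rewrite -EFinD lee_fin.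
  have := lap_lipschitz (w t) v0 (ltW vc).
  have -> : v * (1 + d) / v - 1 = d by field; rewrite gt_eqF.
  lra.
rewrite ge0_integralD//; last 3 first.
- by move=> w _; rewrite lee_fin subr_ge0 lap_le1// ltW.
- exact: mlapCw.
- by move=> w _; rewrite lee_fin ltW.
rewrite leeD2l// integral_cst// -(fineK NCf) -EFinM lee_fin /d mulrAC ler_pdivrMr ?ltr_wpDl//.
by rewrite ler_pM2l// lerDl.
Qed.

Lemma N_dn_le t C E lam : pcyl t C E -> (N C < +oo)%E -> 0 < lam ->
  (N (C `&` B lam) <= \int[N]_(w in C) (lap (V t lam) (w t))%:E)%E.
Proof.
move=> pC NC l0; have t0 := pcyl_gt0 pC; have mC := pcyl_measurable pC.
have NCf : N C \is a fin_num by rewrite ge0_fin_numE.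
have NC0 : 0 <= fine (N C) by exact: fine_ge0.
apply/lee_addgt0Pr => e e0; set v := V t lam; have v0 : 0 < v by exact: V_gt0.
pose d := e / (fine (N C) + 1).
have d0 : 0 < d by rewrite divr_gt0// ltr_wpDl.
have d1 : 0 < 1 + d by rewrite addr_gt0.
have c0 : 0 < v / (1 + d) by rewrite divr_gt0.
have vc : v / (1 + d) < v by rewrite ltr_pdivrMr// ltr_pMr// ltrDl.
apply: le_trans (N_dn_le_aux pC NC c0 vc l0) _.
apply: le_trans (_ : _ <= \int[N]_(w in C) ((lap v (w t))%:E + d%:E))%E _.
  apply: ge0_le_integral => //.
  - by move=> w _; rewrite lee_fin lap_ge0.
  - exact: mlapw.
  - by apply: emeasurable_funD => //; exact: mlapw.
  move=> w _; rewrite -EFinD lee_fin.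
  have := lap_lipschitz (w t) c0 (ltW vc).
  have -> : v / (v / (1 + d)) - 1 = d by field; rewrite !gt_eqF.
  lra.
rewrite ge0_integralD//; last 3 first.
- by move=> w _; rewrite lee_fin lap_ge0.
- exact: mlapw.
- by move=> w _; rewrite lee_fin ltW.
rewrite leeD2l// integral_cst// -(fineK NCf) -EFinM lee_fin /d mulrAC ler_pdivrMr ?ltr_wpDl//.
by rewrite ler_pM2l// lerDl.
Qed.

Definition negpath : set (@Dpath R) :=
  \bigcup_s \bigcup_n \bigcup_j [set w : Dpath | (w (gr s n j) < 0)%E].

Lemma negpath_measurable : measurable negpath.
Proof.
do 3 (apply: bigcupT_measurable => ?).
exact: (coord_measurable (gr_gt0 _ _ _) (measurable_ereal_lt 0%E)).
Qed.

Lemma N_negpath : N negpath = 0%E.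
Proof.
apply/eqP; rewrite -measure_le0; apply/eqP.
have h s n j : N.-negligible [set w : Dpath | (w (gr s n j) < 0)%E].
  exists [set w : Dpath | (w (gr s n j) < 0)%E]; split => //.
    exact: (coord_measurable (gr_gt0 _ _ _) (measurable_ereal_lt 0%E)).
  by apply: Npos; exact: gr_gt0.
have : N.-negligible negpath.
  by do 3 (apply: negligible_bigcup => ?); exact: h.
move=> /negligibleP -/(_ negpath_measurable) ->.
by rewrite lexx.
Qed.

Lemma updn_cover lam : ~` negpath `<=` A lam `|` B lam.
Proof.
move=> w hw; have [|nA] := pselect (A lam w); first by left.
right => s; have [s0 hs0] := not_io nA.
exists 0%N, s0; have e := gr_shift s s0 0 0; rewrite expn0 muln1 addn0 in e.
rewrite -e; split.
  by rewrite leNgt; apply/negP => neg; apply: hw; exists (s + s0)%N => //; exists 0%N => //; exists 0%N.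
have /negP := hs0 (s + s0)%N 0%N 0%N (leq_addl _ _).
by rewrite -ltNge => /ltW.
Qed.

Lemma N_updn t C E lam : pcyl t C E -> (N C < +oo)%E -> 0 < lam ->
  [/\ N (C `&` A lam) = (\int[N]_(w in C) (1 - lap (V t lam) (w t))%:E)%E,
      N (C `&` ~` A lam) = (\int[N]_(w in C) (lap (V t lam) (w t))%:E)%E,
      N (C `&` ~` B lam) = (\int[N]_(w in C) (1 - lap (V t lam) (w t))%:E)%E,
      N (C `&` B lam) = (\int[N]_(w in C) (lap (V t lam) (w t))%:E)%E &
      N (C `&` (A lam `&` B lam)) = 0%E].
Proof.
move=> pC NC l0; have t0 := pcyl_gt0 pC; have mC := pcyl_measurable pC.
have mA : measurable (A lam) by apply: io_measurable => q; exact: up_measurable.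
have mB : measurable (B lam) by apply: io_measurable => q; exact: dn_measurable.
have fin D : measurable D -> N (C `&` D) \is a fin_num.
  move=> mD; rewrite ge0_fin_numE//; apply: le_lt_trans NC.
  by apply: le_measure; rewrite ?inE//; exact: measurableI.
have NCe : (N C = \int[N]_(w in C) (1 - lap (V t lam) (w t))%:E +
    \int[N]_(w in C) (lap (V t lam) (w t))%:E)%E.
  rewrite -ge0_integralD//; last 4 first.
  - by move=> w _; rewrite lee_fin subr_ge0 lap_le1// ltW.
  - exact: mlapCw.
  - by move=> w _; rewrite lee_fin lap_ge0.
  - exact: mlapw.
  under eq_integral do rewrite -EFinD subrK.
  by rewrite integral_cst// mul1e.
have i0 : (0 <= \int[N]_(w in C) (1 - lap (V t lam) (w t))%:E)%E.
  by apply: integral_ge0 => w _; rewrite lee_fin subr_ge0 lap_le1// ltW.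
have j0 : (0 <= \int[N]_(w in C) (lap (V t lam) (w t))%:E)%E.
  by apply: integral_ge0 => w _; rewrite lee_fin lap_ge0.
have ifin : (\int[N]_(w in C) (1 - lap (V t lam) (w t))%:E)%E \is a fin_num.
  by rewrite ge0_fin_numE//; apply: le_lt_trans NC; rewrite NCe leeDl.
have jfin : (\int[N]_(w in C) (lap (V t lam) (w t))%:E)%E \is a fin_num.
  by rewrite ge0_fin_numE//; apply: le_lt_trans NC; rewrite NCe leeDr.
have hA := N_up_le pC NC l0; have hB := N_dn_le pC NC l0.
have split1 D : measurable D -> (N C = N (C `&` D) + N (C `&` ~` D))%E.
  move=> mD; rewrite -measureU; last 3 first.
  - exact: measurableI.
  - by apply: measurableI => //; exact: measurableC.
  - by rewrite setIACA setICr setI0.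
  by rewrite -setIUr setUCr setIT.
have cov : (N (C `&` ~` A lam) <= N (C `&` B lam))%E.
  apply: (@le_trans _ _ (N ((C `&` B lam) `|` negpath))).
    apply: le_measure; rewrite ?inE.
    - by apply: measurableI => //; exact: measurableC.
    - by apply: measurableU; [exact: measurableI|exact: negpath_measurable].
    - move=> w [Cw nA]; have [neg|nneg] := pselect (negpath w); first by right.
      by left; split => //; case: (updn_cover lam nneg).
  apply: (@le_trans _ _ (N (C `&` B lam) + N negpath)%E).
    by apply: measureU2; [exact: measurableI|exact: negpath_measurable].
  by rewrite N_negpath adde0.
have eA := split1 _ mA; have eB := split1 _ mB.
have oAB : (N (C `&` B lam) = N (C `&` (A lam `&` B lam)) + N (C `&` B lam `&` ~` A lam))%E.
  rewrite -measureU; last 3 first.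
  - by apply: measurableI => //; exact: measurableI.
  - by apply: measurableI; [exact: measurableI|exact: measurableC].
  - by apply/seteqP; split => // w [[_ [? _]] [_ ?]].
  congr (N _); apply/seteqP; split => w.
    by move=> [Cw Bw]; have [Aw|nAw] := pselect (A lam w); [left|right].
  by move=> [[Cw [_ Bw]]|[[]]].
have cov2 : (N (C `&` ~` A lam) <= N (C `&` B lam `&` ~` A lam))%E.
  apply: (@le_trans _ _ (N ((C `&` B lam `&` ~` A lam) `|` negpath))).
    apply: le_measure; rewrite ?inE.
    - by apply: measurableI => //; exact: measurableC.
    - apply: measurableU; last exact: negpath_measurable.
      by apply: measurableI; [exact: measurableI|exact: measurableC].
    - move=> w [Cw nA]; have [neg|nneg] := pselect (negpath w); first by right.
      by left; split => //; split => //; case: (updn_cover lam nneg).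
  apply: (@le_trans _ _ (N (C `&` B lam `&` ~` A lam) + N negpath)%E).
    apply: measureU2; last exact: negpath_measurable.
    by apply: measurableI; [exact: measurableI|exact: measurableC].
  by rewrite N_negpath adde0.
have fA := fin _ mA; have fB := fin _ mB.
have fnA := fin _ (measurableC mA); have fnB := fin _ (measurableC mB).
have fAB := fin _ (measurableI _ _ mA mB).
have fBnA : N (C `&` B lam `&` ~` A lam) \is a fin_num.
  by rewrite -setIA; apply: fin; apply: measurableI => //; exact: measurableC.
have oAB0 : (0 <= N (C `&` (A lam `&` B lam)))%E by [].
move: (N (C `&` A lam)) (N (C `&` ~` A lam)) (N (C `&` B lam)) (N (C `&` ~` B lam))
  (N (C `&` (A lam `&` B lam))) (N (C `&` B lam `&` ~` A lam))
  (\int[N]_(w in C) (1 - lap (V t lam) (w t))%:E)%E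
  (\int[N]_(w in C) (lap (V t lam) (w t))%:E)%E
  fA fnA fB fnB fAB fBnA ifin jfin NCe hA hB eA eB oAB oAB0 cov cov2.
case=> [a| |]// [na| |]// [b| |]// [nb| |]// [ab| |]// [bna| |]// [i| |]// [j| |]// _ _ _ _ _ _ _ _.
move=> -> ; rewrite -!EFinD !lee_fin => hA hB [eA] [eB] [oAB] oAB0 cov cov2.
by split; congr EFin; lra.
Qed.

End excursion_limits.

Section poisson_series.
Context {R : realType}.

Lemma pois_series (M r : R) :
  (\sum_(0 <= k <oo) (r ^+ k * pois M k)%:E = (expR (- (M * (1 - r))))%:E)%E.
Proof.
apply/cvg_lim => //.
have -> : (fun n => \sum_(0 <= k < n) (r ^+ k * pois M k)%:E)%E =
    EFin \o (fun n => expR (- M) * series (exp_coeff (M * r)) n).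
  apply/funext => n /=; rewrite sumEFin /series /=; congr EFin.
  rewrite mulr_sumr; apply: eq_bigr => k _; rewrite /pois /exp_coeff /= exprMn; ring.
have -> : expR (- (M * (1 - r))) = expR (- M) * expR (M * r).
  by rewrite -expRD; congr expR; ring.
apply: cvg_EFin; first by apply: nearW.
apply: cvgM; first exact: cvg_cst.
exact: is_cvg_series_exp_coeff.
Qed.

Lemma pois_ge0 (M : R) k : 0 <= M -> 0 <= pois M k.
Proof. by move=> M0; rewrite divr_ge0// mulr_ge0 ?expR_ge0// exprn_ge0. Qed.

Lemma cnt_counting {T : Type} (a : nat -> T) (A : set T) :
  cnt a A = counting [set n | A (a n)] :> \bar R.
Proof.
rewrite /cnt -(@ge0_integral_count R (fun n => (\1_A (a n))%:E)); last first.
  by move=> n; rewrite lee_fin.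
under eq_integral => n _.
  rewrite (_ : \1_A (a n) = \1_[set n | A (a n)] n); last first.
    by rewrite !indicE; congr (_%:R); congr nat_of_bool.
  over.
by rewrite integral_indic// setIT.
Qed.

Lemma cnt_nat {T : Type} (a : nat -> T) (A : set T) :
  (cnt a A = +oo :> \bar R)%E \/ exists k, cnt a A = k%:R%:E :> \bar R.
Proof.
rewrite cnt_counting /counting; case: asboolP => _; last by left.
by right; eexists.
Qed.

Lemma cnt_finite {T : Type} (a : nat -> T) (A : set T) k :
  cnt a A = k%:R%:E :> \bar R -> finite_set [set n | A (a n)].
Proof. by rewrite cnt_counting /counting; case: asboolP. Qed.

Lemma cnt0 {T : Type} (a : nat -> T) (A : set T) :
  cnt a A = 0%:R%:E :> \bar R -> forall n, ~ A (a n).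
Proof.
rewrite cnt_counting /counting; case: asboolP => // fin -[/eqP].
rewrite pnatr_eq0 cardfs_eq0 => /eqP e n An.
have : n \in fset_set [set n | A (a n)] by rewrite in_fset_set// mem_set.
by rewrite e.
Qed.

Lemma cnt_ge2 {T : Type} (a : nat -> T) (A : set T) k m n :
  m <> n -> A (a m) -> A (a n) -> cnt a A = k%:R%:E :> \bar R -> (2 <= k)%N.
Proof.
move=> mn Am An; rewrite cnt_counting /counting; case: asboolP => // fin [/eqP].
rewrite eqr_nat => /eqP <-.
have : ([fset m; n] `<=` fset_set [set n | A (a n)])%fset.
  apply/fsubsetP => x; rewrite !inE => /orP[] /eqP ->; rewrite in_fset_set// mem_set//.
by move=> /fsubset_leq_card; rewrite cardfs2 (introF eqP mn).
Qed.

Lemma pois_tail2 (M : R) : 0 <= M -> 1 - pois M 0 - pois M 1 <= M ^+ 2.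
Proof.
move=> M0; rewrite /pois expr0 fact0 expr1 divr1 mulr1 divr1.
have h := expR_ge1Dx (- M).
have h2 : (1 - M) * (1 + M) <= expR (- M) * (1 + M) by rewrite ler_wpM2r// addr_ge0.
have -> : 1 - expR (- M) - expR (- M) * M = 1 - expR (- M) * (1 + M) by ring.
have -> : M ^+ 2 = 1 - (1 - M) * (1 + M) by ring.
lra.
Qed.

End poisson_series.

Definition marked_atoms {R : realType} {Om S : Type} (xs : Om -> nat -> R)
  (ws : Om -> nat -> S) om n : (measurableTypeR R * S)%type := (xs om n, ws om n).

Definition intensity {R : realType} {dS : measure_display} {S : measurableType dS}
    (N : set S -> \bar R) (A : set (measurableTypeR R * S)) : \bar R :=
  (\int[@lebesgue_measure R]_(x in `[0%R, +oo[) N (xsection A x))%E.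

Section ppp.
Context {R : realType} {d dS : measure_display} {Om : measurableType d} {S : measurableType dS}.
Variables (P : probability Om R) (N : {measure set S -> \bar R}).
Variables (xs : Om -> nat -> R) (ws : Om -> nat -> S).
Local Notation leb := (@lebesgue_measure R).
Local Notation atoms := (marked_atoms xs ws).
Local Notation nu := (intensity N).
Hypothesis hPPP : is_PPP P atoms nu.

Lemma nu_setX (I : set (measurableTypeR R)) (D : set S) : measurable I ->
  nu (I `*` D) = (N D * leb (`[0%R, +oo[%classic `&` I))%E.
Proof.
move=> mI; rewrite /intensity -integral_cst; last exact: measurableI.
rewrite integral_mkcondr; apply: eq_integral => x _; rewrite /patch.
case: ifPn => xI; first by rewrite in_xsectionX.
by rewrite notin_xsectionX// measure0.
Qed.

Lemma ppp1 (A : set (measurableTypeR R * S)) k : measurable A -> (nu A < +oo)%E ->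
  measurable [set om | cnt (atoms om) A = k%:R%:E :> \bar R] /\
  P [set om | cnt (atoms om) A = k%:R%:E :> \bar R] = (pois (fine (nu A)) k)%:E.
Proof.
move=> mA nuA; have := @hPPP 1%N (fun=> A) (fun=> k) (fun=> mA) _ (fun=> nuA).
case=> [i j|mE PE]; first by rewrite !ord1 eqxx.
have e : \bigcap_(i in [set: 'I_1]) [set w | cnt (atoms w) A = k%:R%:E :> \bar R] =
   [set om | cnt (atoms om) A = k%:R%:E :> \bar R].
  by apply/seteqP; split => om; [move=> /(_ ord0 I)|move=> h i _].
by rewrite e in mE PE; rewrite PE big_ord1.
Qed.

Lemma ppp_null (A : set (measurableTypeR R * S)) : measurable A -> nu A = 0%E ->
  {ae P, forall om, forall n, ~ A (atoms om n)}.
Proof.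
move=> mA nuA; have [|mE PE] := @ppp1 A 0%N mA; first by rewrite nuA.
exists (~` [set om | cnt (atoms om) A = 0%:R%:E :> \bar R]); split.
- exact: measurableC.
- rewrite probability_setC// PE nuA/= /pois oppr0 expR0 expr0 fact0 mulr1 divr1.
  by rewrite subee.
- by move=> om /= h e; apply: h; exact: cnt0 e.
Qed.

Lemma ppp_null_path (D : set S) : measurable D -> N D = 0%E ->
  {ae P, forall om, forall n, ~ D (ws om n)}.
Proof.
move=> mD ND.
have : {ae P, forall om, forall n, ~ (setT `*` D) (atoms om n)}.
  apply: ppp_null; first exact: measurableX.
  by rewrite nu_setX// ND mul0e.
by apply: filterS => om h n Dn; apply: (h n).
Qed.

Lemma ppp_pos : {ae P, forall om, forall n, 0 <= xs om n}.
Proof.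
have : {ae P, forall om, forall n, ~ (`]-oo, 0%R[%classic `*` setT) (atoms om n)}.
  apply: ppp_null; first by apply: measurableX.
  rewrite nu_setX// (_ : _ `&` _ = set0) ?measure0 ?mule0//.
  apply/seteqP; split => x //=; rewrite !in_itv/= andbT => -[x0].
  by rewrite ltNge x0.
apply: filterS => om h n; rewrite leNgt; apply/negP => xn; apply: (h n).
by split => //=; rewrite in_itv/= xn.
Qed.

Definition rect (x : R) (D : set S) : set (measurableTypeR R * S) := `[0, x]%classic `*` D.

Lemma rect_measurable x D : measurable D -> measurable (rect x D).
Proof. by move=> mD; apply: measurableX. Qed.

Lemma nu_rect x D : 0 <= x -> nu (rect x D) = (N D * x%:E)%E.
Proof.
move=> x0; rewrite /rect nu_setX//; congr (_ * _)%E.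
rewrite (_ : _ `&` _ = `[0, x]%classic); last first.
  by apply/seteqP; split => y /=; rewrite !in_itv/= ?andbT; [case|move=> /andP[-> ->]].
rewrite lebesgue_measure_itv/= lte_fin; case: ltP => [_|x0']; first by rewrite sube0.
by congr EFin; apply: le_anti; rewrite x0 x0'.
Qed.

Local Notation c x D := (fun om => cnt (atoms om) (rect x D) : \bar R).

Lemma nat_valued_measurable (f : Om -> \bar R) :
  (forall om, (f om = +oo)%E \/ exists k, f om = k%:R%:E) ->
  (forall k, measurable [set om | f om = k%:R%:E]) -> measurable_fun setT f.
Proof.
move=> fv mf _ B mB; rewrite setTI.
have -> : f @^-1` B = (\bigcup_(k in [set k | B k%:R%:E]) [set om | f om = k%:R%:E]) `|`
   (if `[< B +oo%E >] then \bigcap_k ~` [set om | f om = k%:R%:E] else set0).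
  apply/seteqP; split => om /=.
    have [e|[k e]] := fv om; rewrite e => Bf; last by left; exists k => //=.
    by right; case: asboolP => // _ k _ /=; rewrite e.
  move=> [[k /= Bk ->//]|]; case: asboolP => // Boo h.
  by have [->//|[k e]] := fv om; case: (h k I).
apply: measurableU; first by apply: bigcup_measurable.
by case: asboolP => // _; apply: bigcapT_measurable => k; exact: measurableC.
Qed.

Lemma c_measurable x D : 0 <= x -> measurable D -> (N D < +oo)%E ->
  measurable_fun setT (c x D).
Proof.
move=> x0 mD ND; apply: nat_valued_measurable => [om|k]; first exact: cnt_nat.
have [] // := @ppp1 (rect x D) k (rect_measurable x mD).
rewrite nu_rect//.
by rewrite muleC lte_mul_pinfty.
Qed.

Lemma laplace_counts n (A : 'I_n -> set S) (a : 'I_n -> R) x : 0 <= x ->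
  (forall i, measurable (A i)) -> (forall i j, i != j -> A i `&` A j = set0) ->
  (forall i, (N (A i) < +oo)%E) ->
  (\int[P]_om (\prod_i elap (a i) (c x (A i) om))%:E =
   (\prod_i expR (- (fine (N (A i) * x%:E) * (1 - expR (- a i)))))%:E)%E.
Proof.
move=> x0 mA dA NA.
pose M i := fine (N (A i) * x%:E)%E.
have M0 i : 0 <= M i by rewrite fine_ge0// mule_ge0.
pose F j (k : 'I_n -> nat) (i : 'I_n) om : R :=
  if (i < j)%N then elap (a i) (c x (A i) om) else ((c x (A i) om == (k i)%:R%:E :> \bar R) : nat)%:R.
pose G j (k : 'I_n -> nat) (i : 'I_n) : R :=
  if (i < j)%N then expR (- (M i * (1 - expR (- a i)))) else pois (M i) (k i).
have NAx i : (nu (rect x (A i)) < +oo)%E.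
  by rewrite nu_rect// muleC lte_mul_pinfty.
have mc i := c_measurable x0 (mA i) (NA i).
have elap0 b z : 0 <= elap b z :> R by case: z => [r| |] //=; exact: expR_ge0.
have F0 j k i om : 0 <= F j k i om.
  by rewrite /F; case: ifP => _; [exact: elap0|exact: ler0n].
have mF j k i : measurable_fun setT (F j k i).
  rewrite /F; case: (i < j)%N.
    apply: measurableT_comp (mc i); exact: measurable_fun_elap.
  have [mE _] := @ppp1 (rect x (A i)) (k i) (rect_measurable x (mA i)) (NAx i).
  rewrite (_ : (fun om => _) =
      \1_[set om | cnt (atoms om) (rect x (A i)) = (k i)%:R%:E :> \bar R]).
    by apply: measurable_indic.
  apply/funext => om; rewrite indicE; congr (_%:R); congr nat_of_bool; apply/esym.
  by apply/idP/eqP => [/set_mem//|e]; apply/mem_set.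
suff main j k : (j <= n)%N ->
    (\int[P]_om (\prod_i F j k i om)%:E = (\prod_i G j k i)%:E)%E.
  have := main n (fun=> 0%N) (leqnn n).
  have -> : (fun om => (\prod_i F n (fun=> 0%N) i om)%:E) =
     (fun om => (\prod_i elap (a i) (c x (A i) om))%:E).
    by apply/funext => om; congr EFin; apply: eq_bigr => i _; rewrite /F ltn_ord.
  by move=> ->; congr EFin; apply: eq_bigr => i _; rewrite /G ltn_ord.
elim: j k => [|j IH] k jn.
  have [|||mE PE] := @hPPP n (fun i => rect x (A i)) k.
  - by move=> i; exact: rect_measurable.
  - move=> i j ij; rewrite /rect; apply/seteqP; split => // -[y s] [[_ /= Ai] [_ /= Aj]].
    by have : (A i `&` A j) s by []; rewrite dA.
  - exact: NAx.
  transitivity (P (\bigcap_(i in [set: 'I_n]) [set w | cnt (atoms w) (rect x (A i)) = (k i)%:R%:E :> \bar R])).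
    set B := \bigcap_(i in _) _ in mE PE *.
    rewrite -[in RHS](setIT B) -integral_indic//; apply: eq_integral => om _; congr EFin.
    rewrite indicE; case: (boolP (om \in _)) => [/set_mem h|h].
      by rewrite big1// => i _; rewrite /F ltn0 h// eqxx.
    have [i hi] : exists i, c x (A i) om != (k i)%:R%:E.
      apply: contrapT => /forallNP hh; move/negP : h; apply; apply/mem_set => i _ /=.
      by apply/eqP/negPn/negP; exact: hh.
    by rewrite (bigD1 i)//= /F ltn0 (negbTE hi) mul0r.
  by rewrite PE; congr EFin; apply: eq_bigr => i _; rewrite nu_rect.
pose j0 := Ordinal jn.
pose up m (i : 'I_n) := if i == j0 then m else k i.
have ltj (i : 'I_n) : i != j0 -> (i < j.+1)%N = (i < j)%N.
  by move=> ij; rewrite ltnS leq_eqVlt (_ : (nat_of_ord i == j) = false)//; apply/negbTE.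
have other m i : i != j0 -> F j (up m) i =1 F j.+1 k i.
  by move=> ij om; rewrite /F /up (negbTE ij) ltj.
have otherG m i : i != j0 -> G j (up m) i = G j.+1 k i.
  by move=> ij; rewrite /G /up (negbTE ij) ltj.
transitivity (\int[P]_om (\sum_(0 <= m <oo)
    (expR (- a j0) ^+ m * \prod_i F j (up m) i om)%:E))%E.
  apply: eq_integral => om _.
  have Pr m : \prod_i F j (up m) i om =
      ((c x (A j0) om == m%:R%:E :> \bar R) : nat)%:R * \prod_(i | i != j0) F j.+1 k i om.
    rewrite (bigD1 j0)//=; congr (_ * _); first by rewrite /F ltnn /up eqxx.
    by apply: eq_bigr => i ij; exact: other.
  rewrite (bigD1 j0)//= {1}/F ltnS leqnn.
  under eq_eseriesr do rewrite Pr.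
  have [e|[m0 e]] := @cnt_nat R _ (atoms om) (rect x (A j0)).
    rewrite e; under eq_eseriesr do rewrite (_ : (_ == _) = false)// mulr0n mul0r mulr0.
    by rewrite /= mul0r eseries0.
  rewrite e; apply/esym.
  rewrite (@nneseriesD1 R _ m0 xpredT)//; last first.
    move=> m _; rewrite lee_fin !mulr_ge0 ?exprn_ge0 ?expR_ge0 ?ler0n//.
    by apply: prodr_ge0 => i _; exact: F0.
  rewrite eseries0 ?adde0; last first.
    by move=> m _ /= mm; rewrite eqe eqr_nat eq_sym (negbTE mm) mul0r mulr0.
  rewrite eqxx mul1r /= -expRM_natl; congr EFin; congr (expR _ * _); ring.
rewrite integral_nneseries//; last 2 first.
- move=> m; apply/measurable_EFinP; apply: measurable_funM => //.
  by apply: measurable_prod => i _.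
- move=> m om _; rewrite lee_fin mulr_ge0 ?exprn_ge0 ?expR_ge0//.
  by apply: prodr_ge0 => i _; exact: F0.
transitivity (\sum_(0 <= m <oo) ((\prod_(i | i != j0) G j.+1 k i)%:E *
    (expR (- a j0) ^+ m * pois (M j0) m)%:E))%E.
  apply: eq_eseriesr => m _.
  under eq_integral do rewrite EFinM.
  rewrite ge0_integralZl//; last 2 first.
  - by apply/measurable_EFinP; apply: measurable_prod.
  - by move=> om _; rewrite lee_fin; apply: prodr_ge0 => i _; exact: F0.
  rewrite IH ?(ltnW jn)// -!EFinM; congr EFin.
  rewrite (bigD1 j0)//= {1}/G ltnn /up eqxx.
  rewrite (eq_bigr (fun i => G j.+1 k i)); last by move=> i ij; exact: otherG.
  by rewrite mulrA mulrC.
have G0 i : 0 <= G j.+1 k i.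
  by rewrite /G; case: ifP => _; [exact: expR_ge0|exact: pois_ge0].
rewrite nneseriesZl; last by move=> m _; rewrite lee_fin mulr_ge0 ?exprn_ge0 ?expR_ge0 ?pois_ge0.
rewrite pois_series -EFinM; congr EFin.
rewrite [RHS](bigD1 j0)//= [RHS]mulrC; congr (_ * _).
by rewrite /G ltnS leqnn.
Qed.

End ppp.

Section elap.
Context {R : realType}.
Local Open Scope ereal_scope.

Lemma elap_ge0 (a : R) z : (0 <= elap a z)%R.
Proof. by case: z => [r| |] //=; exact: expR_ge0. Qed.

Lemma elap_le1 (a : R) z : (0 <= a)%R -> 0 <= z -> (elap a z <= 1)%R.
Proof. by move=> a0; case: z => [r| |] //= r0; rewrite expR_le1 oppr_le0 mulr_ge0. Qed.

Lemma elapD (a : R) u v : 0 <= u -> 0 <= v -> (elap a (u + v) = elap a u * elap a v)%R.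
Proof.
case: u v => [u| |] [v| |]//= u0 v0; rewrite ?mul0r ?mulr0//.
by rewrite -expRD; congr expR; ring.
Qed.

Lemma elap_sum (I : Type) (s : seq I) (a : R) (F : I -> \bar R) : (forall i, 0 <= F i) ->
  elap a (\sum_(i <- s) F i) = (\prod_(i <- s) elap a (F i))%R.
Proof.
move=> F0; elim: s => [|i s IH]; first by rewrite !big_nil /= mulr0 oppr0 expR0.
by rewrite !big_cons elapD ?IH// sume_ge0.
Qed.

Lemma elapZ (a b : R) z : (0 < b)%R -> elap a (b%:E * z) = elap (a * b) z.
Proof.
move=> b0; case: z => [r| |] /=; first by rewrite mulrA.
  by rewrite gt0_muley ?lte_fin.
by rewrite gt0_muleNy ?lte_fin.
Qed.

Lemma elap_cvg (u : nat -> \bar R) l : (forall n, 0 <= u n) -> u n @[n --> \oo] --> l ->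
  elap 1 (u n) @[n --> \oo] --> elap 1 l.
Proof.
move=> u0; case: l => [r| |] ul /=.
- move/fine_cvgP : ul => [uf ul].
  apply: (@cvg_trans _ ((fun n => expR (- (1 * fine (u n)))) @ \oo)).
    apply: near_eq_cvg; apply: filterS uf => n; by case: (u n).
  apply: (@cvg_comp _ _ _ (fun n => - (1 * fine (u n)))%R (@expR R) _ (nbhs (- (1 * r))%R));
    last exact: continuous_expR.
  by apply: cvgN; apply: cvgM => //; exact: cvg_cst.
- apply/cvgrPdist_le => e e0.
  move/cvgeyPge : ul => /(_ (e^-1)%R) hu.
  apply: filterS hu => n hn; rewrite sub0r normrN ger0_norm ?elap_ge0//.
  move: hn; case: (u n) => [r| |] /=; [|by move=> _; exact: ltW..].
  rewrite lee_fin mul1r => er.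
  apply: (@le_trans _ _ (expR (- e^-1))); first by rewrite ler_expR lerN2.
  rewrite expRN -[leRHS]invrK lef_pV2 ?posrE ?expR_gt0 ?invr_gt0//.
  by have := expR_ge1Dx e^-1; lra.
- have : 0 <= (-oo : \bar R).
    by apply: cvge_ge ul; apply: nearW.
  by rewrite leeNy_eq.
Qed.

End elap.

Section laplace_functional.
Context {R : realType} {d dS : measure_display} {Om : measurableType d} {S : measurableType dS}.
Variables (P : probability Om R) (N : {measure set S -> \bar R}).
Variables (xs : Om -> nat -> R) (ws : Om -> nat -> S).
Hypothesis hPPP : is_PPP P (marked_atoms xs ws) (intensity N).
Hypothesis hNsf : sigma_finite setT N.
Local Notation atoms := (marked_atoms xs ws).
Local Notation c x D := (fun om => cnt (atoms om) (rect x D) : \bar R).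
Local Open Scope ereal_scope.
Import HBNNSimple.

Lemma nneseries_sum_seq (I : eqType) (s : seq I) (F : I -> nat -> \bar R) :
  (forall i n, 0 <= F i n) ->
  \sum_(0 <= n <oo) \sum_(i <- s) F i n = \sum_(i <- s) \sum_(0 <= n <oo) F i n.
Proof.
move=> F0; elim: s => [|i s IH].
  by rewrite big_nil; apply: eseries0 => n _ _; rewrite big_nil.
rewrite big_cons -IH -nneseriesD//; last by move=> n _ _; exact: sume_ge0.
by apply: eq_eseriesr => n _; rewrite big_cons.
Qed.

Definition psum (x : R) (f : S -> \bar R) (om : Om) : \bar R :=
  \sum_(0 <= n <oo) (if (0 <= xs om n <= x)%R then f (ws om n) else 0).

Lemma psum_indic x D om : psum x (fun w => (\1_D w)%:E) om = c x D om.
Proof.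
apply: eq_eseriesr => n _; rewrite !indicE /marked_atoms /rect.
case: ifPn => xn; last first.
  by rewrite memNset//= => -[/=]; rewrite in_itv/= (negbTE xn).
congr EFin; congr (_%:R); congr nat_of_bool; apply/idP/idP => /set_mem h; apply/mem_set.
  by split => //=; rewrite in_itv.
by case: h.
Qed.

Lemma psum_ge0 x f om : (forall w, 0 <= f w) -> 0 <= psum x f om.
Proof. by move=> f0; apply: nneseries_ge0 => n _ _; case: ifP. Qed.

Lemma psum_cvg x (f_ : nat -> S -> \bar R) (f : S -> \bar R) om : (forall n w, 0 <= f_ n w) ->
  (forall w, nondecreasing_seq (f_ ^~ w)) -> (forall w, f_ n w @[n --> \oo] --> f w) ->
  psum x (f_ n) om @[n --> \oo] --> psum x f om.
Proof.
move=> f0 nd cv.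
pose g n k : \bar R := if (0 <= xs om k <= x)%R then f_ n (ws om k) else 0.
have g0 n k : 0 <= g n k by rewrite /g; case: ifP.
have F0 w : 0 <= f w.
  by apply: cvge_ge (cv w); apply: nearW.
have := @cvg_monotone_convergence _ _ R counting setT measurableT g.
have lg k : limn (g ^~ k) = if (0 <= xs om k <= x)%R then f (ws om k) else 0.
  by rewrite /g; case: ifP => _; [apply/cvg_lim => //; exact: cv|exact: lim_cst].
under [X in _ -> _ -> _ -> _ --> X]eq_integral do rewrite lg.
rewrite ge0_integral_count; last by move=> k; case: ifP.
move=> cvi.
have -> : (fun n => psum x (f_ n) om) = (fun n => \int[counting]_k g n k).
  by apply/funext => n; rewrite ge0_integral_count.
apply: cvi => //.
move=> k _ p q pq; rewrite /g; case: ifP => // _; exact: nd.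
Qed.

Section simple.
Variables (h : {nnsfun S >-> R}) (E : set S).
Hypotheses (mE : measurable E) (NE : N E < +oo).
Let r := [seq y <- enum_fset (fset_set (range h)) | y != 0%R].
Let A y : set S := h @^-1` [set y] `&` E.

Let r_uniq : uniq r. Proof. exact/filter_uniq/fset_uniq. Qed.

Let r_gt0 y : y \in r -> (0 < y)%R.
Proof.
rewrite mem_filter => /andP[y0 yh]; rewrite lt_neqAle eq_sym y0/=.
have : y \in fset_set (range h) by [].
by rewrite in_fset_set// => /set_mem [z _ <-]; exact: fun_ge0.
Qed.

Let mA y : measurable (A y).
Proof. by apply: measurableI => //; exact: measurable_sfunP. Qed.

Let NA y : N (A y) < +oo.
Proof.
apply: le_lt_trans NE; apply: le_measure; rewrite ?inE//; exact: subIsetr.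
Qed.

Let sum_level (g : R -> R) w : g 0%R = 0%R ->
  (\sum_(y <- r) g y * \1_(A y) w = g (h w * \1_E w))%R.
Proof.
move=> g0; have [wE|wE] := pselect (E w); last first.
  rewrite [\1_E w]indicE memNset// mulr0 g0 big1// => y _.
  by rewrite indicE memNset ?mulr0// => -[].
rewrite [\1_E w]indicE mem_set// mulr1.
have [hw|hw] := eqVneq (h w) 0%R.
  rewrite hw g0 big_seq big1// => y /r_gt0 y0.
  by rewrite indicE memNset ?mulr0// => -[/= hy _]; move: y0; rewrite -hy hw ltxx.
have hr : h w \in r.
  rewrite mem_filter hw/=; have : h w \in fset_set (range h) by rewrite in_fset_set// mem_set.
  by [].
rewrite (bigD1_seq _ hr r_uniq)/= indicE mem_set// mulr1 big1 ?addr0// => y yh.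
by rewrite indicE memNset ?mulr0// => -[/= hy _]; move: yh; rewrite hy eqxx.
Qed.

Let f w := (h w * \1_E w)%:E.

Let fE w : f w = \sum_(y <- r) y%:E * (\1_(A y) w)%:E.
Proof. by rewrite /f -(sum_level (g := id))// -sumEFin; apply: eq_bigr => y _; rewrite EFinM. Qed.

Let psumE x om : psum x f om = \sum_(y <- r) y%:E * c x (A y) om.
Proof.
rewrite /psum.
transitivity (\sum_(0 <= n <oo) \sum_(y <- r)
    (if y \in r then y%:E * (if (0 <= xs om n <= x)%R then (\1_(A y) (ws om n))%:E else 0) else 0)).
  apply: eq_eseriesr => n _; case: ifPn => _.
    by rewrite fE big_seq [RHS]big_seq; apply: eq_bigr => y ->.
  by rewrite big1// => y _; rewrite mule0; case: ifP.
rewrite nneseries_sum_seq; last first.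
  move=> y n; case: ifPn => // /r_gt0 y0; rewrite mule_ge0 ?lee_fin ?(ltW y0)//.
  by case: ifP.
rewrite big_seq [RHS]big_seq; apply: eq_bigr => y yr; rewrite yr nneseriesZl; last first.
  by move=> n _; case: ifP.
by rewrite -psum_indic.
Qed.

Lemma psum_simple_measurable x : (0 <= x)%R -> measurable_fun setT (psum x f).
Proof.
move=> x0; rewrite (_ : psum x f = (fun om => \sum_(y <- r) y%:E * c x (A y) om)).
  apply: emeasurable_sum => y; apply: measurable_funeM.
  exact: (c_measurable hPPP x0 (mA y) (NA y)).
by apply/funext => om; exact: psumE.
Qed.

Lemma laplace_simple x : (0 <= x)%R ->
  \int[P]_om (elap 1 (psum x f om))%:E =
  (elap 1 (x%:E * \int[N]_w (1 - elap 1 (f w))%:E))%:E.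
Proof.
move=> x0.
have I1 : \int[N]_w (1 - elap 1 (f w))%:E =
    \sum_(y <- r) (1 - expR (- y))%:E * N (A y).
  transitivity (\int[N]_w (\sum_(y <- r) ((1 - expR (- y)) * \1_(A y) w)%:E)).
    apply: eq_integral => w _; rewrite sumEFin sum_level ?oppr0 ?expR0 ?subrr//.
    by rewrite /f /= mul1r.
  transitivity (\int[N]_w (\sum_(y <- r)
      (if y \in r then ((1 - expR (- y)) * \1_(A y) w)%:E else 0))).
    by apply: eq_integral => w _; rewrite big_seq [RHS]big_seq; apply: eq_bigr => y ->.
  rewrite ge0_integral_sum//; last 2 first.
  - move=> y; case: (y \in r) => //; apply/measurable_EFinP; apply: measurable_funM => //.
  - move=> y w _; case: ifPn => // /r_gt0 y0; rewrite lee_fin mulr_ge0//.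
    by rewrite subr_ge0 expR_le1 oppr_le0 ltW.
  rewrite big_seq [RHS]big_seq; apply: eq_bigr => y yr; rewrite yr.
  have y0 := r_gt0 yr.
  under eq_integral do rewrite EFinM.
  rewrite ge0_integralZl//; last 2 first.
  - by apply/measurable_EFinP; exact: measurable_indic.
  - by rewrite lee_fin subr_ge0 expR_le1 oppr_le0 ltW.
  by rewrite integral_indic// setIT.
transitivity (\int[P]_om (\prod_(i < size r) elap (tnth (in_tuple r) i)
    (c x (A (tnth (in_tuple r) i)) om))%:E).
  apply: eq_integral => om _; congr EFin; rewrite psumE.
  rewrite big_seq.
  rewrite (eq_bigr (fun y => if y \in r then y%:E * c x (A y) om else 0)); last first.
    by move=> y ->.
  rewrite -big_seq elap_sum; last first.
    move=> y; case: ifP => // /r_gt0 y0; rewrite mule_ge0 ?lee_fin ?(ltW y0)//.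
    by rewrite cnt_counting.
  rewrite big_tnth; apply: eq_bigr => i _.
  have yr := mem_tnth i (in_tuple r); rewrite /= in yr.
  by rewrite yr elapZ ?mul1r// r_gt0.
rewrite (laplace_counts hPPP)//; last first.
  move=> i j ij; apply/seteqP; split => // w [[/= h1 _] [/= h2 _]].
  move/eqP: ij; apply; apply/val_inj/eqP => /=.
  rewrite -(nth_uniq 0%R (ltn_ord i) (ltn_ord j) r_uniq).
  by rewrite -!(tnth_nth 0%R (in_tuple r)) -h1 -h2.
congr EFin; rewrite I1.
have -> : \sum_(y <- r) (1 - expR (- y))%:E * N (A y) =
    (\sum_(y <- r) (1 - expR (- y)) * fine (N (A y)))%:E.
  rewrite -sumEFin; apply: eq_bigr => y _; rewrite EFinM fineK// ge0_fin_numE//.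
rewrite -EFinM /= mul1r mulr_sumr -sumrN expR_sum [RHS]big_tnth.
apply: eq_bigr => i _; congr expR; congr (- _)%R.
have fN : N (A (tnth (in_tuple r) i)) \is a fin_num by rewrite ge0_fin_numE.
by rewrite fineM//=; ring.
Qed.

End simple.

Lemma sigma_finite_exhaustion : exists E : nat -> set S,
  [/\ forall n, measurable (E n), forall n, N (E n) < +oo,
      forall n n', (n <= n')%N -> E n `<=` E n' & forall w, exists n, E n w].
Proof.
have [F UF hF] := hNsf.
exists (fun n => \big[setU/set0]_(i < n.+1) F i); split.
- by move=> n; apply: bigsetU_measurable => i _; case: (hF i).
- move=> n; apply: le_lt_trans (_ : \sum_(i < n.+1) N (F i) < +oo).
    by apply: content_subadditive => //= [i _|]; [case: (hF i)|
      apply: bigsetU_measurable => i _; case: (hF i)].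
  by apply: lte_sum_pinfty => i _; case: (hF i).
- by move=> n n' nn; apply: subset_bigsetU.
- move=> w; have : setT w by []; rewrite UF => -[n _ Fw].
  by exists n; rewrite -bigcup_mkord; exists n => /=.
Qed.

Lemma laplace_functional x (f : S -> \bar R) : (0 <= x)%R ->
  measurable_fun setT f -> (forall w, 0 <= f w) ->
  measurable_fun setT (psum x f) /\
  \int[P]_om (elap 1 (psum x f om))%:E =
  (elap 1 (x%:E * \int[N]_w (1 - elap 1 (f w))%:E))%:E.
Proof.
move=> x0 mf f0.
have [E [mE NE ndE UE]] := sigma_finite_exhaustion.
pose gm := nnsfun_approx measurableT mf.
pose f_ n w := (gm n w * \1_(E n) w)%:E.
have f_0 n w : 0 <= f_ n w by rewrite lee_fin mulr_ge0 ?fun_ge0.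
have ndf w : nondecreasing_seq (f_ ^~ w).
  move=> p q pq; rewrite lee_fin ler_pM ?fun_ge0//.
    by have /lefP := nd_nnsfun_approx measurableT mf pq; exact.
  rewrite !indicE ler_nat; case: (boolP (w \in E p)) => // /set_mem wE.
  by rewrite mem_set//; exact: ndE wE.
have cvf w : f_ n w @[n --> \oo] --> f w.
  have cg : (gm n w)%:E @[n --> \oo] --> f w by apply: cvg_nnsfun_approx.
  apply: cvg_trans cg; apply: near_eq_cvg.
  have [n0 hn0] := UE w; exists n0 => // n /= nn.
  by rewrite /f_ indicE mem_set ?mulr1//; exact: ndE hn0.
have mp n : measurable_fun setT (psum x (f_ n)).
  exact: psum_simple_measurable.
have cvp om := @psum_cvg x f_ f om f_0 ndf cvf.
have mpf : measurable_fun setT (psum x f).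
  by apply: (emeasurable_fun_cvg (fun n => psum x (f_ n))) => // om _; exact: cvp.
split => //.
have p0 n om : 0 <= psum x (f_ n) om by exact: psum_ge0.
have me : measurable_fun setT (fun om => (elap 1 (psum x f om))%:E : \bar R).
  by apply/measurable_EFinP; apply: measurableT_comp mpf; exact: measurable_fun_elap.
have [||||_ _ cL] := @dominated_convergence _ _ _ P setT measurableT
    (fun n om => (elap 1 (psum x (f_ n) om))%:E) (fun om => (elap 1 (psum x f om))%:E) (cst 1) _ me.
- move=> n; apply/measurable_EFinP; apply: measurableT_comp (mp n).
  exact: measurable_fun_elap.
- apply: aeW => om _; apply: cvg_EFin; first exact: nearW.
  by apply: elap_cvg => //; exact: cvp.
- by apply/integrableP; split => //; rewrite integral_cst//= normr1 mul1e probability_setT ltry.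
- apply: aeW => om n _; rewrite gee0_abs ?lee_fin ?elap_ge0//.
  by rewrite elap_le1.
have I_ n : \int[P]_om (elap 1 (psum x (f_ n) om))%:E =
    (elap 1 (x%:E * \int[N]_w (1 - elap 1 (f_ n w))%:E))%:E by exact: laplace_simple.
have melap (g : S -> \bar R) : measurable_fun setT g ->
    measurable_fun setT (fun w => (1 - elap 1 (g w))%:E : \bar R).
  move=> mg; apply/measurable_EFinP; apply: measurable_funB => //.
  by apply: measurableT_comp mg; exact: measurable_fun_elap.
have mf_ n : measurable_fun setT (f_ n).
  by apply/measurable_EFinP; apply: measurable_funM => //; exact: measurable_indic.
have cI : \int[N]_w (1 - elap 1 (f_ n w))%:E @[n --> \oo] --> \int[N]_w (1 - elap 1 (f w))%:E.
  have := @cvg_monotone_convergence _ _ R N setT measurableT (fun n w => (1 - elap 1 (f_ n w))%:E).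
  have lm w : limn (fun n => (1 - elap 1 (f_ n w))%:E) = (1 - elap 1 (f w))%:E.
    apply/cvg_lim => //; apply: cvg_EFin; first exact: nearW.
    by apply: cvgB; [exact: cvg_cst|exact: elap_cvg].
  under [X in _ -> _ -> _ -> _ --> X]eq_integral do rewrite lm.
  apply.
  - by move=> n; exact: melap.
  - by move=> n w _; rewrite lee_fin subr_ge0 elap_le1.
  - move=> w _ p q pq; rewrite lee_fin lerB//.
    have := ndf w _ _ pq; rewrite /f_ lee_fin /= => h.
    by rewrite ler_expR lerN2 ler_pM2l.
have I0 (g : S -> \bar R) : (forall w, 0 <= g w) -> 0 <= \int[N]_w (1 - elap 1 (g w))%:E.
  by move=> g0; apply: integral_ge0 => w _; rewrite lee_fin subr_ge0 elap_le1.
have cR : (elap 1 (x%:E * \int[N]_w (1 - elap 1 (f_ n w))%:E))%:E @[n --> \oo] -->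
    (elap 1 (x%:E * \int[N]_w (1 - elap 1 (f w))%:E))%:E.
  apply: cvg_EFin; first exact: nearW.
  apply: elap_cvg => [n|]; first by rewrite mule_ge0 ?I0.
  exact: cvgeZl.
rewrite -(cvg_lim _ cL)// -(cvg_lim _ cR)//; congr (lim (_ @ \oo)).
by apply/funext => n; exact: I_.
Qed.

End laplace_functional.

Section path_limits.
Context {R : realType}.
Variables (Psi : R -> R) (lam0 : R).
Hypotheses (hP : admissible Psi) (hlam0 : 0 < lam0).
Local Notation V := (vinv Psi lam0).
Local Notation H := (oint Psi lam0).
Local Notation G := (Gfun Psi lam0).
Local Notation A lam := (io (up Psi lam0 lam)).
Local Notation B lam := (io (dn Psi lam0 lam)).
Implicit Types (t s lam : R) (z : \bar R).

Lemma Gfun_gt0 lam : 0 < G lam. Proof. exact: expR_gt0. Qed.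

Lemma Gfun_lt a b : 0 < a -> a < b -> G b < G a.
Proof. by move=> a0 ab; rewrite /Gfun ltr_expR ltrN2 oint_lt. Qed.

Lemma Gfun_le a b : 0 < a -> a <= b -> G b <= G a.
Proof. by move=> a0; rewrite le_eqVlt => /predU1P[->//|/(Gfun_lt a0)/ltW]. Qed.

Lemma Gfun_lt_inv a b : 0 < b -> G b < G a -> a < b.
Proof. by move=> b0; rewrite !ltNge; apply: contra; exact: Gfun_le. Qed.

Lemma Gfun_surj (c : R) : 0 < c -> exists2 y, 0 < y & G y = c.
Proof.
move=> c0; have [y y0 hy] := oint_surj hP hlam0 (- ln c).
by exists y => //; rewrite /Gfun hy opprK lnK.
Qed.

Lemma scaledG_ge0 t z : (0 <= scaledG Psi lam0 t z)%E.
Proof.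
rewrite /scaledG mule_ge0 ?lee_fin ?expR_ge0//.
case: z => [r| |] //=; case: ifP => // _; rewrite lee_fin ltW//; exact: Gfun_gt0.
Qed.

Let scaledG_fin t (r : R) : 0 < r -> scaledG Psi lam0 t r%:E = (expR (t - H r^-1))%:E.
Proof. by move=> r0; rewrite /scaledG /= r0 -EFinM /Gfun -expRD. Qed.

Let scaledG_y t : scaledG Psi lam0 t +oo%E = +oo%E.
Proof. by rewrite /scaledG /= gt0_muley// lte_fin expR_gt0. Qed.

Let scaledG_0 t : scaledG Psi lam0 t 0%E = 0%E.
Proof. by rewrite /scaledG /= ltxx mule0. Qed.

Lemma scaledG_ge t lam z : (0 <= z)%E ->
  ((G lam)%:E <= scaledG Psi lam0 t z)%E = ((V t lam)^-1%:E <= z)%E.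
Proof.
have V0 := vinv_gt0 hP hlam0 t lam.
case: z => [r| |]//; last by rewrite scaledG_y !leey.
rewrite lee_fin le_eqVlt => /predU1P[<-|r0].
  by rewrite scaledG_0 !lee_fin !leNgt Gfun_gt0 invr_gt0 V0.
rewrite scaledG_fin// !lee_fin /Gfun ler_expR.
have -> : (V t lam)^-1 <= r = (r^-1 <= V t lam) :> bool.
  by rewrite -[X in _ <= X]invrK lef_pV2 ?posrE ?invr_gt0.
have e := oint_vinv hP hlam0 t lam.
apply/idP/idP => h.
  by apply: (le_oint hP hlam0) => //; rewrite ?invr_gt0// e; lra.
have : H r^-1 <= H (V t lam) by apply: (oint_le hP hlam0) => //; rewrite invr_gt0.
by rewrite e; lra.
Qed.

Lemma scaledG_le t lam z : (0 <= z)%E ->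
  (scaledG Psi lam0 t z <= (G lam)%:E)%E = (z <= (V t lam)^-1%:E)%E.
Proof.
have V0 := vinv_gt0 hP hlam0 t lam.
case: z => [r| |]//; last by move=> _; rewrite scaledG_y !leye_eq.
rewrite lee_fin le_eqVlt => /predU1P[<-|r0].
  by rewrite scaledG_0 !lee_fin invr_ge0 (ltW V0) ltW// Gfun_gt0.
rewrite scaledG_fin// !lee_fin /Gfun ler_expR.
have -> : r <= (V t lam)^-1 = (V t lam <= r^-1) :> bool.
  by rewrite -[X in X <= _]invrK lef_pV2 ?posrE ?invr_gt0.
have e := oint_vinv hP hlam0 t lam.
apply/idP/idP => h.
  by apply: (le_oint hP hlam0) => //; rewrite ?invr_gt0// e; lra.
have : H (V t lam) <= H r^-1 by apply: (oint_le hP hlam0).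
by rewrite e; lra.
Qed.

Lemma gr_right_dense (s : nat) t (d : R) : 0 < d -> s.+1%:R <= t ->
  exists n j, t < gr s n j < t + d.
Proof.
move=> d0 st; pose n := (Num.truncn d^-1).+1.
have dn : d^-1 < 2 ^+ n.
  apply: lt_le_trans (truncnS_gt _) _; rewrite -/n -natrX ler_nat ltnW//.
  exact: ltn_expl.
have p0 : 0 < 2 ^+ n :> R by exact: exprn_gt0.
have y0 : 0 <= (t - s.+1%:R) * 2 ^+ n by rewrite mulr_ge0 ?subr_ge0// ltW.
have /andP[k1 k2] := truncn_itv y0.
exists n, (Num.truncn ((t - s.+1%:R) * 2 ^+ n)).+1; rewrite /gr; apply/andP; split.
  by rewrite -ltrBlDl ltr_pdivlMr.
rewrite -ltrBrDl ltr_pdivrMr// -natr1.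
apply: le_lt_trans (_ : (t - s.+1%:R) * 2 ^+ n + 1 < _); first by rewrite lerD2r.
have -> : (t + d - s.+1%:R) * 2 ^+ n = (t - s.+1%:R) * 2 ^+ n + d * 2 ^+ n by ring.
by rewrite ltrD2l -ltr_pdivrMl// mulr1.
Qed.

Let near_right (w : R -> \bar R) (Q : \bar R -> Prop) t : (w x @[x --> t^'+] --> w t) ->
  (nbhs (w t) Q) -> exists2 e : R, 0 < e & forall x, t < x < t + e -> Q (w x).
Proof.
move=> wt /wt [e /= e0 he]; exists e => // x /andP[tx xe]; apply: he => //=.
by rewrite distrC gtr0_norm ?subr_gt0// ltrBlDl.
Qed.

Lemma rcont_le (w : R -> \bar R) (s : nat) t (d : R) (c : \bar R) :
  (w x @[x --> t^'+] --> w t) -> s.+1%:R <= t -> 0 < d ->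
  (forall n j, t < gr s n j < t + d -> (w (gr s n j) <= c)%E) -> (w t <= c)%E.
Proof.
move=> rc st d0 hw.
rewrite leNgt; apply/negP => cwt.
have [e e0 he] := near_right rc (open_ereal_gt_ereal cwt).
have m0 : 0 < Num.min d e by rewrite lt_min d0.
have [n [j /andP[h1 h2]]] := gr_right_dense m0 st.
have := hw n j; rewrite h1 (lt_le_trans h2) ?lerD2l ?ge_min ?lexx// => /(_ isT).
by rewrite leNgt he// h1 (lt_le_trans h2)// lerD2l ge_min lexx orbT.
Qed.

Lemma cadlag_ge (w : R -> \bar R) (s : nat) t (d : R) (c : \bar R) : cadlag_pos w ->
  s.+1%:R <= t -> 0 < d ->
  (forall n j, t < gr s n j < t + d -> (c <= w (gr s n j))%E) -> (c <= w t)%E.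
Proof.
move=> cw st d0 hw; have t0 : 0 < t by exact: lt_le_trans st.
have [_ [rc _]] := cw _ t0.
rewrite leNgt; apply/negP => cwt.
have [e e0 he] := near_right rc (open_ereal_lt_ereal cwt).
have m0 : 0 < Num.min d e by rewrite lt_min d0.
have [n [j /andP[h1 h2]]] := gr_right_dense m0 st.
have := hw n j; rewrite h1 (lt_le_trans h2) ?lerD2l ?ge_min ?lexx// => /(_ isT).
by rewrite leNgt he// h1 (lt_le_trans h2)// lerD2l ge_min lexx orbT.
Qed.

Lemma notA_eventually (w : R -> \bar R) lam : cadlag_pos w -> 0 < lam -> ~ A lam w ->
  exists T : R, 0 < T /\ forall t, T <= t -> (w t <= (V t lam)^-1%:E)%E.
Proof.
move=> cw l0 /not_io [s hs]; exists s.+1%:R; split => // t st.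
have [_ [rc _]] := cw _ (lt_le_trans (ltr0Sn R s) st).
apply: (rcont_le rc st ltr01) => n j /andP[tq _].
have /negP := hs s n j (leqnn s); rewrite -ltNge => /ltW/le_trans; apply.
rewrite lee_fin lef_pV2 ?posrE ?vinv_gt0//.
by apply: vinv_le_time => //; exact: ltW.
Qed.

Lemma notB_eventually (w : R -> \bar R) lam lam' : cadlag_pos w -> 0 < lam -> lam < lam' ->
  ~ B lam w ->
  exists T : R, 0 < T /\ forall t, T <= t -> ((V t lam')^-1%:E <= w t)%E.
Proof.
move=> cw l0 ll /not_io [s hs]; exists s.+1%:R; split => // t st.
have d0 : 0 < H lam' - H lam by rewrite subr_gt0 oint_lt.
apply: (cadlag_ge cw st d0) => n j /andP[tq qd].
have q0 : 0 < gr s n j :> R by exact: gr_gt0.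
have [wq _] := cw _ q0.
have : ~ (w (gr s n j) <= (V (gr s n j) lam)^-1%:E)%E.
  by move=> h; apply: (hs s n j (leqnn s)).
move/negP; rewrite -ltNge => /ltW; apply: le_trans.
rewrite lee_fin lef_pV2 ?posrE ?vinv_gt0//.
apply: (le_oint hP hlam0); rewrite ?vinv_gt0// !oint_vinv//.
by move: qd; lra.
Qed.

Definition rlam (n : nat) : R :=
  if @choice.unpickle rat n is Some q then (if 0 < q then ratr q else 1) else 1.

Lemma rlam_gt0 n : 0 < rlam n.
Proof. by rewrite /rlam; case: choice.unpickle => // q; case: ifP => // q0; rewrite ltr0q. Qed.

Lemma rlam_dense a b : 0 <= a -> a < b -> exists n, a < rlam n < b.
Proof.
move=> a0 ab; have [q] := rat_in_itvoo ab; rewrite in_itv/= => /andP[aq qb].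
exists (choice.pickle q); rewrite /rlam choice.pickleK.
have -> : 0 < q by rewrite -(ltr0q R); exact: le_lt_trans aq.
by rewrite aq qb.
Qed.

Definition pconv : set (@Dpath R) :=
  [set w : Dpath | forall i j, rlam i < rlam j -> ~ (A (rlam i) w /\ B (rlam j) w)].

Definition zsup (w : Dpath) : \bar R :=
  ereal_sup (0%E |` [set (G (rlam i))%:E | i in [set i | ~ B (rlam i) w]]).

Lemma zsup_ge0 w : (0 <= zsup w)%E.
Proof. by apply: ereal_sup_ubound; left. Qed.

Lemma ereal_cvg_order {T : Type} {F : set_system T} {FF : ProperFilter F} (f : T -> \bar R) l :
  (0 <= l)%E -> (forall a : R, (a%:E < l)%E -> \forall x \near F, (a%:E < f x)%E) ->
  (forall b : R, (l < b%:E)%E -> \forall x \near F, (f x < b%:E)%E) ->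
  f x @[x --> F] --> l.
Proof.
case: l => [r| |]// r0 ha hb; last first.
  by apply/cvgeyPgt => a; apply: ha; rewrite ltry.
have h e : 0 < e -> \forall x \near F, ((r - e)%:E < f x < (r + e)%:E)%E.
  move=> e0; near=> x; apply/andP; split; near: x.
    by apply: ha; rewrite lte_fin ltrBlDr ltrDl.
  by apply: hb; rewrite lte_fin ltrDl.
apply/fine_cvgP; split.
  by apply: filterS (h 1 ltr01) => x; case: (f x) => [y| |]//=; rewrite ?andbF.
apply/cvgrPdist_lt => e e0; apply: filterS (h e e0) => x /=.
case: (f x) => [y| |]//=; rewrite ?andbF//.
by rewrite !lte_fin => /andP[h1 h2]; rewrite distrC ltr_distl h1.
Unshelve. all: by end_near. Qed.

Lemma pconv_cvg (w : R -> \bar R) : cadlag_pos w -> pconv w ->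
  scaledG Psi lam0 t (w t) @[t --> +oo%R] --> zsup w.
Proof.
move=> cw pw; apply: ereal_cvg_order; first exact: zsup_ge0.
- move=> a /ereal_sup_gt [y [->|[i nB <-]]].
    rewrite lte_fin => a0; apply: nearW => t.
    by apply: lt_le_trans (scaledG_ge0 _ _).
  rewrite lte_fin => aG.
  have m0 : 0 < Num.max 0 a + (G (rlam i) - Num.max 0 a) / 2 < G (rlam i).
    have : Num.max 0 a < G (rlam i) by rewrite gt_max Gfun_gt0.
    have : 0 <= Num.max 0 a by rewrite le_max lexx.
    by move=> h1 h2; apply/andP; split; lra.
  have am : a < Num.max 0 a + (G (rlam i) - Num.max 0 a) / 2.
    have : Num.max 0 a < G (rlam i) by rewrite gt_max Gfun_gt0.
    have : a <= Num.max 0 a by rewrite le_max lexx orbT.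
    by move=> h1 h2; lra.
  have /andP[m1 m2] := m0.
  have [y' y'0 ey] := Gfun_surj m1.
  have li : rlam i < y' by apply: Gfun_lt_inv => //; rewrite ey.
  have [T [T0 hT]] := notB_eventually cw (rlam_gt0 i) li nB.
  near=> t; apply: (@lt_le_trans _ _ (G y')%:E); first by rewrite lte_fin ey.
  have Tt : T <= t by near: t; apply: nbhs_pinfty_ge; exact: num_real.
  have [wt _] := cw t (lt_le_trans T0 Tt).
  by rewrite scaledG_ge// hT.
- move=> b zb.
  have b0 : 0 < b by rewrite -lte_fin; exact: le_lt_trans (zsup_ge0 w) zb.
  have zf : zsup w \is a fin_num.
    by rewrite ge0_fin_numE ?zsup_ge0//; apply: lt_trans zb _; rewrite ltry.
  pose z := fine (zsup w).
  have ez : zsup w = z%:E by rewrite fineK.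
  have z0 : 0 <= z by rewrite -lee_fin -ez zsup_ge0.
  have zb' : z < b by rewrite -lte_fin -ez.
  have bz0 : 0 < (b - z) / 2 by rewrite divr_gt0 ?subr_gt0.
  have m1 : 0 < z + (b - z) / 2 by rewrite ltr_wpDl.
  have zm : z < z + (b - z) / 2 by rewrite ltrDl.
  have mb : z + (b - z) / 2 < b.
    by rewrite -ltrBrDl ltr_pdivrMr// ltr_pMr ?subr_gt0// ltrDl.
  have [yb yb0 eb] := Gfun_surj b0; have [ym ym0 em] := Gfun_surj m1.
  have bm : yb < ym by apply: Gfun_lt_inv => //; rewrite eb em.
  have [i /andP[i1 i2]] := rlam_dense (ltW yb0) bm.
  have [j /andP[j1 j2]] := rlam_dense (ltW (rlam_gt0 i)) i2.
  have Bj : B (rlam j) w.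
    apply: contrapT => nB.
    have : ((G (rlam j))%:E <= zsup w)%E by apply: ereal_sup_ubound; right; exists j.
    rewrite ez lee_fin leNgt => /negP; apply; apply: lt_trans zm _.
    by rewrite -em Gfun_lt// rlam_gt0.
  have nA : ~ A (rlam i) w by move=> Ai; exact: (pw i j j1).
  have [T [T0 hT]] := notA_eventually cw (rlam_gt0 i) nA.
  near=> t; apply: (@le_lt_trans _ _ (G (rlam i))%:E); last first.
    by rewrite lte_fin -eb; exact: Gfun_lt.
  have Tt : T <= t by near: t; apply: nbhs_pinfty_ge; exact: num_real.
  have [wt _] := cw t (lt_le_trans T0 Tt).
  by rewrite scaledG_le// hT.
Unshelve. all: by end_near. Qed.

Lemma io_unbounded D (w : Dpath) (T : R) : io D w -> exists q, T <= q /\ 0 < q /\ D q (w q).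
Proof.
move=> /(_ (Num.truncn T)) [n [j hD]]; exists (gr (Num.truncn T) n j); split => //.
  by apply: le_trans (ltW (truncnS_gt _)) (gr_ge _ _ _).
by split => //; exact: gr_gt0.
Qed.

Lemma cvg_pconv (w : R -> \bar R) (l : \bar R) : cadlag_pos w ->
  scaledG Psi lam0 t (w t) @[t --> +oo%R] --> l -> pconv w.
Proof.
move=> cw wl i j ij [Ai Bj].
have lA : ((G (rlam i))%:E <= l)%E.
  rewrite leNgt; apply/negP => h; have [M [_ hM]] := wl _ (open_ereal_lt_ereal h).
  have [q [Mq [q0 hq]]] := io_unbounded (M + 1) Ai.
  have [wq _] := cw _ q0.
  have : (scaledG Psi lam0 q (w q) < (G (rlam i))%:E)%E.
    by apply: hM; rewrite (lt_le_trans _ Mq)// ltrDl.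
  by rewrite ltNge scaledG_ge// hq.
have lB : (l <= (G (rlam j))%:E)%E.
  rewrite leNgt; apply/negP => h; have [M [_ hM]] := wl _ (open_ereal_gt_ereal h).
  have [q [Mq [q0 [_ hq]]]] := io_unbounded (M + 1) Bj.
  have [wq _] := cw _ q0.
  have : ((G (rlam j))%:E < scaledG Psi lam0 q (w q))%E.
    by apply: hM; rewrite (lt_le_trans _ Mq)// ltrDl.
  by rewrite ltNge scaledG_le// hq.
have := le_trans lA lB; rewrite lee_fin leNgt.
by rewrite Gfun_lt// rlam_gt0.
Qed.

Definition zeta (w : Dpath) : R := if `[< pconv w >] then fine (zsup w) else fine (point : \bar R).

Lemma Zlim_pconv (w : R -> \bar R) : cadlag_pos w -> pconv w -> Zlim Psi lam0 w = zsup w.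
Proof. by move=> cw pw; apply/cvg_lim => //; exact: pconv_cvg. Qed.

Lemma fine_Zlim (w : R -> \bar R) : cadlag_pos w -> fine (Zlim Psi lam0 w) = zeta w.
Proof.
move=> cw; rewrite /zeta; case: asboolP => pw; first by rewrite Zlim_pconv.
rewrite /Zlim dvgP// => /cvg_ex [l hl]; apply: pw; exact: cvg_pconv hl.
Qed.

Lemma pconv_measurable : measurable pconv.
Proof.
rewrite (_ : pconv = \bigcap_i \bigcap_j (if rlam i < rlam j then
    ~` (A (rlam i) `&` B (rlam j)) else setT)).
  apply: bigcapT_measurable => i; apply: bigcapT_measurable => j.
  case: ifP => // _; apply: measurableC; apply: measurableI; apply: io_measurable => q.
    exact: up_measurable.
  exact: dn_measurable.
apply/seteqP; split => w.
  by move=> h i _ j _; case: ifPn => // ij; exact: h.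
by move=> h i j ij; have := h i I j I; rewrite ij.
Qed.

Lemma zsup_measurable : measurable_fun setT zsup.
Proof.
apply: (measurability (@ErealGenOInfty.G R)) => [|/= _ [_] [y] -> <-].
  exact: ErealGenOInfty.measurableE.
rewrite setTI.
rewrite (_ : zsup @^-1` _ = [set w | (y%:E < 0)%E] `|`
    \bigcup_i (if (y%:E < (G (rlam i))%:E)%E then ~` B (rlam i) else set0)).
  apply: measurableU.
    by case: (boolP (y%:E < 0)%E) => h; [rewrite (_ : [set _ | _] = setT)//|
      rewrite (_ : [set _ | _] = set0)//]; apply/seteqP; split.
  apply: bigcupT_measurable => i; case: ifP => // _; apply: measurableC.
  by apply: io_measurable => q; exact: dn_measurable.
apply/seteqP; split => w /=.
  rewrite in_itv/= andbT => /ereal_sup_gt [x [->|[i nB <-]] yx]; first by left.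
  by right; exists i => //; rewrite yx.
rewrite in_itv/= andbT => -[y0|[i _]]; first exact: lt_le_trans (zsup_ge0 w).
case: ifPn => // yG nB; apply: lt_le_trans yG _.
by apply: ereal_sup_ubound; right; exists i.
Qed.

Lemma zeta_measurable : measurable_fun setT zeta.
Proof.
apply: measurable_fun_ifT => //; last exact: measurableT_comp zsup_measurable.
apply: (@measurable_fun_bool _ _ _ _ true).
rewrite setTI (_ : _ @^-1` _ = pconv); first exact: pconv_measurable.
by apply/seteqP; split => w /=; [move/asboolP|move=> h; apply/asboolP].
Qed.

End path_limits.

Lemma cvg_eq_cst {R : realType} (u : nat -> \bar R) (c : \bar R) : (forall n, u n = c) ->
  u n @[n --> \oo] --> c.
Proof. by move=> /funext ->; exact: cvg_cst. Qed.

Section void.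
Context {R : realType} {d dS : measure_display} {Om : measurableType d} {S : measurableType dS}.
Variables (P : probability Om R) (N : {measure set S -> \bar R}).
Variables (xs : Om -> nat -> R) (ws : Om -> nat -> S).
Hypothesis hPPP : is_PPP P (marked_atoms xs ws) (intensity N).
Hypothesis hNsf : sigma_finite setT N.

(* The number of points of [0, 1] * (D `&` E) vanishes identically, hence so does its mean. *)
Lemma ppp_void (D : set S) : measurable D -> (forall om n, ~ D (ws om n)) -> N D = 0%E.
Proof.
move=> mD hD; have [E [mE NE ndE UE]] := sigma_finite_exhaustion hNsf.
have h n : N (D `&` E n) = 0%E.
  have mDE : measurable (D `&` E n) by exact: measurableI.
  have NDE : (N (D `&` E n) < +oo)%E.
    by apply: le_lt_trans (NE n); apply: le_measure; rewrite ?inE.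
  have e : intensity N (rect 1 (D `&` E n)) = N (D `&` E n) by rewrite nu_rect// mule1.
  have [|mC PC] := ppp1 hPPP 0%N (rect_measurable 1 mDE); first by rewrite e.
  have : P [set om | cnt (marked_atoms xs ws om) (rect 1 (D `&` E n)) = 0%:R%:E :> \bar R] = 1%E.
    rewrite -(probability_setT P); congr (P _); apply/seteqP; split => // om _ /=.
    rewrite /cnt eseries0// => i _ _; rewrite indicE memNset//.
    by move=> [_ [/hD]].
  rewrite PC e /pois expr0 mulr1 fact0 divr1 => -[] /(congr1 (@ln R)).
  rewrite expRK ln1 => /eqP; rewrite oppr_eq0 => /eqP h0.
  by rewrite -(@fineK _ (N _)) ?h0// ge0_fin_numE.
have : N.-negligible D.
  have : N.-negligible (\bigcup_n (D `&` E n)).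
    apply: negligible_bigcup => n; apply/negligibleP; last exact: h.
    exact: measurableI.
  apply: negligibleS => w Dw; have [n En] := UE w; by exists n.
by move/negligibleP => ->.
Qed.

End void.

Section excursion_measure.
Context {R : realType}.
Variables (Psi : R -> R) (lam0 : R).
Hypotheses (hP : admissible Psi) (hlam0 : 0 < lam0).
Variables (ell : R -> {measure set (\bar R) -> \bar R}).
Hypothesis hell0 : forall t, 0 < t -> ell t [set z | (z <= 0)%E] = 0%E.
Hypothesis hell : forall t lam v, 0 < t -> 0 < lam -> is_cum Psi t lam v ->
  (\int[ell t]_z (1 - elap lam z)%:E)%E = v%:E.
Variables (K : R -> \bar R -> {measure set (\bar R) -> \bar R}).
Hypothesis hK0 : forall s y, 0 < s -> (0 <= y)%E ->
  K s y [set z | (z < 0)%E] = 0%E /\ K s y setT = 1%E.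
Hypothesis hK : forall s y lam v, 0 < s -> (0 <= y)%E -> 0 < lam -> is_cum Psi s lam v ->
  (\int[K s y]_z (elap lam z)%:E)%E = (elap v y)%:E.
Variable N : {measure set (@Dpath R) -> \bar R}.
Hypothesis hNfdd : forall (t : R) (B : set (\bar R)) (l : seq (R * set (\bar R))),
  0 < t -> measurable B -> B `<=` [set z | (0 < z)%E] ->
  all (fun p => 0 < p.1) l -> (forall p, p \in l -> measurable p.2) ->
  N (((fun w : R -> \bar R => w t) @^-1` B) `&` cyl t l) =
    (\int[ell t]_(y in B) fdd_iter K y l)%E.
Hypothesis Npos : forall t : R, (0 < t)%R -> N [set w : Dpath | (w t < 0)%E] = 0%E.
Hypothesis hNabs : forall s t : R, 0 < s < t ->
  N [set w : R -> \bar R | w s = 0%E /\ w t != 0%E] = 0%E.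
Hypothesis hNnz : N [set w : R -> \bar R | forall q : rat, 0 < q -> w (ratr q) = 0%E] = 0%E.

Local Notation V := (vinv Psi lam0).
Local Notation G := (Gfun Psi lam0).
Local Notation A lam := (io (up Psi lam0 lam)).
Local Notation B lam := (io (dn Psi lam0 lam)).
Implicit Types (t lam : R).

Definition posat t : set (@Dpath R) := [set w : Dpath | (0 < w t)%E].
Definition posat_n t n : set (@Dpath R) := [set w : Dpath | (n.+1%:R^-1%:E <= w t)%E].

Lemma posat_measurable t : 0 < t -> measurable (posat t).
Proof. by move=> t0; exact: (coord_measurable t0 (measurable_ereal_gt 0%E)). Qed.

Lemma posat_n_pcyl t n : 0 < t -> exists E, pcyl t (posat_n t n) E.
Proof.
move=> t0; exists [set z | (n.+1%:R^-1%:E <= z)%E]; apply: pcyl_init => //.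
  exact: measurable_ereal_ge.
by move=> z /=; apply: lt_le_trans; rewrite lte_fin invr_gt0.
Qed.

Lemma posat_n_nd t : {homo posat_n t : n m / (n <= m)%N >-> (n <= m)%O}.
Proof.
move=> n m nm; apply/subsetPset => w; apply: le_trans.
by rewrite lee_fin lef_pV2 ?posrE// ler_nat.
Qed.

Lemma posat_bigcup t : posat t = \bigcup_n posat_n t n.
Proof.
apply/seteqP; split => w /=; last first.
  by move=> [n _]; apply: lt_le_trans; rewrite lte_fin invr_gt0.
rewrite /posat /=; case E : (w t) => [r| |]//; last first.
  by move=> _; exists 0%N => //; rewrite /posat_n /= E leey.
rewrite lte_fin => r0; exists (Num.truncn r^-1) => //; rewrite /posat_n /= E lee_fin.
rewrite -[X in _ <= X]invrK lef_pV2 ?posrE ?invr_gt0//.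
by apply: ltW; exact: truncnS_gt.
Qed.

Lemma N_coord t (D : set (\bar R)) : 0 < t -> measurable D -> D `<=` [set z | (0 < z)%E] ->
  N ((fun w : Dpath => w t) @^-1` D) = ell t D.
Proof.
move=> t0 mD Dp; have := @hNfdd t D [::] t0 mD Dp isT.
rewrite /= setIT => -> //; by rewrite integral_cst// mul1e.
Qed.

Lemma cum_vinv t lam : 0 < t -> 0 < lam -> is_cum Psi t (V t lam) lam.
Proof.
move=> t0 l0; have := vinv_is_cum hP hlam0 0 lam (ltW t0).
by rewrite add0r vinv0.
Qed.

Lemma le_vinv t lam : 0 < t -> 0 < lam -> lam <= V t lam.
Proof. by move=> t0 l0; have [_ []] := cum_vinv t0 l0. Qed.

Let elapC_ge0 (c : R) (z : \bar R) : 0 <= c -> (0 <= z)%E -> (0 <= (1 - elap c z)%:E)%E.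
Proof. by move=> c0 z0; rewrite lee_fin subr_ge0 elap_le1. Qed.

Let melapC (c : R) D : measurable_fun D (fun z : \bar R => (1 - elap c z)%:E : \bar R).
Proof.
apply: measurable_funTS; apply/measurable_EFinP; apply: measurable_funB => //.
exact: measurable_fun_elap.
Qed.

Lemma ell_pos_elap t (c : R) : 0 < t -> 0 < c ->
  (\int[ell t]_(z in [set z | (0 < z)%E]) (1 - elap c z)%:E = \int[ell t]_z (1 - elap c z)%:E)%E.
Proof.
move=> t0 c0; have mp : measurable [set z : \bar R | (0 < z)%E] by exact: measurable_ereal_gt.
rewrite integral_mkcond; apply: ae_eq_integral => //.
- by apply/(measurable_restrictT _ _).1.
exists [set z | (z <= 0)%E]; split; [exact: measurable_ereal_le|exact: hell0|].
move=> z /= /not_implyP [_ hz]; rewrite leNgt; apply/negP => z0; apply: hz.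
by rewrite /patch mem_set.
Qed.

Lemma N_posat_n_fin t n : 0 < t -> (N (posat_n t n) < +oo)%E.
Proof.
move=> t0; set D := [set z : \bar R | (n.+1%:R^-1%:E <= z)%E].
have e0 : 0 < n.+1%:R^-1 :> R by rewrite invr_gt0.
have mD : measurable D by exact: measurable_ereal_ge.
have Dp : D `<=` [set z | (0 < z)%E].
  by move=> z /=; apply: lt_le_trans; rewrite lte_fin.
rewrite (_ : N _ = ell t D); last exact: N_coord.
pose a : R := 1 - expR (- n.+1%:R^-1).
have a0 : 0 < a by rewrite subr_gt0 expR_lt1 oppr_lt0.
have h1 : (a%:E * ell t D <= \int[ell t]_(z in [set z | (0 < z)%E]) (1 - elap 1 z)%:E)%E.
  rewrite -integral_cst//; apply: (@le_trans _ _ (\int[ell t]_(z in D) (1 - elap 1 z)%:E)%E).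
    apply: ge0_le_integral => //; first by move=> z _; rewrite lee_fin ltW.
    move=> z; rewrite /D /=; case: z => [r| |]//=; rewrite ?lee_fin /a.
      by move=> r1; rewrite lerD2l lerN2 mul1r ler_expR lerN2.
    by move=> _; rewrite lerD2l lerN2 expR_ge0.
  apply: ge0_subset_integral => //; first exact: measurable_ereal_gt.
  by move=> z /ltW z0; exact: elapC_ge0.
rewrite ltey; apply/eqP => h; move: h1.
have cum1 := cum_vinv t0 (vinv_gt0 hP hlam0 (- t) 1).
rewrite vinvD// addNr vinv0// in cum1.
by rewrite h gt0_muley ?lte_fin// (ell_pos_elap t0 ltr01) (hell t0 ltr01 cum1).
Qed.

Lemma N_posat_lap t lam : 0 < t -> 0 < lam ->
  (\int[N]_(w in posat t) (1 - lap (V t lam) (w t))%:E = lam%:E)%E.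
Proof.
move=> t0 l0; have c0 := vinv_gt0 hP hlam0 t lam.
have mp : measurable [set z : \bar R | (0 < z)%E] by exact: measurable_ereal_gt.
have mX := measurable_coord t0.
rewrite -(hell t0 c0 (cum_vinv t0 l0)) -(ell_pos_elap t0 c0).
transitivity (\int[pushforward N (fun w : Dpath => w t)]_(z in [set z | (0 < z)%E])
    (1 - elap (V t lam) z)%:E)%E; last first.
  by apply: eq_measure_integral => D mD Dp; rewrite -(N_coord t0 mD Dp).
rewrite [RHS]ge0_integral_pushforward//; last first.
  by move=> z /set_mem/ltW z0; exact: elapC_ge0 (ltW c0) z0.
by apply: eq_integral => w /set_mem/ltW wt; rewrite /= lap_elap.
Qed.

Let mA lam : measurable (A lam : set (@Dpath R)).
Proof. by apply: io_measurable => q; exact: up_measurable. Qed.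
Let mB lam : measurable (B lam : set (@Dpath R)).
Proof. by apply: io_measurable => q; exact: dn_measurable. Qed.

Lemma N_posat_cvg t D : 0 < t -> measurable D ->
  (N (posat_n t n `&` D) @[n --> \oo] --> N (posat t `&` D))%E.
Proof.
move=> t0 mD; rewrite posat_bigcup setI_bigcupl.
have mF n : measurable (posat_n t n).
  by have [E /pcyl_measurable] := posat_n_pcyl n t0.
apply: nondecreasing_cvg_mu => [n||n m nm]; first exact: measurableI.
  by apply: bigcupT_measurable => n; exact: measurableI.
apply/subsetPset; apply: setSI; apply/subsetPset; exact: posat_n_nd.
Qed.

Lemma N_posat_updn t lam : 0 < t -> 0 < lam ->
  [/\ N (posat t `&` A lam) = lam%:E, N (posat t `&` ~` B lam) = lam%:E &
      N (posat t `&` (A lam `&` B lam)) = 0%E].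
Proof.
move=> t0 l0.
have c0 := vinv_gt0 hP hlam0 t lam.
have mF n : measurable (posat_n t n).
  by have [E /pcyl_measurable] := posat_n_pcyl n t0.
have mf D : measurable_fun D (fun w : Dpath => (1 - lap (V t lam) (w t))%:E : \bar R).
  apply: measurable_funTS; apply/measurable_EFinP; apply: measurable_funB => //.
  by apply: measurableT_comp (measurable_coord t0); exact: measurable_fun_lap.
have cI : (\int[N]_(w in posat_n t n) (1 - lap (V t lam) (w t))%:E @[n --> \oo] --> lam%:E)%E.
  rewrite -(N_posat_lap t0 l0) posat_bigcup.
  apply: ge0_nondecreasing_set_cvg_integral => //; first exact: posat_n_nd.
  by move=> n w _; rewrite lee_fin subr_ge0 lap_le1// ltW.
have h n := let: ex_intro E pE := posat_n_pcyl n t0 in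
  N_updn hP hlam0 hK0 hK hNfdd Npos pE (N_posat_n_fin n t0) l0.
split.
- apply: cvg_unique (N_posat_cvg t0 (mA lam)) _ => //.
  by apply: cvg_trans cI; apply: near_eq_cvg; apply: nearW => n; case: (h n).
- apply: cvg_unique (N_posat_cvg t0 (measurableC (mB lam))) _ => //.
  by apply: cvg_trans cI; apply: near_eq_cvg; apply: nearW => n; case: (h n).
- apply: cvg_unique (N_posat_cvg t0 (measurableI _ _ (mA lam) (mB lam))) _ => //.
  by apply: cvg_eq_cst => n; case: (h n).
Qed.

Let tn (n : nat) : R := n.+1%:R^-1.
Let tn0 n : 0 < tn n. Proof. by rewrite invr_gt0. Qed.

Let badstart : set (@Dpath R) :=
  (\bigcup_n \bigcup_j [set w : Dpath | tn n < rlam j /\ (w (tn n) = 0%E /\ w (rlam j) != 0%E)]) `|`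
  (\bigcup_n [set w : Dpath | w (tn n.+1) = 0%E /\ w (tn n) != 0%E]) `|`
  (\bigcup_n [set w : Dpath | (w (tn n) < 0)%E]) `|`
  [set w : Dpath | forall q : rat, 0 < q -> w (ratr q) = 0%E].

Let mzero (t : R) : 0 < t -> measurable [set w : @Dpath R | w t = 0%E].
Proof. by move=> t0; exact: (coord_measurable t0 (emeasurable_set1 0%E)). Qed.

Let badstart_null : N.-negligible badstart.
Proof.
have habs s t : 0 < s -> 0 < t -> (s < t -> N.-negligible [set w : Dpath | w s = 0%E /\ w t != 0%E]).
  move=> s0 t0 st; apply/negligibleP; last by apply: hNabs; rewrite s0.
  rewrite (_ : [set _ | _] = [set w : Dpath | w s = 0%E] `&` ~` [set w : Dpath | w t = 0%E]).
    by apply: measurableI; [exact: mzero|apply: measurableC; exact: mzero].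
  by apply/seteqP; split => w /= [h1 h2]; split => //; [exact/eqP|apply/eqP].
apply: negligibleU; first (apply: negligibleU; first apply: negligibleU).
- apply: negligible_bigcup => n; apply: negligible_bigcup => j.
  have [h|h] := pselect (tn n < rlam j); last first.
    by apply: negligibleS (negligible_set0 N) => w [].
  by apply: negligibleS (habs _ _ (tn0 n) (rlam_gt0 j) h) => w [].
- apply: negligible_bigcup => n; apply: habs => //.
  by rewrite /tn ltf_pV2 ?posrE// ltr_nat.
- apply: negligible_bigcup => n; apply/negligibleP; last exact: Npos.
  exact: (coord_measurable (tn0 n) (measurable_ereal_lt 0%E)).
- apply/negligibleP; last exact: hNnz.
  rewrite (_ : [set _ | _] = \bigcap_j [set w : Dpath | w (rlam j) = 0%E]).
    by apply: bigcapT_measurable => j; apply: mzero; exact: rlam_gt0.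
  apply/seteqP; split => w /=.
    move=> h j _; rewrite /= /rlam; case: choice.unpickle => [q|].
      by case: ifPn => [q0|_]; [exact: h|rewrite -(rmorph1 (@ratr R)); exact: h].
    by rewrite -(rmorph1 (@ratr R)); exact: h.
  move=> h q q0; have := h (choice.pickle q) I.
  by rewrite /= /rlam choice.pickleK q0.
Qed.

Lemma N_start D (c : \bar R) : measurable D -> (forall t, 0 < t -> N (posat t `&` D) = c) -> N D = c.
Proof.
move=> mD hD; have [Z [mZ NZ bZ]] := badstart_null.
have NDZ E : measurable E -> N E = N (E `\` Z).
  move=> mE; apply/eqP; rewrite eq_le; apply/andP; split; last first.
    by apply: le_measure; rewrite ?inE//; exact: measurableD.
  apply: (@le_trans _ _ (N ((E `\` Z) `|` Z))).
    apply: le_measure; rewrite ?inE//; first by apply: measurableU => //; exact: measurableD.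
    by move=> w Ew; have [|nZ] := pselect (Z w); [right|left].
  apply: (@le_trans _ _ (N (E `\` Z) + N Z)%E).
    by apply: measureU2 => //; exact: measurableD.
  by rewrite NZ adde0.
pose F n := (posat (tn n) `&` D) `\` Z.
have mF n : measurable (F n).
  by apply: measurableD => //; apply: measurableI => //; exact: posat_measurable.
have UF : \bigcup_n F n = D `\` Z.
  apply/seteqP; split => w; first by move=> [n _ [[_ ?] ?]].
  move=> [Dw nZ]; have nb : ~ badstart w by move=> /bZ.
  apply: contrapT => hw; apply: nb; right => q q0.
  have z n : w (tn n) = 0%E.
    apply: le_anti; apply/andP; split.
      by rewrite leNgt; apply/negP => h; apply: hw; exists n.
    by rewrite leNgt; apply/negP => h; apply: nZ; apply: bZ; left; right; exists n.
  apply/eqP; apply: contrapT => /negP wq; apply: nZ; apply: bZ; left; left; left.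
  exists (Num.truncn (ratr q : R)^-1) => //; exists (choice.pickle q) => //=.
  rewrite /rlam choice.pickleK q0; split => //.
  rewrite /tn -[X in _ < X]invrK ltf_pV2 ?posrE ?invr_gt0 ?ltr0q//.
  exact: truncnS_gt.
rewrite (NDZ D mD) -UF.
apply: cvg_unique (_ : (N \o F) n @[n --> \oo] --> c) => //.
  apply: nondecreasing_cvg_mu => //; first exact: bigcupT_measurable.
  apply/nondecreasing_seqP => n; apply/subsetPset => w [[pw Dw] nZ]; split => //; split => //.
  rewrite /posat /= ltNge; apply/negP => h; apply: nZ; apply: bZ.
  have [h0|h0] := ltP (w (tn n.+1)) 0%E; first by left; right; exists n.+1.
  left; left; right; exists n => //=; split; first by apply: le_anti; rewrite h h0.
  by rewrite gt_eqF.
apply: cvg_eq_cst => n.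
rewrite /= -NDZ ?hD//; by apply: measurableI => //; exact: posat_measurable.
Qed.

Lemma N_up lam : 0 < lam -> N (A lam) = lam%:E.
Proof. by move=> l0; apply: N_start => // t t0; case: (N_posat_updn t0 l0). Qed.

Lemma N_notdn lam : 0 < lam -> N (~` B lam) = lam%:E.
Proof.
by move=> l0; apply: N_start => [|t t0]; [exact: measurableC|case: (N_posat_updn t0 l0)].
Qed.

Lemma N_updnI lam : 0 < lam -> N (A lam `&` B lam) = 0%E.
Proof.
by move=> l0; apply: N_start => [|t t0]; [exact: measurableI|case: (N_posat_updn t0 l0)].
Qed.

Lemma dn_mono lam lam' : 0 < lam -> lam <= lam' -> B lam' `<=` B lam.
Proof.
move=> l0 ll w hw s; have [n [j [h0 h1]]] := hw s; exists n, j.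
split; [exact: h0|apply: le_trans h1 _]; rewrite lee_fin lef_pV2 ?posrE ?vinv_gt0//; exact: vinv_le.
Qed.

Lemma N_npconv : N (~` pconv Psi lam0) = 0%E.
Proof.
apply/negligibleP; first by apply: measurableC; exact: pconv_measurable.
have : N.-negligible (\bigcup_i (A (rlam i) `&` B (rlam i))).
  apply: negligible_bigcup => i; apply/negligibleP; first exact: measurableI.
  by apply: N_updnI; exact: rlam_gt0.
apply: negligibleS => w /existsNP [i /existsNP [j /not_implyP [ij /contrapT [Ai Bj]]]].
exists i; first exact: I.
by split; [exact: Ai|apply: dn_mono (rlam_gt0 i) (ltW ij) _ Bj].
Qed.

Local Notation zs := (zsup Psi lam0).

Lemma N_zsup_infty : N [set w | zs w = +oo%E] = 0%E.
Proof.
have mz : measurable [set w | zs w = +oo%E].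
  by rewrite -[X in measurable X]setTI; exact: (zsup_measurable Psi lam0 measurableT (emeasurable_set1 +oo%E)).
apply/eqP; rewrite -measure_le0; apply/lee_addgt0Pr => e e0; rewrite add0e -(N_notdn e0).
apply: le_measure; rewrite ?inE//; first exact: measurableC.
move=> w /= zw Be; have : ((G e)%:E < zs w)%E by rewrite zw ltry.
move=> /ereal_sup_gt [y [->|[i nB <-]]]; rewrite lte_fin.
  by move=> /ltW; rewrite leNgt Gfun_gt0.
move=> h; apply: nB; apply: dn_mono Be; first exact: rlam_gt0.
by apply: ltW; exact: (Gfun_lt_inv hP hlam0 e0).
Qed.

Lemma N_zsup0 : N [set w | zs w = 0%E] = 0%E.
Proof.
have mz : measurable [set w | zs w = 0%E].
  by rewrite -[X in measurable X]setTI; exact: (zsup_measurable Psi lam0 measurableT (emeasurable_set1 0%E)).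
apply: N_start => // t t0.
apply: cvg_unique (N_posat_cvg t0 mz) _ => //.
apply: cvg_eq_cst => n.
have [E pE] := posat_n_pcyl n t0; have mE := pcyl_measurable pE.
have Nf := N_posat_n_fin n t0.
apply/eqP; rewrite -measure_le0; apply/lee_addgt0Pr => e e0; rewrite add0e.
pose M := fine (N (posat_n t n)); have M0 : 0 <= M by exact: fine_ge0.
have NM : N (posat_n t n) = M%:E by rewrite fineK// ge0_fin_numE.
pose lam := n.+1%:R * (M / e) + 1.
have lM0 : 0 <= M / e by rewrite divr_ge0// ltW.
have l0 : 0 < lam by rewrite ltr_wpDl// mulr_ge0.
have l1 : lam < lam + 1 by rewrite ltrDl.
have [i /andP[li _]] := rlam_dense (ltW l0) l1.
have [_ _ _ eB _] := N_updn hP hlam0 hK0 hK hNfdd Npos pE Nf (rlam_gt0 i).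
apply: (@le_trans _ _ (N (posat_n t n `&` B (rlam i)))).
  apply: le_measure; rewrite ?inE; [exact: measurableI|exact: measurableI|].
  move=> w [pw zw]; split => //; apply: contrapT => nB.
  have : ((G (rlam i))%:E <= zs w)%E by apply: ereal_sup_ubound; right; exists i.
  by rewrite zw lee_fin leNgt Gfun_gt0.
have MV : M / e <= V t (rlam i) * n.+1%:R^-1.
  rewrite ler_pdivlMr// mulrC; apply: le_trans (le_vinv t0 (rlam_gt0 i)).
  by apply: le_trans (ltW li); rewrite /lam lerDl.
rewrite eB; apply: (@le_trans _ _ (\int[N]_(w in posat_n t n) (expR (- (M / e)))%:E)%E).
  apply: ge0_le_integral => //.
  - by move=> w _; rewrite lee_fin lap_ge0.
  - apply: measurable_funTS; apply/measurable_EFinP.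
    by apply: measurableT_comp (measurable_coord t0); exact: measurable_fun_lap.
  - move=> w pw; rewrite lee_fin; apply: le_trans (lap_le_expR _ _ pw) _.
    + by rewrite ltW// vinv_gt0.
    + by rewrite invr_ge0.
    + by rewrite ler_expR lerN2.
rewrite integral_cst// NM -EFinM lee_fin expRN mulrC ler_pdivrMr ?expR_gt0//.
have := expR_ge1Dx (M / e); rewrite -[X in _ -> X <= _](@divfK _ e) ?gt_eqF// [X in _ -> _ <= X]mulrC.
by rewrite ler_pM2r//; apply: le_trans; rewrite lerDr.
Qed.

Definition goodpath : set (@Dpath R) :=
  [set w | [/\ pconv Psi lam0 w, (0 < zs w)%E & (zs w < +oo)%E]].

Lemma goodpath_measurable : measurable goodpath.
Proof.
have mz := zsup_measurable Psi lam0.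
rewrite (_ : goodpath = pconv Psi lam0 `&` (zs @^-1` [set z | (0 < z)%E] `&`
   zs @^-1` [set z | (z < +oo)%E])).
  apply: measurableI; first exact: pconv_measurable.
  by apply: measurableI; rewrite -[X in measurable X]setTI; apply: mz => //;
    [exact: measurable_ereal_gt|exact: measurable_ereal_lt].
by apply/seteqP; split => w; [case|case=> ? []].
Qed.

Lemma N_ngoodpath : N (~` goodpath) = 0%E.
Proof.
apply/negligibleP; first by apply: measurableC; exact: goodpath_measurable.
have mz := zsup_measurable Psi lam0.
have h1 : N.-negligible (~` pconv Psi lam0).
  by apply/negligibleP; [apply: measurableC; exact: pconv_measurable|exact: N_npconv].
have h2 : N.-negligible [set w | zs w = 0%E].
  apply/negligibleP; last exact: N_zsup0.
  by rewrite -[X in measurable X]setTI; exact: (mz measurableT _ (emeasurable_set1 0%E)).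
have h3 : N.-negligible [set w | zs w = +oo%E].
  apply/negligibleP; last exact: N_zsup_infty.
  by rewrite -[X in measurable X]setTI; exact: (mz measurableT _ (emeasurable_set1 +oo%E)).
apply: negligibleS (negligibleU h1 (negligibleU h2 h3)) => w hw.
have [p|] := pselect (pconv Psi lam0 w); last by left.
right; have [z0|] := ltP 0%E (zs w); last first.
  by move=> z0; left; apply: le_anti; rewrite z0 zsup_ge0.
by right; apply/eqP; rewrite -leye_eq leNgt; apply/negP => zy; apply: hw.
Qed.

Lemma N_zeta_gt y : 0 < y -> N [set w | G y < zeta Psi lam0 w] = y%:E.
Proof.
move=> y0; set D := [set w | _].
have mD : measurable D.
  rewrite (_ : D = setT `&` zeta Psi lam0 @^-1` `]G y, +oo[%classic).
    by apply: zeta_measurable.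
  by rewrite setTI; apply/seteqP; split => w /=; rewrite in_itv/= andbT.
have Nng : N (D `&` ~` goodpath) = 0%E.
  apply/eqP; rewrite -measure_le0 -N_ngoodpath; apply: le_measure; rewrite ?inE//.
  - by apply: measurableI => //; apply: measurableC; exact: goodpath_measurable.
  - by apply: measurableC; exact: goodpath_measurable.
have zE w : goodpath w -> D w <-> exists i, rlam i < y /\ ~ B (rlam i) w.
  move=> [pw z0 zy]; rewrite /D /= /zeta asboolT//.
  have ez : zs w = (fine (zs w))%:E by rewrite fineK// ge0_fin_numE// ltW.
  split.
    rewrite -lte_fin -ez => /ereal_sup_gt [x [->|[i nB <-]]]; rewrite lte_fin.
      by move=> /ltW; rewrite leNgt Gfun_gt0.
    by move=> h; exists i; split => //; exact: (Gfun_lt_inv hP hlam0 y0).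
  move=> [i [iy nB]]; rewrite -lte_fin -ez; apply: (@lt_le_trans _ _ (G (rlam i))%:E).
    by rewrite lte_fin Gfun_lt// rlam_gt0.
  by apply: ereal_sup_ubound; right; exists i.
have sub E F : measurable E -> measurable F -> E `&` goodpath `<=` F -> (N E <= N F)%E.
  move=> mE mF EF; apply: (@le_trans _ _ (N (F `|` ~` goodpath))).
    apply: le_measure; rewrite ?inE//.
      by apply: measurableU => //; apply: measurableC; exact: goodpath_measurable.
    by move=> w Ew; have [g|] := pselect (goodpath w); [left; apply: EF|right].
  apply: (@le_trans _ _ (N F + N (~` goodpath))%E).
    by apply: measureU2 => //; apply: measurableC; exact: goodpath_measurable.
  by rewrite N_ngoodpath adde0.
apply/eqP; rewrite eq_le; apply/andP; split.
  rewrite -(N_notdn y0); apply: sub => //; first exact: measurableC.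
  move=> w [Dw gw]; have [i [iy nB]] := (zE w gw).1 Dw.
  by move=> By; apply: nB; exact: dn_mono (rlam_gt0 i) (ltW iy) _ By.
rewrite leNgt; apply/negP => Ny.
have Nf : N D \is a fin_num by rewrite ge0_fin_numE//; apply: lt_trans Ny _; rewrite ltry.
have fy : fine (N D) < y by rewrite -lte_fin fineK.
have f0 : 0 <= fine (N D) by exact: fine_ge0.
have [i /andP[i1 i2]] := rlam_dense f0 fy.
have : (N (~` B (rlam i)) <= N D)%E.
  apply: sub => //; first exact: measurableC.
  by move=> w [nB gw]; apply/(zE w gw); exists i.
by rewrite N_notdn ?rlam_gt0// -(fineK Nf) lee_fin leNgt i1.
Qed.

Lemma N_zeta_le0 : N [set w | zeta Psi lam0 w <= 0] = 0%E.
Proof.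
set D := [set w | _].
have mD : measurable D.
  rewrite (_ : D = setT `&` zeta Psi lam0 @^-1` `]-oo, 0]%classic).
    by apply: zeta_measurable.
  by rewrite setTI; apply/seteqP; split => w /=; rewrite in_itv/=.
apply/eqP; rewrite -measure_le0 -N_ngoodpath; apply: le_measure; rewrite ?inE//.
  by apply: measurableC; exact: goodpath_measurable.
move=> w /= Dw [pw z0 zy]; move: Dw; rewrite /D /= /zeta asboolT// leNgt => /negP; apply.
by apply: fine_gt0; rewrite z0.
Qed.

End excursion_measure.

Section excursion_products.
Context {R : realType}.
Variables (Psi : R -> R) (lam0 : R).
Hypotheses (hP : admissible Psi) (hlam0 : 0 < lam0).
Variables (ell : R -> {measure set (\bar R) -> \bar R}).
Hypothesis hell0 : forall t, 0 < t -> ell t [set z | (z <= 0)%E] = 0%E.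
Hypothesis hell : forall t lam v, 0 < t -> 0 < lam -> is_cum Psi t lam v ->
  (\int[ell t]_z (1 - elap lam z)%:E)%E = v%:E.
Variables (K : R -> \bar R -> {measure set (\bar R) -> \bar R}).
Hypothesis hK0 : forall s y, 0 < s -> (0 <= y)%E ->
  K s y [set z | (z < 0)%E] = 0%E /\ K s y setT = 1%E.
Hypothesis hK : forall s y lam v, 0 < s -> (0 <= y)%E -> 0 < lam -> is_cum Psi s lam v ->
  (\int[K s y]_z (elap lam z)%:E)%E = (elap v y)%:E.
Variable N : {measure set (@Dpath R) -> \bar R}.
Hypothesis hNfdd : forall (t : R) (B : set (\bar R)) (l : seq (R * set (\bar R))),
  0 < t -> measurable B -> B `<=` [set z | (0 < z)%E] ->
  all (fun p => 0 < p.1) l -> (forall p, p \in l -> measurable p.2) ->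
  N (((fun w : R -> \bar R => w t) @^-1` B) `&` cyl t l) =
    (\int[ell t]_(y in B) fdd_iter K y l)%E.
Hypothesis Npos : forall t : R, (0 < t)%R -> N [set w : Dpath | (w t < 0)%E] = 0%E.
Hypothesis hNabs : forall s t : R, 0 < s < t ->
  N [set w : R -> \bar R | w s = 0%E /\ w t != 0%E] = 0%E.
Hypothesis hNnz : N [set w : R -> \bar R | forall q : rat, 0 < q -> w (ratr q) = 0%E] = 0%E.

Local Notation V := (vinv Psi lam0).
Local Notation A lam := (io (up Psi lam0 lam)).
Local Notation B lam := (io (dn Psi lam0 lam)).
Implicit Types (t lam : R).

Let mA lam : measurable (A lam : set (@Dpath R)).
Proof. by apply: io_measurable => q; exact: up_measurable. Qed.

Let mlapw t lam : 0 < t -> measurable_fun [set: @Dpath R] (fun w : Dpath => lap lam (w t)).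
Proof.
by move=> t0; apply: measurableT_comp (measurable_coord t0); exact: measurable_fun_lap.
Qed.

Lemma path_gt0 t (ts : seq R) q : 0 < t -> path <%R t ts -> q \in ts -> 0 < q.
Proof.
move=> t0 /(order_path_min lt_trans)/allP h /h; exact: lt_trans.
Qed.

Lemma last_gt0 t (ts : seq R) : 0 < t -> path <%R t ts -> 0 < last t ts.
Proof.
case: ts => [//|q ts] t0 pts.
have := mem_last q ts; exact: (path_gt0 t0 pts).
Qed.

Lemma prod_coord_measurable (t : R) (ts : seq R) (g : R -> \bar R -> R) : 0 < t -> path <%R t ts ->
  (forall q, measurable_fun setT (g q)) ->
  measurable_fun [set: @Dpath R] (fun w : Dpath => \prod_(q <- ts) g q (w q)).
Proof.
move=> t0 pts mg; apply: measurable_prod => q qts.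
by apply: measurableT_comp (mg q) _; apply: measurable_coord; exact: (path_gt0 t0 pts).
Qed.

Lemma N_prod_up t C E lam (ts : seq R) (g : R -> \bar R -> R) :
  pcyl t C E -> (N C < +oo)%E -> 0 < lam -> path <%R t ts ->
  (forall q, measurable_fun setT (g q)) -> (forall q z, 0 <= g q z) ->
  (\int[N]_(w in C) ((\prod_(q <- ts) g q (w q)) * \1_(~` A lam) w)%:E =
   \int[N]_(w in C) ((\prod_(q <- ts) g q (w q)) * lap (V (last t ts) lam) (w (last t ts)))%:E)%E.
Proof.
move=> + + l0 + mg g0; elim: ts t C E => [|q ts IH] t C E pC NC.
  move=> _; under eq_integral do rewrite big_nil mul1r.
  under [RHS]eq_integral do rewrite big_nil mul1r.
  have [_ + _ _ _] := N_updn hP hlam0 hK0 hK hNfdd Npos pC NC l0.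
  have mC := pcyl_measurable pC.
  by rewrite /= integral_indic//; [move=> <-; rewrite setIC|exact: measurableC].
move=> /= /andP[tq pts]; have t0 := pcyl_gt0 pC; have q0 : 0 < q := lt_trans t0 tq.
have mC := pcyl_measurable pC.
pose a (w : Dpath) := (\prod_(q <- ts) g q (w q)) * \1_(~` A lam) w.
pose b (w : Dpath) := (\prod_(q <- ts) g q (w q)) * lap (V (last q ts) lam) (w (last q ts)).
have p0 (w : R -> \bar R) : 0 <= \prod_(q <- ts) g q (w q) by apply: prodr_ge0.
have mp := prod_coord_measurable q0 pts mg.
have ma : measurable_fun setT a.
  by apply: measurable_funM => //; apply: measurable_indic; exact: measurableC.
have mb : measurable_fun setT b.
  by apply: measurable_funM => //; apply: mlapw; exact: last_gt0 pts.
have a0 w : 0 <= a w by rewrite mulr_ge0.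
have b0 w : 0 <= b w by rewrite mulr_ge0// lap_ge0.
have hD D : measurable D ->
    (\int[N]_(w in C `&` (fun w : Dpath => w q) @^-1` D) (a w)%:E =
     \int[N]_(w in C `&` (fun w : Dpath => w q) @^-1` D) (b w)%:E)%E.
  move=> mD; apply: IH (pcyl_step pC tq mD) _ pts.
  apply: le_lt_trans NC; apply: le_measure; rewrite ?inE//.
  exact: pcyl_measurable (pcyl_step pC tq mD).
have e1 (w : Dpath) : ((\prod_(r <- q :: ts) g r (w r)) * \1_(~` A lam) w)%:E = ((g q (w q))%:E * (a w)%:E)%E.
  by rewrite big_cons -EFinM mulrA.
have e2 (w : Dpath) : ((\prod_(r <- q :: ts) g r (w r)) * lap (V (last q ts) lam) (w (last q ts)))%:E
   = ((g q (w q))%:E * (b w)%:E)%E.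
  by rewrite big_cons -EFinM mulrA.
under eq_integral do rewrite e1.
under [RHS]eq_integral do rewrite e2.
have mX := measurable_coord q0.
by apply/eqP; rewrite eq_le; apply/andP; split;
  apply: (@integral_comp_le _ _ _ _ _ N C (fun w : Dpath => w q) _ _ (EFin \o g q)) => //;
  first [exact/measurable_EFinP|by move=> z; rewrite lee_fin|by move=> D mD; rewrite hD].
Qed.

Lemma ae_posat t (f : @Dpath R -> \bar R) : 0 < t -> measurable_fun setT f ->
  N.-negligible [set w : Dpath | (w t <= 0)%E /\ f w != 0%E] ->
  (\int[N]_w f w = \int[N]_(w in posat t) f w)%E.
Proof.
move=> t0 mf hf; rewrite [RHS]integral_mkcond; apply: ae_eq_integral => //.
  by apply/(measurable_restrictT _ _).1; [exact: posat_measurable|exact: measurable_funTS].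
apply: negligibleS hf => w /= /not_implyP [_]; rewrite /patch.
case: ifPn => // /negP h fw; split.
  by rewrite leNgt; apply/negP => w0; apply: h; exact/mem_set.
by apply/eqP.
Qed.

Lemma N_prod_up_full (t lam : R) (ts : seq R) (k : R -> nat) :
  0 < t -> t < 1 -> 0 < lam -> path <%R t ts ->
  (\int[N]_w (1 - (\prod_(q <- ts) lap (V q lam) (w q) ^+ k q) * \1_(~` A lam) w)%:E =
   \int[N]_w (1 - (\prod_(q <- ts) lap (V q lam) (w q) ^+ k q) *
      lap (V (last t ts) lam) (w (last t ts)))%:E)%E.
Proof.
move=> t0 t1 l0 pts.
have V0 q : 0 < V q lam by exact: vinv_gt0.
pose F (w : Dpath) := \prod_(q <- ts) lap (V q lam) (w q) ^+ k q.
have mF : measurable_fun setT F.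
  apply: (@prod_coord_measurable t ts (fun q z => lap (V q lam) z ^+ k q)) => // q.
  by apply: measurable_funX; exact: measurable_fun_lap.
have F0 w : 0 <= F w by apply: prodr_ge0 => q _; rewrite exprn_ge0// lap_ge0.
have F1 w : F w <= 1.
  apply: prodr_ile1 => q; rewrite exprn_ge0 ?lap_ge0//= exprn_ile1 ?lap_ge0//.
  by rewrite lap_le1// ltW.
have mI : measurable_fun setT (\1_(~` A lam) : Dpath -> R).
  by apply: measurable_indic; exact: measurableC.
have mL := mlapw (V (last t ts) lam) (last_gt0 t0 pts).
have le01 (b : Dpath -> R) : (forall w, 0 <= b w <= 1) -> forall w, 0 <= F w * b w <= 1.
  move=> hb w; have /andP[b0 b1] := hb w.
  by rewrite mulr_ge0//= mulr_ile1.
have I01 (w : Dpath) : 0 <= (\1_(~` A lam) w : R) <= 1 by rewrite indicE; case: (_ \in _); rewrite ?lexx ler01.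
have L01 (w : Dpath) : 0 <= lap (V (last t ts) lam) (w (last t ts)) <= 1.
  by rewrite lap_ge0 lap_le1// ltW.
have mfull (b : Dpath -> R) D : measurable_fun setT b ->
    measurable_fun D (fun w => (1 - F w * b w)%:E : \bar R).
  move=> mb; apply: measurable_funTS; apply/measurable_EFinP; apply: measurable_funB => //.
  exact: measurable_funM.
have zero : N.-negligible [set w : Dpath | (w t <= 0)%E /\
    ((exists q, q \in ts /\ w q != 0%E) \/ exists s n j, w (gr s n j) != 0%E)].
  have neg : N.-negligible [set w : Dpath | (w t < 0)%E].
    apply/negligibleP; last exact: Npos.
    exact: (coord_measurable t0 (measurable_ereal_lt 0%E)).
  have habs q : t < q -> N.-negligible [set w : Dpath | w t = 0%E /\ w q != 0%E].
    move=> tq; apply/negligibleP; last by apply: hNabs; rewrite t0.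
    rewrite (_ : [set _ | _] = ((fun w : Dpath => w t) @^-1` [set 0%E]) `&`
        ~` ((fun w : Dpath => w q) @^-1` [set 0%E])).
      apply: measurableI; first exact: (coord_measurable t0 (emeasurable_set1 0%E)).
      apply: measurableC.
      exact: (coord_measurable (lt_trans t0 tq) (emeasurable_set1 0%E)).
    by apply/seteqP; split => w /= [h1 h2]; split => //; [exact/eqP|apply/eqP].
  have tgr s n j : t < gr s n j.
    apply: lt_le_trans t1 _; apply: le_trans (gr_ge _ _ _).
    by rewrite ler1n.
  have h1 : N.-negligible (\bigcup_i [set w : Dpath | w t = 0%E /\ w (nth (gr 0 0 0) ts i) != 0%E]).
    apply: negligible_bigcup => i; apply: habs.
    have [h|h] := ltnP i (size ts); last by rewrite nth_default.
    by have /(order_path_min lt_trans)/allP := pts; apply; exact: mem_nth.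
  have h2 : N.-negligible (\bigcup_s \bigcup_n \bigcup_j [set w : Dpath | w t = 0%E /\ w (gr s n j) != 0%E]).
    by do 3 (apply: negligible_bigcup => ?); exact: habs.
  apply: negligibleS (negligibleU neg (negligibleU h1 h2)) => w /= [wt h].
  have [|w0] := ltP (w t) 0%E; first by left.
  have e0 : w t = 0%E by apply: le_anti; rewrite wt w0.
  right; case: h => [[q [qts wq]]|[s [n [j wq]]]].
    by left; exists (index q ts) => //; rewrite /= nth_index.
  by right; exists s => //; exists n => //; exists j.
have lap0 c : lap c (0%E : \bar R) = 1 by rewrite lap_elap//= mulr0 oppr0 expR0.
have red (b : Dpath -> R) : measurable_fun setT b -> (forall w : Dpath, (w t <= 0)%E ->
    (forall q, q \in ts -> w q = 0%E) -> (forall s n j, w (gr s n j) = 0%E) -> ~ (w t < 0)%E -> b w = 1) ->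
    (\int[N]_w (1 - F w * b w)%:E = \int[N]_(w in posat t) (1 - F w * b w)%:E)%E.
  move=> mb hb; apply: ae_posat => //; first exact: mfull.
  have neg : N.-negligible [set w : Dpath | (w t < 0)%E].
    apply/negligibleP; last exact: Npos.
    exact: (coord_measurable t0 (measurable_ereal_lt 0%E)).
  apply: negligibleS (negligibleU zero neg) => w /= [wt fw].
  have [|nneg] := pselect (w t < 0)%E; first by right.
  left; split => //; apply: contrapT => /not_orP [n1 n2].
  have z1 q : q \in ts -> w q = 0%E.
    by move=> qts; apply: contrapT => /eqP h; apply: n1; exists q.
  have z2 s n j : w (gr s n j) = 0%E.
    by apply: contrapT => /eqP h; apply: n2; exists s, n, j.
  move/eqP: fw; apply; rewrite hb// mulr1 /F big_seq big1 ?subrr// => q /z1 ->.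
  by rewrite lap0 expr1n.
rewrite (red \1_(~` A lam))//; last first.
  move=> w _ _ z _; rewrite indicE mem_set// => /(_ 0%N) [n [j]].
  by rewrite /up /= z lee_fin leNgt invr_gt0 V0.
rewrite (red (fun w => lap (V (last t ts) lam) (w (last t ts))))//; last first.
  move=> w wt z _ nneg; suff -> : w (last t ts) = 0%E by [].
  case: (ts) z => [_|q ts' z] /=; last by apply: z; exact: mem_last.
  by apply: le_anti; rewrite wt leNgt; exact/negP.
rewrite posat_bigcup.
have mPn n : measurable (posat_n t n).
  by have [E /pcyl_measurable] := posat_n_pcyl n t0.
have cvI (b : Dpath -> R) : measurable_fun setT b -> (forall w, 0 <= b w <= 1) ->
   (\int[N]_(w in posat_n t n) (1 - F w * b w)%:E @[n --> \oo] -->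
     \int[N]_(w in \bigcup_n posat_n t n) (1 - F w * b w)%:E)%E.
  move=> mb hb; apply: ge0_nondecreasing_set_cvg_integral => //; first exact: posat_n_nd.
    by move=> n; exact: mfull.
  by move=> n w _; rewrite lee_fin subr_ge0; have /andP[] := le01 _ hb w.
apply: (cvg_unique _ (cvI _ mI I01)) => //.
apply: cvg_trans (cvI _ mL L01); apply: near_eq_cvg; apply: nearW => n.
have Nf : (N (posat_n t n) < +oo)%E 
  by exact: (N_posat_n_fin hP hlam0 hell0 hell hNfdd n t0).
have int (b : Dpath -> R) : measurable_fun setT b -> (forall w, 0 <= b w <= 1) ->
    (\int[N]_(w in posat_n t n) (1 - F w * b w)%:E = N (posat_n t n) - \int[N]_(w in posat_n t n) (F w * b w)%:E)%E.
  move=> mb hb.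
  have mFb : measurable_fun (posat_n t n) (fun w => F w * b w).
    by apply: measurable_funTS; exact: measurable_funM.
  have intFb : N.-integrable (posat_n t n) (EFin \o (fun w => F w * b w)).
    apply: measurable_bounded_integrable => //.
    exists 1; split => // M M1 w _; have /andP[h0 h1] := le01 _ hb w.
    by rewrite /= ger0_norm// (le_trans h1)// ltW.
  have int1 : N.-integrable (posat_n t n) (EFin \o cst 1) 
    by apply: measurable_bounded_integrable => //; exists 1; split => // M M1 w _ /=; rewrite normr1 ltW.
  under eq_integral do rewrite EFinB.
  rewrite (integralB_EFin (f1 := cst 1))//; congr (_ - _)%E.
  by rewrite (integral_cst N (mPn n) 1%E) mul1e.
have [E pE] := posat_n_pcyl n t0.
rewrite (int _ mI I01) (int _ mL L01); congr (_ - _)%E; apply/esym.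
apply: (N_prod_up (g := fun q z => lap (V q lam) z ^+ k q) pE Nf l0 pts).
  by move=> q; apply: measurable_funX; exact: measurable_fun_lap.
by move=> q z; rewrite exprn_ge0// lap_ge0.
Qed.

End excursion_products.

Lemma expC_le1 {R : realType} (u : R) n : 0 <= u <= 1 -> (1 + n%:R * u) * (1 - u) ^+ n <= 1.
Proof.
move=> /andP[u0 u1]; have v0 : 0 <= 1 - u by rewrite subr_ge0.
elim: n => [|n IH]; first by rewrite mul0r addr0 expr0 mulr1.
apply: le_trans IH; rewrite exprS mulrA ler_wpM2r ?exprn_ge0// -natr1.
have n0 : 0 <= n%:R :> R by [].
have : 0 <= n%:R * u * u by rewrite !mulr_ge0.
have : 0 <= u * u by rewrite mulr_ge0.
by move: (n%:R) n0 => a a0; nra.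
Qed.

Lemma expC_ge {R : realType} (u : R) m : 0 <= u <= 1 -> 1 - m%:R * u <= (1 - u) ^+ m.
Proof.
move=> /andP[u0 u1]; have v0 : 0 <= 1 - u by rewrite subr_ge0.
elim: m => [|m IH]; first by rewrite mul0r subr0 expr0.
rewrite exprSr; have := ler_wpM2r v0 IH; apply: le_trans.
rewrite -natr1; have : 0 <= m%:R * (u * u) by rewrite !mulr_ge0.
by move: (m%:R) => a; nra.
Qed.

(* (1 - u^j)^m has a sharp threshold at u = delta when j is large and m is about delta^(-j) / 2. *)
Lemma threshold_poly {R : realType} (delta eta : R) : 0 < delta -> 0 < eta -> exists j m,
  forall u : R, 0 <= u <= 1 -> (u <= delta -> 2^-1 <= (1 - u ^+ j) ^+ m) /\
    (1 - u ^+ j) ^+ m * u <= 2 * delta * (1 - u ^+ j) ^+ m + eta.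
Proof.
move=> d0 e0; pose n := Num.truncn eta^-1; pose j := n.+2.
have n2 : eta^-1 <= 2 ^+ n.+1.
  apply: (@le_trans _ _ n.+1%:R); first exact: ltW (truncnS_gt _).
  by rewrite -natrX ler_nat ltnW// ltn_expl.
have dj : 0 < delta ^+ j by rewrite exprn_gt0.
have y0 : 0 <= (2 * delta ^+ j)^-1 by rewrite invr_ge0 mulr_ge0// ltW.
have /andP[k1 k2] := truncn_itv y0.
exists j, (Num.truncn (2 * delta ^+ j)^-1) => u /andP[u0 u1].
set m := Num.truncn _ in k1 k2 *.
have uj : 0 <= u ^+ j <= 1 by rewrite exprn_ge0//= exprn_ile1.
have g0 : 0 <= (1 - u ^+ j) ^+ m by rewrite exprn_ge0// subr_ge0; case/andP: uj.
split.
  move=> ud; apply: le_trans (expC_ge m uj).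
  rewrite lerBrDr -lerBrDl.
  have -> : 1 - 2^-1 = 2^-1 :> R by field.
  apply: (@le_trans _ _ ((2 * delta ^+ j)^-1 * delta ^+ j)).
    by apply: ler_pM => //; [rewrite exprn_ge0|rewrite lerXn2r// nnegrE ltW].
  by rewrite invfM mulfVK ?gt_eqF.
have [h|h] := leP u (2 * delta).
  by rewrite mulrC (le_trans (ler_wpM2r g0 h))// lerDl ltW.
apply: (@le_trans _ _ eta); last by rewrite lerDr mulr_ge0// mulr_ge0// ltW.
apply: (@le_trans _ _ ((1 - u ^+ j) ^+ m)); first by rewrite ler_piMr.
have h1 : eta^-1 <= 1 + m%:R * u ^+ j.
  apply: le_trans n2 _; apply: (@le_trans _ _ (m.+1%:R * u ^+ j)); last first.
    by rewrite -natr1 mulrDl mul1r addrC lerD2r; case/andP: uj.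
  apply: (@le_trans _ _ ((2 * delta ^+ j)^-1 * (2 * delta) ^+ j)).
    rewrite exprMn invfM mulrACA mulVf ?gt_eqF// mulr1 /j [2 ^+ n.+2]exprS mulrA mulVf ?mul1r//.
  apply: ler_pM => //; [by rewrite exprn_ge0// mulr_ge0// ltW|exact: ltW|].
  by apply: lerXn2r (ltW h); rewrite nnegrE// mulr_ge0// ltW.
have := expC_le1 m uj; move/(le_trans (ler_wpM2r g0 h1)).
by rewrite ler_pdivrMl// mulr1.
Qed.

(* [U] and [W] are [0, 1]-valued processes such that [W] under [P] is distributed as [U] under
   the measure whose density along the filtration is [U / c].  A monomial identity suffices, and
   passing to low values is tested with the polynomials of [threshold_poly]. *)
Section first_passage.
Context {R : realType} {d : measure_display} {Om : measurableType d}.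
Variables (P : probability Om R) (U W : R -> Om -> R) (c t0 : R).
Hypotheses (mU : forall q, measurable_fun setT (U q)) (U01 : forall q om, 0 <= U q om <= 1).
Hypotheses (mW : forall q, measurable_fun setT (W q)) (W01 : forall q om, 0 <= W q om <= 1).
Hypothesis c01 : 0 <= c <= 1.
Hypothesis hUW : forall (ts : seq R) (k : R -> nat), path <%R t0 ts ->
  (\int[P]_om ((\prod_(q <- ts) W q om ^+ k q) * c)%:E =
   \int[P]_om ((\prod_(q <- ts) U q om ^+ k q) * U (last t0 ts) om)%:E)%E.

Let c0 : 0 <= c. Proof. by case/andP: c01. Qed.

Let bounded_int (f : Om -> R) : measurable_fun setT f -> (forall om, 0 <= f om <= 1) ->
  P.-integrable setT (EFin \o f).
Proof.
move=> mf f01; apply: measurable_bounded_integrable => //.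
  exact: fin_num_fun_lty.
exists 1; split => // M M1 om _; have /andP[h0 h1] := f01 om.
by rewrite /= ger0_norm// (le_trans h1)// ltW.
Qed.

Let mul01 (a b : R) : 0 <= a <= 1 -> 0 <= b <= 1 -> 0 <= a * b <= 1.
Proof. by move=> /andP[a0 a1] /andP[b0 b1]; rewrite mulr_ge0//= mulr_ile1. Qed.

Let exp01 (a : R) n : 0 <= a <= 1 -> 0 <= a ^+ n <= 1.
Proof. by move=> /andP[a0 a1]; rewrite exprn_ge0//= exprn_ile1. Qed.

Let sub01 (a : R) : 0 <= a <= 1 -> 0 <= 1 - a <= 1.
Proof. by move=> /andP[a0 a1]; rewrite subr_ge0 a1/= lerBlDr lerDl. Qed.

Section fixed.
Variables (ts : seq R) (j : nat).
Hypothesis pts : path <%R t0 ts.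
Let L := U (last t0 ts).
Let pr (Y : R -> Om -> R) (k : R -> nat) om := \prod_(q <- ts) Y q om ^+ k q.

Let mpr Y k : (forall q, measurable_fun setT (Y q)) -> measurable_fun setT (pr Y k).
Proof. by move=> mY; apply: measurable_prod => q _; apply: measurable_funX. Qed.

Let pr01 (Y : R -> Om -> R) k om : (forall q om, 0 <= Y q om <= 1) -> 0 <= pr Y k om <= 1.
Proof.
move=> Y01; apply/andP; split; last by apply: prodr_ile1 => q _; exact: exp01.
by apply: prodr_ge0 => q _; case/andP: (exp01 (k q) (Y01 q om)).
Qed.

Let test (F F' : Om -> R) := [/\ measurable_fun setT F, measurable_fun setT F',
  forall om, 0 <= F om <= 1, forall om, 0 <= F' om <= 1 &
  forall k, (\int[P]_om (F' om * pr W k om * c)%:E = \int[P]_om (F om * pr U k om * L om)%:E)%E].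

Let test1 : test (cst 1) (cst 1).
Proof.
split => [||om|om|k]; [exact: measurable_cst|exact: measurable_cst|by rewrite lexx ler01..|].
under eq_integral do rewrite mul1r; under [RHS]eq_integral do rewrite mul1r.
exact: hUW.
Qed.

Let prM Y q k om : q \in ts -> Y q om * pr Y k om = pr Y (fun r => (k r + (r == q))%N) om.
Proof.
move=> qts; have uts : uniq ts by move: pts; rewrite lt_path_sortedE => /andP[_ /lt_sorted_uniq].
rewrite /pr (bigD1_seq q)//= [RHS](bigD1_seq q)//= mulrA; congr (_ * _).
  by rewrite eqxx addn1 exprS.
by apply: eq_bigr => r /negbTE h; rewrite h addn0.
Qed.

Let testM F F' q : q \in ts -> test F F' ->
  test (fun om => F om * U q om) (fun om => F' om * W q om).
Proof.
move=> qts [mF mF' F01 F'01 hF]; split.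
- exact: measurable_funM.
- exact: measurable_funM.
- by move=> om; apply: mul01.
- by move=> om; apply: mul01.
move=> k.
transitivity (\int[P]_om (F' om * pr W (fun r => (k r + (r == q))%N) om * c)%:E)%E.
  by apply: eq_integral => om _; rewrite -prM// mulrA.
by rewrite hF; apply: eq_integral => om _; rewrite -prM// mulrA.
Qed.

Let testB F F' E E' : test F F' -> test E E' -> (forall om, E om <= F om) ->
  (forall om, E' om <= F' om) -> test (fun om => F om - E om) (fun om => F' om - E' om).
Proof.
move=> [mF mF' F01 F'01 hF] [mE mE' E01 E'01 hE] le le'.
have diff01 (a b : R) : 0 <= a <= 1 -> 0 <= b <= 1 -> b <= a -> 0 <= a - b <= 1.
  move=> /andP[? ?] /andP[? ?] ba.
  by rewrite subr_ge0 ba/= lerBlDr (le_trans (_ : _ <= 1))// lerDl.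
split.
- exact: measurable_funB.
- exact: measurable_funB.
- by move=> om; exact: diff01.
- by move=> om; exact: diff01.
move=> k.
have int (Y : R -> Om -> R) (H X : Om -> R) : (forall q, measurable_fun setT (Y q)) ->
    (forall q om, 0 <= Y q om <= 1) ->
    measurable_fun setT H -> (forall om, 0 <= H om <= 1) ->
    measurable_fun setT X -> (forall om, 0 <= X om <= 1) ->
    P.-integrable setT (EFin \o (fun om => H om * pr Y k om * X om)).
  move=> mY Y01 mH H01 mX X01; apply: bounded_int.
    by apply: measurable_funM => //; apply: measurable_funM => //; exact: mpr.
  by move=> om; apply: mul01 => //; apply: mul01 => //; exact: pr01.
have mL : measurable_fun setT L by exact: mU.
have L01 om : 0 <= L om <= 1 by exact: U01.
have mc : measurable_fun setT (cst c : Om -> R) by exact: measurable_cst.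
have c01' (om : Om) : 0 <= cst c om <= 1 by exact: c01.
under eq_integral do rewrite mulrBl mulrBl EFinB.
under [RHS]eq_integral do rewrite mulrBl mulrBl EFinB.
rewrite (integralB_EFin measurableT (int _ _ _ mW W01 mF' F'01 mc c01') (int _ _ _ mW W01 mE' E'01 mc c01')).
by rewrite (integralB_EFin measurableT (int _ _ _ mU U01 mF F01 mL L01) (int _ _ _ mU U01 mE E01 mL L01)) hF hE.
Qed.

Let testMX F F' q i : q \in ts -> test F F' ->
  test (fun om => F om * U q om ^+ i) (fun om => F' om * W q om ^+ i).
Proof.
move=> qts tF; elim: i => [|i IH].
  by under [X in test X]eq_fun do rewrite expr0 mulr1;
     under [X in test _ X]eq_fun do rewrite expr0 mulr1.
under [X in test X]eq_fun do rewrite exprSr mulrA.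
under [X in test _ X]eq_fun do rewrite exprSr mulrA.
exact: testM.
Qed.

Let testMC F F' q : q \in ts -> test F F' ->
  test (fun om => F om * (1 - U q om ^+ j)) (fun om => F' om * (1 - W q om ^+ j)).
Proof.
move=> qts tF; have h (a b : R) : a * (1 - b ^+ j) = a - a * b ^+ j by ring.
under [X in test X]eq_fun do rewrite h.
under [X in test _ X]eq_fun do rewrite h.
case: (tF) => _ _ F01 F'01 _; apply: testB => //; first exact: testMX.
  by move=> om; rewrite ler_piMr//; [case/andP: (F01 om)|case/andP: (exp01 j (U01 q om))].
by move=> om; rewrite ler_piMr//; [case/andP: (F'01 om)|case/andP: (exp01 j (W01 q om))].
Qed.

Let testMCX F F' q m : q \in ts -> test F F' ->
  test (fun om => F om * (1 - U q om ^+ j) ^+ m) (fun om => F' om * (1 - W q om ^+ j) ^+ m).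
Proof.
move=> qts tF; elim: m => [|m IH].
  by under [X in test X]eq_fun do rewrite expr0 mulr1;
     under [X in test _ X]eq_fun do rewrite expr0 mulr1.
under [X in test X]eq_fun do rewrite exprSr mulrA.
under [X in test _ X]eq_fun do rewrite exprSr mulrA.
exact: testMC.
Qed.

Let testMCXC F F' q m : q \in ts -> test F F' ->
  test (fun om => F om * (1 - (1 - U q om ^+ j) ^+ m)) (fun om => F' om * (1 - (1 - W q om ^+ j) ^+ m)).
Proof.
move=> qts tF.
have h (a b : R) : a * (1 - (1 - b ^+ j) ^+ m) = a - a * (1 - b ^+ j) ^+ m by ring.
under [X in test X]eq_fun do rewrite h.
under [X in test _ X]eq_fun do rewrite h.
case: (tF) => _ _ F01 F'01 _; apply: testB => //; first exact: testMCX.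
  move=> om; rewrite ler_piMr//; first by case/andP: (F01 om).
  by case/andP: (exp01 m (sub01 (exp01 j (U01 q om)))).
move=> om; rewrite ler_piMr//; first by case/andP: (F'01 om).
by case/andP: (exp01 m (sub01 (exp01 j (W01 q om)))).
Qed.

Lemma first_passage_test m (rs : seq R) : {subset rs <= ts} -> last t0 ts \in ts ->
  (\int[P]_om ((\prod_(q <- rs) (1 - (1 - W q om ^+ j) ^+ m)) * (1 - W (last t0 ts) om ^+ j) ^+ m * c)%:E =
   \int[P]_om ((\prod_(q <- rs) (1 - (1 - U q om ^+ j) ^+ m)) * (1 - L om ^+ j) ^+ m * L om)%:E)%E.
Proof.
move=> srs lts.
have : test (fun om => \prod_(q <- rs) (1 - (1 - U q om ^+ j) ^+ m))
    (fun om => \prod_(q <- rs) (1 - (1 - W q om ^+ j) ^+ m)).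
  elim: rs srs => [_|q rs IH srs].
    under [X in test X]eq_fun do rewrite big_nil.
    by under [X in test _ X]eq_fun do rewrite big_nil; exact: test1.
  under [X in test X]eq_fun do rewrite big_cons mulrC.
  under [X in test _ X]eq_fun do rewrite big_cons mulrC.
  apply: testMCXC; first by apply: srs; rewrite mem_head.
  by apply: IH => r hr; apply: srs; rewrite inE hr orbT.
move=> /(testMCX m lts) [_ _ _ _ /(_ (fun=> 0%N))].
have e Y om : pr Y (fun=> 0%N) om = 1 by rewrite /pr big1.
under eq_integral do rewrite e mulr1.
by under [RHS]eq_integral do rewrite e mulr1.
Qed.

End fixed.

Section threshold.
Variables (j m : nat) (e eta : R).
Hypotheses (e0 : 0 <= e) (eta0 : 0 <= eta).
Let g (u : R) := (1 - u ^+ j) ^+ m.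
Hypothesis hg : forall u, 0 <= u <= 1 -> g u * u <= e * g u + eta.
Let Q (Y : R -> Om -> R) rs om := \prod_(q <- rs) (1 - g (Y q om)).

Let g01 u : 0 <= u <= 1 -> 0 <= g u <= 1.
Proof. by move=> u01; apply: exp01; apply: sub01; exact: exp01. Qed.

Let Q01 (Y : R -> Om -> R) rs om : (forall q om, 0 <= Y q om <= 1) -> 0 <= Q Y rs om <= 1.
Proof.
move=> Y01; apply/andP; split; last by apply: prodr_ile1 => q _; apply: sub01; exact: g01.
by apply: prodr_ge0 => q _; case/andP: (sub01 (g01 (Y01 q om))).
Qed.

Let mg (Y : R -> Om -> R) q : (forall q, measurable_fun setT (Y q)) ->
  measurable_fun setT (fun om => g (Y q om)).
Proof. by move=> mY; apply: measurable_funX; apply: measurable_funB => //; exact: measurable_funX. Qed.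

Let mQ Y rs : (forall q, measurable_fun setT (Y q)) -> measurable_fun setT (Q Y rs).
Proof. by move=> mY; apply: measurable_prod => q _; apply: measurable_funB => //; exact: mg. Qed.

Let Q0 Y rs om : (forall q om, 0 <= Y q om <= 1) -> 0 <= Q Y rs om.
Proof. by move=> Y01; case/andP: (Q01 rs om Y01). Qed.
Let QC0 Y rs om : (forall q om, 0 <= Y q om <= 1) -> 0 <= 1 - Q Y rs om.
Proof. by move=> Y01; rewrite subr_ge0; case/andP: (Q01 rs om Y01). Qed.
Let g0 (Y : R -> Om -> R) q om : (forall q om, 0 <= Y q om <= 1) -> 0 <= g (Y q om).
Proof. by move=> Y01; case/andP: (g01 (Y01 q om)). Qed.

Let Qrcons Y rs q om : 1 - Q Y (rcons rs q) om = (1 - Q Y rs om) + Q Y rs om * g (Y q om).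
Proof. by rewrite /Q big_rcons/=; ring. Qed.

Lemma first_passage_le (rs : seq R) : path <%R t0 rs ->
  (\int[P]_om ((1 - Q W rs om) * c)%:E <=
   e%:E * \int[P]_om (1 - Q U rs om)%:E + ((size rs)%:R * eta)%:E)%E.
Proof.
elim/last_ind: rs => [_|rs q IH].
  have h Y om : 1 - Q Y [::] om = 0 by rewrite /Q big_nil subrr.
  under eq_integral do rewrite h mul0r.
  under [X in (_ <= _ * X + _)%E]eq_integral do rewrite h.
  by rewrite !integral0 mule0 mul0r adde0.
move=> pr; have pr' : path <%R t0 rs by move: pr; rewrite rcons_path => /andP[].
have mI1 : measurable_fun setT (fun om => ((1 - Q W rs om) * c)%:E : \bar R).
  apply/measurable_EFinP; apply: measurable_funM => //; apply: measurable_funB => //; exact: mQ.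
have mI2 : measurable_fun setT (fun om => (Q W rs om * g (W q om) * c)%:E : \bar R).
  apply/measurable_EFinP; apply: measurable_funM => //.
  by apply: measurable_funM; [exact: mQ|exact: mg].
have mI3 : measurable_fun setT (fun om => (1 - Q U rs om)%:E : \bar R).
  by apply/measurable_EFinP; apply: measurable_funB => //; exact: mQ.
have mI4 : measurable_fun setT (fun om => (Q U rs om * g (U q om))%:E : \bar R).
  by apply/measurable_EFinP; apply: measurable_funM; [exact: mQ|exact: mg].
under eq_integral do rewrite Qrcons mulrDl EFinD.
under [X in (_ <= _ * X + _)%E]eq_integral do rewrite Qrcons EFinD.
rewrite ge0_integralD//; last 2 first.
- by move=> om _; rewrite lee_fin mulr_ge0// QC0.
- by move=> om _; rewrite lee_fin mulr_ge0// mulr_ge0 ?Q0 ?g0.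
rewrite ge0_integralD//; last 2 first.
- by move=> om _; rewrite lee_fin QC0.
- by move=> om _; rewrite lee_fin mulr_ge0 ?Q0 ?g0.
rewrite ge0_muleDr; last 2 first.
- by apply: integral_ge0 => om _; rewrite lee_fin QC0.
- by apply: integral_ge0 => om _; rewrite lee_fin mulr_ge0 ?Q0 ?g0.
rewrite size_rcons -natr1 mulrDl mul1r EFinD [X in (_ <= X)%E]addeACA.
apply: leeD; first exact: IH.
have := @first_passage_test _ j pr m rs.
rewrite last_rcons mem_rcons mem_head => -> //; last first.
  by move=> r hr; rewrite mem_rcons inE hr orbT.
rewrite -ge0_integralZl//; last by move=> om _; rewrite lee_fin mulr_ge0 ?Q0 ?g0.
have -> : eta%:E = (\int[P]_om eta%:E)%E.
  transitivity (eta%:E * P setT)%E; first by have := probability_setT P => ->; rewrite mule1.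
  by apply/esym; exact: (integral_cst P measurableT eta%:E).
rewrite -ge0_integralD//; last 2 first.
- by move=> om _; rewrite -EFinM lee_fin mulr_ge0// mulr_ge0 ?Q0 ?g0.
- exact: measurable_funeM.
have Uq0 om : 0 <= U q om by case/andP: (U01 q om).
apply: ge0_le_integral => //.
- by move=> om _; rewrite lee_fin; apply: mulr_ge0 => //; exact: (mulr_ge0 (Q0 rs om U01) (g0 q om U01)).
- apply/measurable_EFinP; apply: measurable_funM => //; exact: (measurable_funM (mQ rs mU) (mg q mU)).
- by apply: emeasurable_funD => //; exact: measurable_funeM.
move=> om _; rewrite -EFinM -EFinD lee_fin -/(Q U rs om) -/(g (U q om)) -mulrA.
apply: le_trans (ler_wpM2l (Q0 rs om U01) (hg (U01 q om))) _; rewrite mulrDr mulrCA lerD2l.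
by rewrite ler_piMl//; case/andP: (Q01 rs om U01).
Qed.

Lemma first_passage_bound_aux (delta : R) (rs : seq R) : path <%R t0 rs ->
  (forall u, 0 <= u <= 1 -> u <= delta -> 2^-1 <= g u) ->
  (c%:E * P [set om | exists2 q, q \in rs & (W q om <= delta)%R] <=
    (2 * (e + (size rs)%:R * eta))%:E)%E.
Proof.
move=> prs md; set H := [set om | _].
have mH : measurable H.
  rewrite (_ : H = \bigcup_(q in [set` rs]) (setT `&` W q @^-1` `]-oo, delta])).
    by apply: fin_bigcup_measurable => // q _; exact: mW.
  apply/seteqP; split => om /=.
    by move=> [q qrs h]; exists q => //; split => //=; rewrite in_itv.
  by move=> [q /= qrs [_]]; rewrite /= in_itv/= => h; exists q.
have mI1 : measurable_fun setT (fun om => (2 * ((1 - Q W rs om) * c))%:E : \bar R).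
  apply/measurable_EFinP; apply: measurable_funM => //; apply: measurable_funM => //.
  by apply: measurable_funB => //; exact: mQ.
have mI2 : measurable_fun setT (fun om => ((1 - Q W rs om) * c)%:E : \bar R).
  apply/measurable_EFinP; apply: measurable_funM => //; apply: measurable_funB => //; exact: mQ.
have mI3 : measurable_fun setT (fun om => (1 - Q U rs om)%:E : \bar R).
  by apply/measurable_EFinP; apply: measurable_funB => //; exact: mQ.
have mI5 : measurable_fun setT (fun om => (\1_H om)%:E : \bar R).
  by apply/measurable_EFinP; exact: measurable_indic.
rewrite -[X in P X]setIT -integral_indic// -ge0_integralZl//.
apply: (@le_trans _ _ (\int[P]_om (2 * ((1 - Q W rs om) * c))%:E)%E).
  apply: ge0_le_integral => //.
  - by move=> om _; rewrite mule_ge0 ?lee_fin.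
  - exact: measurable_funeM.
  move=> om _; rewrite -EFinM lee_fin indicE; case: (boolP (om \in H)) => [/set_mem|_]; last first.
    by rewrite mulr0 mulr_ge0// mulr_ge0// QC0.
  move=> [q qrs qd]; rewrite mulr1 mulrA ler_peMl//.
  have h1 : Q W rs om <= 1 - g (W q om).
    rewrite /Q (big_rem q qrs) /=; apply: ler_piMr; first by case/andP: (sub01 (g01 (W01 q om))).
    by apply: prodr_ile1 => r _; apply: sub01; exact: g01.
  have h2 := md _ (W01 q om) qd.
  by move: (Q W rs om) (g (W q om)) h1 h2 => a b h1 h2; lra.
under eq_integral do rewrite EFinM.
rewrite ge0_integralZl//; last by move=> om _; rewrite lee_fin mulr_ge0// QC0.
rewrite EFinM; apply: lee_wpmul2l => //.
apply: le_trans (first_passage_le prs) _; rewrite EFinD leeD2r//.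
rewrite -[leRHS]mule1; apply: lee_wpmul2l => //.
rewrite -(probability_setT P) -[leRHS]mul1e -integral_cst//.
apply: ge0_le_integral => //.
- by move=> om _; rewrite lee_fin QC0.
by move=> om _; rewrite lee_fin lerBlDr lerDl Q0.
Qed.

End threshold.

Lemma first_passage_bound (delta : R) (rs : seq R) : 0 < delta -> path <%R t0 rs ->
  (c%:E * P [set om | exists2 q, q \in rs & (W q om <= delta)%R] <= (4 * delta)%:E)%E.
Proof.
move=> d0 prs; apply/lee_addgt0Pr => r r0.
pose eta := r / (2 * (size rs).+1%:R).
have eta0 : 0 < eta by rewrite divr_gt0// mulr_gt0.
have [j [m hjm]] := threshold_poly d0 eta0.
have := @first_passage_bound_aux j m (2 * delta) eta (mulr_ge0 (ler0n R 2) (ltW d0)) (ltW eta0)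
  (fun u u01 => (hjm u u01).2) delta rs prs (fun u u01 => (hjm u u01).1).
move/le_trans; apply; rewrite -EFinD lee_fin mulrDr mulrA -natrM lerD2l.
have -> : 2 * ((size rs)%:R * eta) = r * ((size rs)%:R / (size rs).+1%:R).
  by rewrite /eta; field.
by rewrite ler_piMr ?(ltW r0)// ler_pdivrMr// mul1r ler_nat.
Qed.

End first_passage.

Lemma lap_maxe {R : realType} (lam : R) (z : \bar R) : lap lam (maxe 0%E z) = lap lam z.
Proof.
have [//|z0] := leP 0%E z.
rewrite lap_elap//= /lap; case: eqP z0 => [->//|_ z0].
by rewrite max_l ?(ltW z0)//= !mulr0.
Qed.

Section psum_algebra.
Context {R : realType} {d dS : measure_display} {Om : measurableType d} {S : measurableType dS}.
Variables (xs : Om -> nat -> R) (ws : Om -> nat -> S).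
Local Open Scope ereal_scope.

Lemma psumD x (f g : S -> \bar R) om : (forall w, 0 <= f w) -> (forall w, 0 <= g w) ->
  psum xs ws x (fun w => f w + g w) om = psum xs ws x f om + psum xs ws x g om.
Proof.
move=> f0 g0; rewrite /psum -nneseriesD; last 2 first.
- by move=> n _ _; case: ifP.
- by move=> n _ _; case: ifP.
by apply: eq_eseriesr => n _; case: ifP => // _; rewrite adde0.
Qed.

Lemma psum_sum (I : eqType) (s : seq I) x (f : I -> S -> \bar R) om : (forall i w, 0 <= f i w) ->
  psum xs ws x (fun w => \sum_(i <- s) f i w) om = \sum_(i <- s) psum xs ws x (f i) om.
Proof.
move=> f0; rewrite /psum -nneseries_sum_seq; last by move=> i n; case: ifP.
by apply: eq_eseriesr => n _; case: ifP => // _; rewrite big1.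
Qed.

Lemma psumZ (c : R) x (f : S -> \bar R) om : (0 <= c)%R -> (forall w, 0 <= f w) ->
  psum xs ws x (fun w => c%:E * f w) om = c%:E * psum xs ws x f om.
Proof.
move=> c0 f0; rewrite /psum -nneseriesZl//; last by move=> n _ ; case: ifP.
by apply: eq_eseriesr => n _; case: ifP => // _; rewrite mule0.
Qed.

End psum_algebra.

Section flow_bound.
Context {R : realType}.
Variables (Psi : R -> R) (lam0 : R).
Hypotheses (hP : admissible Psi) (hlam0 : 0 < lam0).
Variables (ell : R -> {measure set (\bar R) -> \bar R}).
Hypothesis hell0 : forall t, 0 < t -> ell t [set z | (z <= 0)%E] = 0%E.
Hypothesis hell : forall t lam v, 0 < t -> 0 < lam -> is_cum Psi t lam v ->
  (\int[ell t]_z (1 - elap lam z)%:E)%E = v%:E.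
Variables (K : R -> \bar R -> {measure set (\bar R) -> \bar R}).
Hypothesis hK0 : forall s y, 0 < s -> (0 <= y)%E ->
  K s y [set z | (z < 0)%E] = 0%E /\ K s y setT = 1%E.
Hypothesis hK : forall s y lam v, 0 < s -> (0 <= y)%E -> 0 < lam -> is_cum Psi s lam v ->
  (\int[K s y]_z (elap lam z)%:E)%E = (elap v y)%:E.
Variable N : {measure set (@Dpath R) -> \bar R}.
Hypothesis hNfdd : forall (t : R) (B : set (\bar R)) (l : seq (R * set (\bar R))),
  0 < t -> measurable B -> B `<=` [set z | (0 < z)%E] ->
  all (fun p => 0 < p.1) l -> (forall p, p \in l -> measurable p.2) ->
  N (((fun w : R -> \bar R => w t) @^-1` B) `&` cyl t l) =
    (\int[ell t]_(y in B) fdd_iter K y l)%E.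
Hypothesis Npos : forall t : R, (0 < t)%R -> N [set w : Dpath | (w t < 0)%E] = 0%E.
Hypothesis hNabs : forall s t : R, 0 < s < t ->
  N [set w : R -> \bar R | w s = 0%E /\ w t != 0%E] = 0%E.
Hypothesis hNnz : N [set w : R -> \bar R | forall q : rat, 0 < q -> w (ratr q) = 0%E] = 0%E.

Local Notation V := (vinv Psi lam0).
Local Notation A lam := (io (up Psi lam0 lam)).
Local Notation B lam := (io (dn Psi lam0 lam)).
Context {d : measure_display} {Om : measurableType d}.
Variables (P : probability Om R) (xs : Om -> nat -> R) (Xs : Om -> nat -> @Dpath R).
Hypothesis hNsf : sigma_finite setT N.
Hypothesis hPPP : is_PPP P (marked_atoms xs Xs) (intensity N).
Implicit Types (t lam : R).

Let mA lam : measurable (A lam : set (@Dpath R)).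
Proof. by apply: io_measurable => q; exact: up_measurable. Qed.

Let V0 q lam : 0 < V q lam. Proof. exact: vinv_gt0. Qed.

Section fixed.
Variables (x lam : R).
Hypotheses (x0 : 0 <= x) (l0 : 0 < lam).

(* Only positive times matter; the truncation makes every [U q] measurable. *)
Let pt (q : R) : R := if 0 < q then q else 1.
Let pt0 q : 0 < pt q. Proof. by rewrite /pt; case: ifPn. Qed.
Let f (q : R) (w : Dpath) : \bar R := ((V q lam)%:E * maxe 0 (w (pt q)))%E.
Let h (q : R) (w : @Dpath R) : \bar R := if w \in A lam then 0%E else f q w.
Let L (g : @Dpath R -> \bar R) om := elap 1 (psum xs Xs x g om).
Let U q := L (f q).
Let W q := L (h q).

Let f0 q w : (0 <= f q w)%E.
Proof. by rewrite mule_ge0 ?lee_fin ?(ltW (V0 _ _))// le_max lexx. Qed.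

Let h0 q w : (0 <= h q w)%E. Proof. by rewrite /h; case: ifP. Qed.

Let mf q : measurable_fun [set: @Dpath R] (f q).
Proof.
apply: measurable_funeM; apply: measurable_maxe => //.
exact: measurable_coord.
Qed.

Let mh q : measurable_fun [set: @Dpath R] (h q).
Proof.
apply: measurable_fun_ifT => //.
apply: (@measurable_fun_bool _ _ _ _ true).
rewrite setTI (_ : _ @^-1` _ = A lam)//.
by apply/seteqP; split => w /= hw; [exact: set_mem|exact: mem_set].
Qed.

Let mL g : measurable_fun [set: @Dpath R] g -> (forall w, (0 <= g w)%E) ->
  measurable_fun setT (L g).
Proof.
move=> mg g0; have [mp _] := laplace_functional hPPP hNsf x0 mg g0.
by apply: measurableT_comp mp; exact: measurable_fun_elap.
Qed.

Let L01 g om : (forall w : @Dpath R, (0 <= g w)%E) -> 0 <= L g om <= 1.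
Proof. by move=> g0; rewrite elap_ge0 elap_le1// psum_ge0. Qed.

Let elapf q w : 0 < q -> elap 1 (f q w) = lap (V q lam) (w q).
Proof.
by move=> q0; rewrite /f /pt q0 elapZ// mul1r -lap_elap ?le_max ?lexx// lap_maxe.
Qed.

Let LE (Y : R -> @Dpath R -> \bar R) (ts : seq R) (k : R -> nat) g :
  (forall q, measurable_fun setT (Y q)) -> (forall q w, (0 <= Y q w)%E) ->
  measurable_fun setT g -> (forall w, (0 <= g w)%E) ->
  (\int[P]_om ((\prod_(q <- ts) L (Y q) om ^+ k q) * L g om)%:E =
   (elap 1 (x%:E * \int[N]_w (1 - (\prod_(q <- ts) elap 1 (Y q w) ^+ k q) * elap 1 (g w))%:E))%:E)%E.
Proof.
move=> mY Y0 mg g0.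
pose F (w : Dpath) := (\sum_(q <- ts) \sum_(i < k q) Y q w)%E.
have F0 w : (0 <= F w)%E by apply: sume_ge0 => q _; apply: sume_ge0.
have mF : measurable_fun setT F.
  by apply: emeasurable_sum => q; apply: emeasurable_sum.
have eF om : \prod_(q <- ts) L (Y q) om ^+ k q = L F om.
  rewrite /L /F psum_sum; last by move=> q w; apply: sume_ge0.
  rewrite elap_sum; last by move=> q; apply: psum_ge0 => w; apply: sume_ge0.
  apply: eq_bigr => q _; rewrite (@psum_sum _ _ _ _ _ xs Xs _ _ x (fun=> Y q) om)//.
  by rewrite elap_sum ?big_const_ord ?iter_mulr_1// => i; exact: psum_ge0.
have mFg : measurable_fun setT (fun w => F w + g w)%E by exact: emeasurable_funD.
have Fg0 w : (0 <= F w + g w)%E by exact: adde_ge0.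
have [_ e] := laplace_functional hPPP hNsf x0 mFg Fg0.
transitivity (\int[P]_om (elap 1 (psum xs Xs x (fun w => F w + g w)%E om))%:E)%E.
  by apply: eq_integral => om _; rewrite eF psumD// elapD// psum_ge0.
rewrite e; congr ((elap 1 (_ * _))%:E); apply: eq_integral => w _.
rewrite elapD// /F elap_sum; last by move=> q; apply: sume_ge0.
congr (1 - _ * _)%:E; apply: eq_bigr => q _.
by rewrite elap_sum// big_const_ord iter_mulr_1.
Qed.

Let elap10 : elap 1 (0%E : \bar R) = 1. Proof. by rewrite /= mulr0 oppr0 expR0. Qed.

Let c : R := expR (- (x * lam)).

Let hUW t0 : 0 < t0 -> t0 < 1 -> forall (ts : seq R) (k : R -> nat), path <%R t0 ts ->
  (\int[P]_om ((\prod_(q <- ts) W q om ^+ k q) * c)%:E =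
   \int[P]_om ((\prod_(q <- ts) U q om ^+ k q) * U (last t0 ts) om)%:E)%E.
Proof.
move=> t00 t01 ts k pts.
pose FU (w : Dpath) := \prod_(q <- ts) lap (V q lam) (w q) ^+ k q.
pose FW (w : Dpath) := \prod_(q <- ts) elap 1 (h q w) ^+ k q.
have mFW : measurable_fun setT FW.
  apply: measurable_prod => q _; apply: measurable_funX.
  by apply: measurableT_comp (mh q); exact: measurable_fun_elap.
have FW01 w : 0 <= FW w <= 1.
  apply/andP; split; first by apply: prodr_ge0 => q _; rewrite exprn_ge0 ?elap_ge0.
  by apply: prodr_ile1 => q _; rewrite exprn_ge0 ?elap_ge0//= exprn_ile1 ?elap_ge0 ?elap_le1.
have FE w : (1 - FU w * \1_(~` A lam) w)%:E = ((1 - FW w)%:E + (\1_(A lam) w)%:E)%E :> \bar R.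
  rewrite -EFinD !indicE in_setC; congr EFin.
  case: (boolP (w \in A lam)) => wA /=.
    rewrite mulr0 subr0 /FW big1 ?subrr ?add0r// => q _.
    by rewrite /h wA elap10 expr1n.
  rewrite mulr1 addr0; congr (_ - _); rewrite /FU /FW big_seq [RHS]big_seq.
  apply: eq_bigr => q qts; rewrite /h (negbTE wA) elapf//; exact: path_gt0 pts qts.
have key : (\int[N]_w (1 - FU w * \1_(~` A lam) w)%:E = \int[N]_w (1 - FW w)%:E + lam%:E)%E.
  under eq_integral do rewrite FE.
  rewrite ge0_integralD//; last 3 first.
  - by move=> w _; rewrite lee_fin subr_ge0; case/andP: (FW01 w).
  - by apply/measurable_EFinP; exact: measurable_funB.
  - by apply/measurable_EFinP; exact: measurable_indic.
  by rewrite integral_indic// setIT (N_up hP hlam0 hell0 hell hK0 hK hNfdd Npos hNabs hNnz l0).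
transitivity (\int[P]_om ((\prod_(q <- ts) W q om ^+ k q) * L (fun=> 0%E) om)%:E * c%:E)%E.
  have mP : measurable_fun setT (fun om => \prod_(q <- ts) W q om ^+ k q).
    by apply: measurable_prod => q _; apply: measurable_funX; exact: mL.
  have P0 om : 0 <= \prod_(q <- ts) W q om ^+ k q.
    by apply: prodr_ge0 => q _; rewrite exprn_ge0 ?elap_ge0.
  have L0 om : L (fun=> 0%E) om = 1 by rewrite /L /psum eseries0// => n _ _; rewrite if_same.
  under [in RHS]eq_integral do rewrite L0 mulr1.
  under [in LHS]eq_integral do rewrite EFinM.
  rewrite ge0_integralZr// ?lee_fin ?expR_ge0//; first exact/measurable_EFinP.
  by move=> om _; rewrite lee_fin.
rewrite /W /U (LE _ _ mh h0) ?(LE _ _ mf f0)//.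
have := N_prod_up_full hP hlam0 hell0 hell hK0 hK hNfdd Npos hNabs k t00 t01 l0 pts.
rewrite -/FU key => e.
transitivity (elap 1 (x%:E * (\int[N]_w (1 - FW w)%:E + lam%:E)))%:E.
  under eq_integral do rewrite elap10 mulr1.
  have i0 : (0 <= \int[N]_w (1 - FW w)%:E)%E.
    by apply: integral_ge0 => w _; rewrite lee_fin subr_ge0; case/andP: (FW01 w).
  have lam_ge0 : (0 <= lam%:E)%E by rewrite lee_fin ltW.
  have -> : (x%:E * (\int[N]_w (1 - FW w)%:E + lam%:E) =
      x%:E * \int[N]_w (1 - FW w)%:E + (x * lam)%:E)%E by rewrite ge0_muleDr.
  rewrite elapD ?mule_ge0// ?lee_fin ?mulr_ge0 ?(ltW l0)//.
  by rewrite EFinM /= mul1r.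
rewrite e; congr ((elap 1 (_ * _))%:E); apply: eq_integral => w _; congr (1 - _ * _)%:E.
  rewrite /FU big_seq [RHS]big_seq; apply: eq_bigr => q qts.
  by rewrite elapf//; exact: path_gt0 pts qts.
by rewrite elapf// (last_gt0 t00 pts).
Qed.

Let trim (q : R) (w : @Dpath R) : \bar R := if w \in A lam then 0%E else maxe 0%E (w q).

Let trim0 q w : (0 <= trim q w)%E. Proof. by rewrite /trim; case: ifP => // _; rewrite le_max lexx. Qed.

Let WE q om : 0 < q -> W q om = elap (V q lam) (psum xs Xs x (trim q) om).
Proof.
move=> q0; rewrite -[V q lam]mul1r -elapZ// -psumZ ?(ltW (V0 _ _))//; congr (elap 1 _).
by apply: eq_eseriesr => n _; case: ifP => // _; rewrite /h /trim /f /pt q0; case: ifP => //; rewrite mule0.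
Qed.

Lemma trimmed_flow_upper lam' : 0 < lam' -> lam' < lam ->
  {ae P, forall om, exists s, forall n j,
      (psum xs Xs x (fun w => if w \in A lam then 0%E else maxe 0%E (w (gr s n j))) om
        < (V (gr s n j) lam')^-1%:E)%E}.
Proof.
move=> l'0 ll.
have t00 : 0 < 2^-1 :> R by [].
have t01 : 2^-1 < 1 :> R by rewrite invf_lt1// ltr1n.
have c0 : 0 < c by exact: expR_gt0.
have c1 : c <= 1 by rewrite expR_le1 oppr_le0 mulr_ge0// ltW.
pose dl (i : nat) : R := i.+1%:R^-1.
have dl0 i : 0 < dl i by rewrite invr_gt0.
have hs i : exists s : nat, forall q, s.+1%:R <= q -> expR (- (V q lam / V q lam')) <= dl i.
  have [M [_ hM]] := vinv_ratio_cvgy hP hlam0 i.+1%:R l'0 ll.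
  exists (Num.truncn M) => q Mq.
  have h1 : i.+1%:R * V q lam' <= V q lam.
    by apply: hM; apply: lt_le_trans Mq; exact: truncnS_gt.
  have h2 : i.+1%:R <= V q lam / V q lam' by rewrite ler_pdivlMr.
  apply: (@le_trans _ _ (expR (- i.+1%:R))); first by rewrite ler_expR lerN2.
  rewrite expRN lef_pV2 ?posrE ?expR_gt0//.
  by have := expR_ge1Dx (i.+1%:R : R); apply: le_trans; rewrite lerDr.
have /choice [sq hsq] := hs.
pose H i n := [set om | exists2 q, q \in grid (sq i) n & W q om <= dl i].
have mU q : measurable_fun setT (U q) by exact: mL.
have mW q : measurable_fun setT (W q) by exact: mL.
have mH i n : measurable (H i n).
  rewrite (_ : H i n = \bigcup_(q in [set` grid (sq i) n]) (setT `&` W q @^-1` `]-oo, dl i])).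
    by apply: fin_bigcup_measurable => // q _; exact: mW.
  apply/seteqP; split => om /=.
    by move=> [q qrs hq]; exists q => //; split => //=; rewrite in_itv.
  by move=> [q /= qrs [_]]; rewrite /= in_itv/= => hq; exists q.
have PH i n : (P (H i n) <= (4 * dl i / c)%:E)%E.
  rewrite EFinM lee_pdivlMr// muleC.
  apply: (first_passage_bound mU _ mW _ _ (hUW t00 t01)) => //.
  - by move=> q om; exact: L01.
  - by move=> q om; exact: L01.
  - by rewrite (ltW c0).
  - by apply: grid_path; apply: lt_le_trans t01 _; rewrite ler1n.
have PUH i : (P (\bigcup_n H i n) <= (4 * dl i / c)%:E)%E.
  have nd : {homo H i : n m / (n <= m)%N >-> (n <= m)%O}.
    move=> n m nm; apply/subsetPset => om [q qn hq]; exists q => //.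
    exact: grid_mono nm _ qn.
  have cv := nondecreasing_cvg_mu (mu := P) (mH i) (bigcupT_measurable _ (mH i)) nd.
  rewrite -(cvg_lim _ cv)//; apply: lime_le; first by apply/cvg_ex; eexists; exact: cv.
  by apply: nearW => n; exact: PH.
exists (\bigcap_i \bigcup_n H i n); split.
- by apply: bigcapT_measurable => i; exact: bigcupT_measurable.
- apply/eqP; rewrite -measure_le0; apply/lee_addgt0Pr => e e0; rewrite add0e.
  have [i hi] : exists i, 4 * dl i / c <= e.
    exists (Num.truncn (4 / (e * c))); rewrite ler_pdivrMr// ler_pdivrMr// mulrC -ler_pdivrMr ?mulr_gt0//.
    exact: ltW (truncnS_gt _).
  apply: (@le_trans _ _ (P (\bigcup_n H i n))).
    apply: le_measure; rewrite ?inE.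
    + by apply: bigcapT_measurable => k; exact: bigcupT_measurable.
    + exact: bigcupT_measurable.
    + by move=> om; apply.
  by apply: le_trans (PUH i) _; rewrite lee_fin.
move=> om /= hn i _.
have [n [j hj]] : exists n j, ((V (gr (sq i) n j) lam')^-1%:E <=
    psum xs Xs x (trim (gr (sq i) n j)) om)%E.
  apply: contrapT => hh; apply: hn; exists (sq i) => n j; rewrite ltNge; apply/negP => h'.
  by apply: hh; exists n, j.
have [n' _ hn'] := gr_grid (R := R) (sq i) n j.
exists n' => //.
exists (gr (sq i) n j) => //; rewrite WE ?gr_gt0//.
rewrite -lap_elap; last by apply: psum_ge0.
apply: le_trans (lap_le_expR (ltW (V0 _ _)) _ hj) _; first by rewrite invr_ge0 ltW.
by apply: hsq; exact: gr_ge.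
Qed.

End fixed.

End flow_bound.

Section ppp_almost_sure.
Context {R : realType} {d dS : measure_display} {Om : measurableType d} {S : measurableType dS}.
Variables (P : probability Om R) (N : {measure set S -> \bar R}).
Variables (xs : Om -> nat -> R) (ws : Om -> nat -> S).
Hypothesis hPPP : is_PPP P (marked_atoms xs ws) (intensity N).

Lemma ppp_map {dT : measure_display} {T : measurableType dT} (g : S -> T) (zs : Om -> nat -> T) :
  measurable_fun setT g -> (forall om n, zs om n = g (ws om n)) ->
  is_PPP P (marked_atoms xs zs) (intensity (fun A : set T => N (g @^-1` A))).
Proof.
move=> mg gz n A k mA dA finA.
pose phi (p : measurableTypeR R * S) : measurableTypeR R * T := (p.1, g p.2).
have mphi : measurable_fun setT phi.
  by apply: measurable_fun_pair => //; apply: measurableT_comp mg _.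
have xsE i (x : measurableTypeR R) : xsection (phi @^-1` A i) x = g @^-1` xsection (A i) x.
  by apply/seteqP; split => w; rewrite /xsection /= !inE.
have nuE i : intensity N (phi @^-1` A i) = intensity (fun A : set T => N (g @^-1` A)) (A i).
  by rewrite /intensity; apply: eq_integral => x _; rewrite xsE.
have := @hPPP n (fun i => phi @^-1` A i) k.
case=> [i|i j ij|i|mE PE].
- by rewrite -[X in measurable X]setTI; exact: mphi.
- by rewrite -preimage_setI dA// preimage_set0.
- by rewrite nuE.
have cE om i : cnt (marked_atoms xs ws om) (phi @^-1` A i) = cnt (marked_atoms xs zs om) (A i) :> \bar R.
  by apply: eq_eseriesr => m _; rewrite !indicE /marked_atoms gz.
have EE : \bigcap_(i in [set: 'I_n])
    [set w | cnt (marked_atoms xs ws w) (phi @^-1` A i) = (k i)%:R%:E :> \bar R] =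
  \bigcap_(i in [set: 'I_n]) [set w | cnt (marked_atoms xs zs w) (A i) = (k i)%:R%:E :> \bar R].
  by apply: eq_bigcapr => i _; apply/seteqP; split => om /=; rewrite cE.
rewrite EE in mE PE; split; first exact: mE.
by rewrite /= PE; congr EFin; apply: eq_bigr => i _; rewrite nuE.
Qed.

Lemma ppp_finite x (D : set S) : 0 <= x -> measurable D -> (N D < +oo)%E ->
  {ae P, forall om, finite_set [set n | 0 <= xs om n <= x /\ D (ws om n)]}.
Proof.
move=> x0 mD ND; have mA := rect_measurable x mD.
have nuf : (intensity N (rect x D) < +oo)%E.
  by rewrite nu_rect// lte_mul_pinfty// ?ge0_fin_numE// ltry.
set M := fine (intensity N (rect x D)).
pose E k := [set om | cnt (marked_atoms xs ws om) (rect x D) = k%:R%:E :> \bar R].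
have mE k : measurable (E k) by have [] := ppp1 hPPP k mA nuf.
have PE k : P (E k) = (pois M k)%:E by have [] := ppp1 hPPP k mA nuf.
exists (~` \bigcup_k E k); split.
- by apply: measurableC; exact: bigcupT_measurable.
- rewrite probability_setC; last exact: bigcupT_measurable.
  have tE : trivIset setT E.
    apply/trivIsetP => i j _ _ ij; apply/seteqP; split => // om [].
    by rewrite /E /= => -> [] /eqP; rewrite eqr_nat (negbTE ij).
  have := measure_semi_sigma_additive (s := P) E mE tE (bigcupT_measurable _ mE).
  move=> /cvg_lim => /(_ (@ereal_hausdorff R)) <-.
  have -> : (fun n => \sum_(0 <= k < n) P (E k))%E = (fun n => \sum_(0 <= k < n) (1 ^+ k * pois M k)%:E)%E.
    by apply/funext => n; apply: eq_bigr => k _; rewrite expr1n mul1r; exact: PE.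
  by have := pois_series M 1; rewrite subrr mulr0 oppr0 expR0 => ->; rewrite subee.
move=> om /= h [k _ /cnt_finite fk]; apply: h; apply: sub_finite_set fk => n [/= xn Dn].
by split => //=; rewrite in_itv.
Qed.

Lemma ppp_atom_le (eps : R) : 0 < eps ->
  (forall y : nat, exists D, measurable D /\ N D = y%:R%:E) ->
  {ae P, forall om, exists n, 0 <= xs om n <= eps}.
Proof.
move=> e0 /choice [D hD].
have mD y : measurable (D y) by case: (hD y).
have ND y : N (D y) = y%:R%:E by case: (hD y).
pose E y := [set om | cnt (marked_atoms xs ws om) (rect eps (D y)) = 0%:R%:E :> \bar R].
have nuE y : intensity N (rect eps (D y)) = (y%:R * eps)%:E.
  by rewrite nu_rect ?ltW// ND.
have mE y : measurable (E y).
  by have [] := ppp1 hPPP 0%N (rect_measurable eps (mD y)); rewrite ?nuE ?ltry.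
have PE y : P (E y) = (expR (- (y%:R * eps)))%:E.
  have [|_ ->] := ppp1 hPPP 0%N (rect_measurable eps (mD y)); first by rewrite nuE ltry.
  by rewrite nuE/= /pois expr0 mulr1 fact0 divr1.
exists (\bigcap_y E y); split.
- exact: bigcapT_measurable.
- apply/eqP; rewrite -measure_le0; apply/lee_addgt0Pr => r r0; rewrite add0e.
  pose y := (Num.truncn (r * eps)^-1).+1.
  apply: (@le_trans _ _ (P (E y))).
    by apply: le_measure; rewrite ?inE//; [exact: bigcapT_measurable|move=> om; apply].
  rewrite PE lee_fin expRN -[leRHS]invrK lef_pV2 ?posrE ?expR_gt0 ?invr_gt0//.
  apply: le_trans (expR_ge1Dx _); apply: (@le_trans _ _ (y%:R * eps)); last by rewrite lerDr.
  by rewrite -ler_pdivrMr// -invfM; apply: ltW; exact: truncnS_gt.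
move=> om /= h y _; rewrite /E /= /cnt eseries0// => n _ _; rewrite indicE memNset//.
by move=> [/=]; rewrite in_itv/= => xn _; apply: h; exists n.
Qed.

(* Cutting [0, K] into M cells of mean x K / M, two atoms share a cell with probability at
   most M (x K / M)^2, which vanishes as M grows. *)
Lemma ppp_no_ties_box x (K : R) (y : S -> R) : 0 <= x -> 0 < K ->
  (forall a b : R, 0 <= a -> a < b ->
     measurable [set w | a <= y w < b] /\ N [set w | a <= y w < b] = (b - a)%:E) ->
  {ae P, forall om n m, n <> m -> 0 <= xs om n <= x -> 0 <= xs om m <= x ->
     0 <= y (ws om n) < K -> y (ws om n) <> y (ws om m)}.
Proof.
move=> x0 K0 hy.
pose h (M : nat) : R := K / M.+1%:R.
have h0 M : 0 < h M by rewrite divr_gt0.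
pose D M (i : nat) := [set w | i%:R * h M <= y w < i.+1%:R * h M].
have ih M (i : nat) : 0 <= i%:R * h M by rewrite mulr_ge0// ltW.
have ilt M (i : nat) : i%:R * h M < i.+1%:R * h M by rewrite ltr_pM2r// ltr_nat.
have mD M i : measurable (D M i) by have [] := hy _ _ (ih M i) (ilt M i).
have ND M i : N (D M i) = (h M)%:E.
  have [_ ->] := hy _ _ (ih M i) (ilt M i); congr EFin.
  by rewrite -natr1 mulrDl mul1r addrC addKr.
pose E M i k := [set om | cnt (marked_atoms xs ws om) (rect x (D M i)) = k%:R%:E :> \bar R].
have nuE M i : intensity N (rect x (D M i)) = (h M * x)%:E by rewrite nu_rect// ND.
have mE M i k : measurable (E M i k).
  by have [] := ppp1 hPPP k (rect_measurable x (mD M i)); rewrite ?nuE ?ltry.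
have PE M i k : P (E M i k) = (pois (h M * x) k)%:E.
  have [|_ ->] := ppp1 hPPP k (rect_measurable x (mD M i)); first by rewrite nuE ltry.
  by rewrite nuE.
pose F M i := ~` (E M i 0%N `|` E M i 1%N).
have mF M i : measurable (F M i) by apply: measurableC; exact: measurableU.
have PF M i : (P (F M i) <= ((h M * x) ^+ 2)%:E)%E.
  rewrite probability_setC; last exact: measurableU.
  have -> : P (E M i 0%N `|` E M i 1%N) = (pois (h M * x) 0 + pois (h M * x) 1)%:E.
    rewrite EFinD -!(PE M i); apply: measureU => //.
    by apply/seteqP; split => // om []; rewrite /E /= => -> [] /eqP; rewrite eqr_nat.
  rewrite -EFinB lee_fin opprD addrA; apply: pois_tail2.
  by rewrite mulr_ge0// ltW.
pose B M := \bigcup_(i in `I_M.+1) F M i.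
have mB M : measurable (B M) by apply: bigcup_measurable.
have PB M : (P (B M) <= ((K * x) ^+ 2 / M.+1%:R)%:E)%E.
  apply: (@le_trans _ _ (\sum_(i < M.+1) P (F M i))%E).
    by rewrite /B bigcup_mkord; apply: content_subadditive => //=; apply: bigsetU_measurable.
  apply: (@le_trans _ _ (\sum_(i < M.+1) ((h M * x) ^+ 2)%:E)%E).
    by apply: lee_sum => i _; exact: PF.
  rewrite sumEFin lee_fin sumr_const card_ord -[leLHS]mulr_natl le_eqVlt; apply/orP; left.
  have m0 : M.+1%:R != 0 :> R by rewrite pnatr_eq0.
  by apply/eqP; rewrite /h; move: (M.+1%:R) m0 => a a0; field.
exists (\bigcap_M B M); split.
- exact: bigcapT_measurable.
- apply/eqP; rewrite -measure_le0; apply/lee_addgt0Pr => r r0; rewrite add0e.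
  pose M := Num.truncn ((K * x) ^+ 2 / r).
  apply: (@le_trans _ _ (P (B M))).
    by apply: le_measure; rewrite ?inE//; [exact: bigcapT_measurable|move=> om; apply].
  apply: le_trans (PB M) _; rewrite lee_fin ler_pdivrMr// [leRHS]mulrC -ler_pdivrMr//.
  by apply: ltW; exact: truncnS_gt.
move=> om /= hn M _; apply: contrapT => nB; apply: hn => n m nm xn xm /andP[y0 yK] yy.
apply: nB; set v := y (ws om n) in y0 yK yy.
have vh : 0 <= v / h M by rewrite divr_ge0// ltW.
have /andP[i1 i2] := truncn_itv vh.
set i := Num.truncn (v / h M) in i1 i2.
have vD : i%:R * h M <= v < i.+1%:R * h M by rewrite -ler_pdivlMr// -ltr_pdivrMr// i1.
exists i => /=.
  rewrite -(@ltr_nat R); apply: le_lt_trans i1 _.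
  by rewrite ltr_pdivrMr// /h mulrC divfK.
move=> hE.
have key k : E M i k om -> (2 <= k)%N.
  by apply: cnt_ge2 nm _ _; split => //=; rewrite ?in_itv//= /D /= -?yy.
by case: hE => /key.
Qed.

Lemma ppp_no_ties (y : S -> R) :
  (forall a b : R, 0 <= a -> a < b ->
     measurable [set w | a <= y w < b] /\ N [set w | a <= y w < b] = (b - a)%:E) ->
  {ae P, forall om n m, n <> m -> 0 <= y (ws om n) -> y (ws om n) <> y (ws om m)}.
Proof.
move=> hy.
have h1 : {ae P, forall om, forall x K : nat, forall n m, n <> m -> 0 <= xs om n <= x%:R ->
    0 <= xs om m <= x%:R -> 0 <= y (ws om n) < K.+1%:R -> y (ws om n) <> y (ws om m)}.
  by apply/ae_foralln => x; apply/ae_foralln => K; apply: ppp_no_ties_box.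
have h2 := ppp_pos hPPP; near=> om.
have h1om : forall x K : nat, forall n m, n <> m -> 0 <= xs om n <= x%:R ->
    0 <= xs om m <= x%:R -> 0 <= y (ws om n) < K.+1%:R -> y (ws om n) <> y (ws om m).
  by near: om.
have h2om : forall n, 0 <= xs om n by near: om.
move=> n m nm y0.
pose x := maxn (Num.truncn (xs om n)).+1 (Num.truncn (xs om m)).+1.
apply: (h1om x (Num.truncn (y (ws om n))) n m nm).
- rewrite h2om/= ltW// (lt_le_trans (truncnS_gt _))// ler_nat; exact: leq_maxl.
- rewrite h2om/= ltW// (lt_le_trans (truncnS_gt _))// ler_nat; exact: leq_maxr.
- by rewrite y0 truncnS_gt.
Unshelve. all: by end_near. Qed.

End ppp_almost_sure.

Section nonnegative_series.
Context {R : realType}.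
Local Open Scope ereal_scope.

Lemma nneseries_le_partial (u : nat -> \bar R) (c : \bar R) : (forall n, 0 <= u n) ->
  (forall M, \sum_(0 <= n < M) u n <= c) -> \sum_(0 <= n <oo) u n <= c.
Proof.
move=> u0 hu; apply: lime_le; first by apply: is_cvg_nneseries => n _ _.
by apply: nearW => M; exact: hu.
Qed.

Lemma nneseries_ge_term (u : nat -> \bar R) m : (forall n, 0 <= u n) ->
  u m <= \sum_(0 <= n <oo) u n.
Proof.
move=> u0; apply: (@le_trans _ _ (\sum_(0 <= n < m.+1) u n)); last exact: nneseries_lim_ge.
by rewrite big_nat_recr//= leeDr// sume_ge0.
Qed.

End nonnegative_series.

Section atoms.
Context {R : realType}.
Variables (Psi : R -> R) (lam0 : R).
Hypotheses (hP : admissible Psi) (hlam0 : 0 < lam0).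
Local Notation V := (vinv Psi lam0).
Local Notation G := (Gfun Psi lam0).
Local Notation A lam := (io (up Psi lam0 lam)).
Variables (xs : nat -> R) (ws : nat -> R -> \bar R).
Hypothesis xs_ge0 : forall n, 0 <= xs n.
Hypothesis cw : forall n, cadlag_pos (ws n).
Hypothesis good : forall n, goodpath Psi lam0 (ws n).
Local Notation inA i n := ((ws n : @Dpath R) \in A (rlam i)).
Hypothesis trim : forall (X i j : nat), rlam j < rlam i :> R -> exists s, forall n k,
  (\sum_(0 <= m <oo) (if (0 <= xs m <= X%:R)%R then
     if inA i m then 0 else maxe 0 (ws m (gr s n k)) else 0) < (V (gr s n k) (rlam j))^-1%:E)%E.
Hypothesis fin : forall X i : nat, finite_set [set n | 0 <= xs n <= X%:R /\ A (rlam i) (ws n)].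
Hypothesis acc : forall k : nat, exists n, 0 <= xs n <= k.+1%:R^-1.
Local Notation Z n := (Zlim Psi lam0 (ws n)).
Hypothesis ties : forall n m, n <> m -> Z n <> Z m.
Local Notation ZZ := (Zfun (fun n => Z n) xs).
Local Notation fl := (flow xs ws).
Implicit Types (t x y : R).

Let V0 t y : 0 < V t y. Proof. exact: vinv_gt0. Qed.

Let w0 n t : 0 < t -> (0 <= ws n t)%E. Proof. by move=> /(cw n) []. Qed.

Lemma Zlim_good n : [/\ (0 < Z n)%E, Z n \is a fin_num &
  scaledG Psi lam0 t (ws n t) @[t --> +oo%R] --> Z n].
Proof.
have [pw z0 zy] := good n; rewrite (Zlim_pconv hP hlam0 (cw n) pw); split => //.
  by rewrite ge0_fin_numE ?zsup_ge0.
exact: pconv_cvg.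
Qed.

Let Zpos n : (0 < Z n)%E. Proof. by case: (Zlim_good n). Qed.
Let Zfin n : Z n \is a fin_num. Proof. by case: (Zlim_good n). Qed.

Let pinf_gt (T : R) : \forall t \near +oo%R, T <= t.
Proof. by apply: nbhs_pinfty_ge; exact: num_real. Qed.

Lemma atom_eventually_ge n y : ((G y)%:E < Z n)%E ->
  \forall t \near +oo%R, ((V t y)^-1%:E <= ws n t)%E.
Proof.
move=> h; have [_ _ cv] := Zlim_good n; near=> t.
have t0 : 0 < t by apply: (@lt_le_trans _ _ 1) => //; near: t; exact: pinf_gt.
rewrite -scaledG_ge//; last exact: w0.
by apply: ltW; near: t; exact: cv (open_ereal_gt_ereal h).
Unshelve. all: by end_near. Qed.

Lemma atom_notA n y : (Z n < (G y)%:E)%E -> ~ A y (ws n).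
Proof.
move=> h Ay; have [_ _ cv] := Zlim_good n.
have [M [_ hM]] := cv _ (open_ereal_lt_ereal h).
have [q [Mq [q0 hq]]] := io_unbounded (M + 1) Ay.
have : (scaledG Psi lam0 q (ws n q) < (G y)%:E)%E.
  by apply: hM; rewrite (lt_le_trans _ Mq)// ltrDl.
by rewrite ltNge scaledG_ge ?hq//; exact: w0.
Qed.

Lemma rlam_between (a b : R) : 0 <= a -> a < b -> exists i j,
  [/\ rlam j < rlam i :> R, a < G (rlam i) & G (rlam j) < b].
Proof.
move=> a0 ab.
have d0 : 0 < (b - a) / 2 by rewrite divr_gt0 ?subr_gt0.
have m0 : 0 < a + (b - a) / 2 by rewrite ltr_wpDl.
have am : a < a + (b - a) / 2 by rewrite ltrDl.
have mb : a + (b - a) / 2 < b.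
  by rewrite -ltrBrDl ltr_pdivrMr// ltr_pMr ?subr_gt0// ltrDl.
have [yb yb0 eb] := Gfun_surj hP hlam0 (le_lt_trans a0 ab).
have [ym ym0 em] := Gfun_surj hP hlam0 m0.
have lt1 : yb < ym by apply: (Gfun_lt_inv hP hlam0) => //; rewrite eb em.
have [j /andP[j1 j2]] := rlam_dense (ltW yb0) lt1.
have [i /andP[i1 i2]] := rlam_dense (ltW (rlam_gt0 j)) j2.
exists i, j; split => //; last by rewrite -eb; exact: Gfun_lt.
by apply: lt_trans am _; rewrite -em; apply: Gfun_lt => //; exact: rlam_gt0.
Qed.

Definition rest (i X : nat) t : \bar R :=
  (\sum_(0 <= n <oo) (if (xs n <= X%:R)%R && ~~ inA i n then ws n t else 0))%E.

Lemma rest_le i j X : rlam j < rlam i :> R ->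
  \forall t \near +oo%R, (rest i X t <= (V t (rlam j))^-1%:E)%E.
Proof.
move=> ji; have [s hs] := trim X ji.
near=> t.
have st : s.+1%:R <= t by near: t; exact: pinf_gt.
have t0 : 0 < t by exact: lt_le_trans st.
pose u n t : \bar R := if (xs n <= X%:R)%R && ~~ inA i n then ws n t else 0%E.
have u0 n r : 0 < r -> (0 <= u n r)%E by move=> r0; rewrite /u; case: ifP => // _; exact: w0.
apply: nneseries_le_partial => [n|M]; first exact: u0.
apply: (@rcont_le _ (fun r => \sum_(0 <= n < M) u n r)%E s t 1) => //.
  apply: cvg_nnesum => n _.
    by near=> r; apply: u0; apply: lt_trans t0 _; near: r; exact: nbhs_right_gt.
  rewrite /u; case: ifP => _; last exact: cvg_cst.
  by have [_ []] := cw n t0.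
move=> n k /andP[tq _].
have q0 : 0 < gr s n k :> R by exact: gr_gt0.
apply: (@le_trans _ _ (V (gr s n k) (rlam j))^-1%:E); last first.
  rewrite lee_fin lef_pV2 ?posrE//; apply: vinv_le_time => //; exact: ltW.
apply: le_trans (ltW (hs n k)).
apply: (@le_trans _ _ (\sum_(0 <= m <oo) u m (gr s n k))%E).
  by apply: nneseries_lim_ge => m _ _; exact: u0.
apply: lee_nneseries => [m _ _|m _]; first exact: u0.
rewrite /u xs_ge0/=; case: (xs m <= X%:R) => //=.
by case: (_ \in _) => //=; rewrite le_max lexx orbT.
Unshelve. all: by end_near. Qed.

Let natbound x : exists X : nat, x <= X%:R.
Proof. by exists (Num.truncn x).+1; exact: ltW (truncnS_gt _). Qed.

Let fl0 t n x : 0 < t -> (0 <= (if (xs n <= x)%R then ws n t else 0))%E.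
Proof. by move=> t0; case: ifP => // _; exact: w0. Qed.

Lemma flow_le_rest i X x t : 0 < t -> x <= X%:R ->
  (forall n, xs n <= x -> ~ A (rlam i) (ws n)) -> (fl t x <= rest i X t)%E.
Proof.
move=> t0 xX h; apply: lee_nneseries => [n _ _|n _]; first exact: fl0.
case: ifPn => xn.
  by rewrite (le_trans xn xX) memNset//; exact: h.
by case: ifP => // _; exact: w0.
Qed.

Lemma flow_ge_atom n x t : 0 < t -> xs n <= x -> (ws n t <= fl t x)%E.
Proof.
move=> t0 xn.
have := @nneseries_ge_term _ (fun n => if xs n <= x then ws n t else 0%E) n (fun n => fl0 n x t0).
by rewrite xn.
Qed.

Let fl_ge0 t x : 0 < t -> (0 <= fl t x)%E.
Proof. by move=> t0; apply: nneseries_ge0 => n _ _; exact: fl0. Qed.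

Lemma flow_mono t x x' : 0 < t -> x <= x' -> (fl t x <= fl t x')%E.
Proof.
move=> t0 xx; apply: lee_nneseries => [n _ _|n _]; first exact: fl0.
by case: ifPn => [xn|_]; [rewrite (le_trans xn xx)|exact: fl0].
Qed.

Lemma Zfun_ge0 x : (0 <= ZZ x)%E. Proof. by apply: ereal_sup_ubound; left. Qed.

Lemma Zfun_ge n x : xs n <= x -> (Z n <= ZZ x)%E.
Proof. by move=> xn; apply: ereal_sup_ubound; right; exists n. Qed.

Lemma Zfun_le x (c : \bar R) : (0 <= c)%E -> (forall n, xs n <= x -> (Z n <= c)%E) -> (ZZ x <= c)%E.
Proof. by move=> c0 h; apply: ge_ereal_sup => _ [->//|[n xn <-]]; exact: h. Qed.

Lemma flow_eventually_le x (b : R) : (ZZ x < b%:E)%E -> exists j, G (rlam j) < b /\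
  \forall t \near +oo%R, (fl t x <= (V t (rlam j))^-1%:E)%E.
Proof.
move=> zb.
have zf : ZZ x \is a fin_num.
  by rewrite ge0_fin_numE ?Zfun_ge0//; apply: lt_trans zb _; rewrite ltry.
have z0 : 0 <= fine (ZZ x) by rewrite fine_ge0 ?Zfun_ge0.
have zb' : fine (ZZ x) < b by rewrite -lte_fin fineK.
have [i [j [ji zi jb]]] := rlam_between z0 zb'.
exists j; split => //; have [X xX] := natbound x.
near=> t.
have t0 : 0 < t by apply: (@lt_le_trans _ _ 1) => //; near: t; exact: pinf_gt.
apply: (@le_trans _ _ (rest i X t)); last by near: t; exact: rest_le.
apply: flow_le_rest => // n xn; apply: atom_notA.
by apply: le_lt_trans (Zfun_ge xn) _; rewrite -(fineK zf) lte_fin.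
Unshelve. all: by end_near. Qed.

Lemma flow_cvg x : scaledG Psi lam0 t (fl t x) @[t --> +oo%R] --> ZZ x.
Proof.
apply: ereal_cvg_order; first exact: Zfun_ge0.
- move=> a az.
  have [a0|a0] := ltP a 0.
    by apply: nearW => t; apply: lt_le_trans (scaledG_ge0 _ _ _ _); rewrite lte_fin.
  move: az => /ereal_sup_gt [_ [->|[n xn <-]]]; first by rewrite lte_fin ltNge a0.
  rewrite -(fineK (Zfin n)) lte_fin => aZ.
  have [i [j [ji ai jZ]]] := rlam_between a0 aZ.
  have iZ : ((G (rlam j))%:E < Z n)%E by rewrite -(fineK (Zfin n)) lte_fin.
  have aj : a < G (rlam j).
    by apply: (lt_trans ai); apply: Gfun_lt => //; exact: rlam_gt0.
  near=> t.
  have t0 : 0 < t by apply: (@lt_le_trans _ _ 1) => //; near: t; exact: pinf_gt.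
  apply: (@lt_le_trans _ _ (G (rlam j))%:E); first by rewrite lte_fin.
  rewrite scaledG_ge ?fl_ge0//; apply: le_trans (flow_ge_atom t0 xn).
  by near: t; exact: atom_eventually_ge.
- move=> b zb; have [j [jb hj]] := flow_eventually_le zb.
  near=> t.
  have t0 : 0 < t by apply: (@lt_le_trans _ _ 1) => //; near: t; exact: pinf_gt.
  apply: (@le_lt_trans _ _ (G (rlam j))%:E); last by rewrite lte_fin.
  by rewrite scaledG_le ?fl_ge0//; near: t.
Unshelve. all: by end_near. Qed.

Lemma A_atoms_bound X i : exists k, forall n, 0 <= xs n <= X%:R -> A (rlam i) (ws n) -> (n < k)%N.
Proof.
have /finite_fsetP [F hF] := fin X i.
exists (\max_(n <- (F : seq nat)) n).+1 => n xn An; rewrite ltnS.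
have nF : n \in F by have : [set` F] n by rewrite -hF.
by rewrite (big_rem n nF)/= leq_maxl.
Qed.

Lemma notA_Zlim_le n i : ~ A (rlam i) (ws n) -> (Z n <= (G (rlam i))%:E)%E.
Proof.
move=> nA; rewrite leNgt; apply/negP => gz.
have [T [T0 hT]] := notA_eventually hP hlam0 (cw n) (rlam_gt0 i) nA.
have zf := Zfin n.
have gz' : G (rlam i) < fine (Z n) by rewrite -lte_fin fineK.
have [a [b [ba ha hb]]] := rlam_between (ltW (Gfun_gt0 Psi lam0 (rlam i))) gz'.
have bz : ((G (rlam b))%:E < Z n)%E by rewrite -(fineK zf) lte_fin.
have bi : rlam b < rlam i :> R.
  apply: (Gfun_lt_inv hP hlam0); first exact: rlam_gt0.
  by apply: lt_trans ha _; apply: Gfun_lt => //; exact: rlam_gt0.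
have [M [_ hM]] := atom_eventually_ge bz.
pose t := Num.max T (M + 1).
have h1 : ((V t (rlam b))^-1%:E <= ws n t)%E.
  by apply: hM; rewrite /t lt_max ltrDl ltr01 orbT.
have h2 : (ws n t <= (V t (rlam i))^-1%:E)%E by apply: hT; rewrite /t le_max lexx.
have := le_trans h1 h2; rewrite lee_fin lef_pV2 ?posrE// leNgt => /negP; apply.
by apply: vinv_lt => //; exact: rlam_gt0.
Qed.

Lemma atoms_gap X (p : nat -> Prop) (z : R) : 0 < z -> (forall n, p n -> xs n <= X%:R) ->
  (forall n, p n -> (Z n < z%:E)%E) ->
  exists z' : R, [/\ 0 <= z', z' < z & forall n, p n -> (Z n <= z'%:E)%E].
Proof.
move=> z0 pX pz.
have [i' [j [_ _ jz]]] := rlam_between (lexx 0) z0.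
have h k : exists z' : R, [/\ G (rlam j) <= z', z' < z & forall n, (n < k)%N -> p n -> (Z n <= z'%:E)%E].
  elim: k => [|k [z' [g1 g2 g3]]]; first by exists (G (rlam j)); split.
  have [pk|npk] := pselect (p k); last first.
    by exists z'; split => // n; rewrite ltnS leq_eqVlt => /predU1P[->//|/g3].
  exists (Num.max z' (fine (Z k))); split.
  - by rewrite le_max g1.
  - by rewrite gt_max g2/= -lte_fin fineK// pz.
  move=> n; rewrite ltnS leq_eqVlt => /predU1P[-> _|nk pn].
    by rewrite -{1}(fineK (Zfin k)) lee_fin le_max lexx orbT.
  by apply: le_trans (g3 n nk pn) _; rewrite lee_fin le_max lexx.
have [k hk] := A_atoms_bound X j.
have [z' [g1 g2 g3]] := h k; exists z'; split => //; first by apply: le_trans g1; exact/ltW/Gfun_gt0.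
move=> n pn; have [nk|nk] := ltnP n k; first exact: g3.
apply: (@le_trans _ _ (G (rlam j))%:E); last by rewrite lee_fin.
apply: notA_Zlim_le => An; have : (n < k)%N by apply: hk; rewrite ?xs_ge0 ?pX.
by rewrite ltnNge nk.
Qed.

Lemma Zfun_fin x : ZZ x \is a fin_num.
Proof.
rewrite ge0_fin_numE ?Zfun_ge0//; have [X xX] := natbound x.
have [|nall] := pselect (exists c : R, forall n, xs n <= x -> (Z n <= c%:E)%E).
  move=> [c hc]; apply: (@le_lt_trans _ _ (Num.max 0 c)%:E); last by rewrite ltry.
  apply: Zfun_le => [|n xn]; first by rewrite lee_fin le_max lexx.
  by apply: le_trans (hc n xn) _; rewrite lee_fin le_max lexx orbT.
exfalso; apply: nall.
have h k : exists c : R, forall n, (n < k)%N -> (Z n <= c%:E)%E.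
  elim: k => [|k [c hc]]; first by exists 0.
  exists (Num.max c (fine (Z k))) => n; rewrite ltnS leq_eqVlt => /predU1P[->|nk].
    by rewrite -{1}(fineK (Zfin k)) lee_fin le_max lexx orbT.
  by apply: le_trans (hc n nk) _; rewrite lee_fin le_max lexx.
have [k hk] := A_atoms_bound X 0; have [c hc] := h k.
exists (Num.max c (G (rlam 0))) => n xn.
have [nk|nk] := ltnP n k.
  by apply: le_trans (hc n nk) _; rewrite lee_fin le_max lexx.
apply: (@le_trans _ _ (G (rlam 0))%:E); last by rewrite lee_fin le_max lexx orbT.
apply: notA_Zlim_le => An; have : (n < k)%N by apply: hk An; rewrite xs_ge0 (le_trans xn xX).
by rewrite ltnNge nk.
Qed.

Lemma lft_flow_ge n x t : 0 < t -> xs n < x -> (ws n t <= lft (fl t) x)%E.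
Proof.
move=> t0 xn; apply: le_trans (flow_ge_atom t0 (lexx (xs n))) _.
by apply: ereal_sup_ubound; exists (xs n) => //=; rewrite in_itv.
Qed.

Lemma lft_flow_le x t (c : \bar R) : (forall x', x' < x -> (fl t x' <= c)%E) -> (lft (fl t) x <= c)%E.
Proof. by move=> h; apply: ge_ereal_sup => _ [x' /= + <-]; rewrite in_itv/= => /h. Qed.

Lemma flow_jump_ge n x t : 0 < t -> xs n = x -> ws n t \is a fin_num ->
  (lft (fl t) x + ws n t <= fl t x)%E.
Proof.
move=> t0 xn wf; rewrite -leeBrDr//; apply: lft_flow_le => x' x'x; rewrite leeBrDr//.
have e : (ws n t = \sum_(0 <= m <oo) (if m == n then ws m t else 0))%E.
  rewrite (nneseries_split 0 n.+1); last by move=> k _; case: eqP => // ->; exact: w0.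
  rewrite add0n big_nat_recr//= eqxx big_nat_cond big1 ?add0e; last first.
    by move=> m /andP[/andP[_ mn] _]; rewrite ltn_eqF.
  rewrite eseries0 ?adde0// => m /= mn _; rewrite gtn_eqF//.
rewrite e -nneseriesD; last 2 first.
- by move=> m _ _; exact: fl0.
- by move=> m _ _; case: ifP => // _; exact: w0.
apply: lee_nneseries => [m _ _|m _].
  by apply: adde_ge0; [exact: fl0|case: ifP => // _; exact: w0].
case: eqP => [->|_]; last by rewrite adde0; case: ifPn => [xm|_]; [rewrite (le_trans xm (ltW x'x))|exact: fl0].
by rewrite xn lexx (_ : (x <= x') = false) ?add0e// leNgt x'x.
Qed.

Lemma flow_jump_le x t : 0 < t ->
  (fl t x <= lft (fl t) x + \sum_(0 <= n <oo) (if xs n == x then ws n t else 0))%E.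
Proof.
move=> t0.
have hs n : (0 <= if (xs n < x)%R then ws n t else 0)%E by case: ifP => // _; exact: w0.
have he n : (0 <= if xs n == x then ws n t else 0)%E by case: ifP => // _; exact: w0.
have -> : (fl t x = \sum_(0 <= n <oo) (if (xs n < x)%R then ws n t else 0) +
    \sum_(0 <= n <oo) (if xs n == x then ws n t else 0))%E.
  rewrite -nneseriesD//; apply: eq_eseriesr => n _.
  by case: (ltgtP (xs n) x) => _; rewrite ?adde0 ?add0e.
apply: leeD2r; apply: nneseries_le_partial => // M.
have [x' [x'x hx']] : exists x', x' < x /\ forall n, (n < M)%N -> xs n < x -> xs n <= x'.
  elim: M => [|M [x' [x'x hx']]]; first by exists (x - 1); split => //; rewrite ltrBlDr ltrDl.
  exists (if xs M < x then Num.max x' (xs M) else x'); split.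
    by case: ifP => // h; rewrite gt_max x'x.
  move=> n; rewrite ltnS leq_eqVlt => /predU1P[->|nM] xn.
    by rewrite xn le_max lexx orbT.
  by case: ifP => _; rewrite ?le_max hx'.
apply: (@le_trans _ _ (fl t x')); last by apply: ereal_sup_ubound; exists x' => //=; rewrite in_itv.
apply: (@le_trans _ _ (\sum_(0 <= n < M) (if (xs n <= x')%R then ws n t else 0))%E); last first.
  by apply: nneseries_lim_ge => n _ _; exact: fl0.
rewrite big_nat_cond [leRHS]big_nat_cond; apply: lee_sum => n /andP[/andP[_ nM] _].
by case: ifPn => [xn|_]; [rewrite hx'|exact: fl0].
Qed.

Let small_atom x : 0 < x -> exists n, xs n < x.
Proof.
move=> x0; have [n /andP[_ hn]] := acc (Num.truncn x^-1); exists n; apply: le_lt_trans hn _.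
rewrite -[X in _ < X]invrK ltf_pV2 ?posrE ?invr_gt0//; exact: truncnS_gt.
Qed.

Lemma lft_Zfun_ge n x : xs n < x -> (Z n <= lft ZZ x)%E.
Proof.
move=> xn; apply: le_trans (Zfun_ge (lexx (xs n))) _.
by apply: ereal_sup_ubound; exists (xs n) => //=; rewrite in_itv.
Qed.

Lemma lft_Zfun_le x : (lft ZZ x <= ZZ x)%E.
Proof.
apply: ge_ereal_sup => _ [x' /= + <-]; rewrite in_itv/= => x'x.
by apply: Zfun_le => [|n xn]; [exact: Zfun_ge0|apply: Zfun_ge; apply: le_trans xn (ltW x'x)].
Qed.

Let lftZ_fin x : 0 < x -> lft ZZ x \is a fin_num /\ (0 < lft ZZ x)%E.
Proof.
move=> x0; have [n xn] := small_atom x0.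
have z0 := lt_le_trans (Zpos n) (lft_Zfun_ge xn).
split => //; rewrite ge0_fin_numE ?(ltW z0)//; apply: le_lt_trans (lft_Zfun_le x) _.
by rewrite -ge0_fin_numE ?Zfun_ge0// Zfun_fin.
Qed.

Let flow_fin x : \forall t \near +oo%R, fl t x \is a fin_num.
Proof.
have zf := Zfun_fin x.
have zb : (ZZ x < (fine (ZZ x) + 1)%:E)%E by rewrite EFinD fineK// lteDl// lte_fin.
have [j [_ hj]] := flow_eventually_le zb.
near=> t.
have t0 : 0 < t by apply: (@lt_le_trans _ _ 1) => //; near: t; exact: pinf_gt.
rewrite ge0_fin_numE ?fl_ge0//; apply: (@le_lt_trans _ _ (V t (rlam j))^-1%:E); last by rewrite ltry.
by near: t.
Unshelve. all: by end_near. Qed.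

Lemma lft_flow_mono x t : 0 < t -> (lft (fl t) x <= fl t x)%E.
Proof. by move=> t0; apply: lft_flow_le => x' /ltW; exact: flow_mono. Qed.

Let lft_fin x : 0 < x -> \forall t \near +oo%R, lft (fl t) x \is a fin_num /\ 0 < fine (lft (fl t) x).
Proof.
move=> x0; have [n xn] := small_atom x0.
have z0 : 0 < fine (Z n) by apply: fine_gt0; rewrite Zpos/= -ge0_fin_numE ?Zfin// ltW.
have [i [j [_ _ jz]]] := rlam_between (lexx 0) z0.
have jZ : ((G (rlam j))%:E < Z n)%E by rewrite -(fineK (Zfin n)) lte_fin.
near=> t.
have t0 : 0 < t by apply: (@lt_le_trans _ _ 1) => //; near: t; exact: pinf_gt.
have h1 : ((V t (rlam j))^-1%:E <= ws n t)%E by near: t; exact: atom_eventually_ge.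
have h2 : (0 < lft (fl t) x)%E.
  apply: lt_le_trans (lft_flow_ge t0 xn); apply: lt_le_trans h1.
  by rewrite lte_fin invr_gt0.
have h3 : (lft (fl t) x < +oo)%E.
  apply: le_lt_trans (lft_flow_mono x t0) _; rewrite -ge0_fin_numE ?fl_ge0//.
  by near: t; exact: flow_fin.
by split; [rewrite ge0_fin_numE// ltW|apply: fine_gt0; rewrite h2].
Unshelve. all: by end_near. Qed.

Lemma jump_superind x : 0 < x -> (lft ZZ x < ZZ x)%E -> superind xs ws x.
Proof.
move=> x0 zz; have [zf z0] := lftZ_fin x0.
have [n xn zn] : exists2 n, xs n = x & (lft ZZ x < Z n)%E.
  move/ereal_sup_gt : zz => [_ [->|[n /= xn <-]] h]; first by move: (lt_trans z0 h); rewrite ltxx.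
  exists n => //; apply/eqP; rewrite eq_le xn/= leNgt; apply/negP => /lft_Zfun_ge.
  by rewrite leNgt h.
have zn' : fine (lft ZZ x) < fine (Z n) by rewrite -lte_fin !fineK.
have [i [j [ji li jz]]] := rlam_between (fine_ge0 (ltW z0)) zn'.
have zn0 : 0 < fine (Z n) by exact: lt_trans (Gfun_gt0 _ _ _) jz.
have [yn yn0 eyn] := Gfun_surj hP hlam0 zn0.
have ynj : yn < rlam j by apply: (Gfun_lt_inv hP hlam0); [exact: rlam_gt0|rewrite eyn].
have [k /andP[k1 k2]] := rlam_dense (ltW yn0) ynj.
have kz : ((G (rlam k))%:E < Z n)%E by rewrite -(fineK (Zfin n)) lte_fin -eyn Gfun_lt.
have [X xX] := natbound x.
split => //; apply/cvgryPge => C; near=> t.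
have t0 : 0 < t by apply: (@lt_le_trans _ _ 1) => //; near: t; exact: pinf_gt.
have [lf l0] : lft (fl t) x \is a fin_num /\ 0 < fine (lft (fl t) x) by near: t; exact: lft_fin.
have ff : fl t x \is a fin_num by near: t; exact: flow_fin.
have wk : ((V t (rlam k))^-1%:E <= ws n t)%E by near: t; exact: atom_eventually_ge.
have wf : ws n t \is a fin_num.
  rewrite ge0_fin_numE ?w0//; apply: (@le_lt_trans _ _ (fl t x)).
    by apply: flow_ge_atom => //; rewrite xn.
  by rewrite -ge0_fin_numE ?fl_ge0.
have lj : (lft (fl t) x <= (V t (rlam j))^-1%:E)%E.
  apply: lft_flow_le => x' x'x; apply: (@le_trans _ _ (rest i X t)); last by near: t; exact: rest_le.
  apply: flow_le_rest => //; first exact: le_trans (ltW x'x) xX.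
  move=> m xm; apply: atom_notA; apply: (@le_lt_trans _ _ (lft ZZ x)).
    by apply: lft_Zfun_ge; exact: le_lt_trans x'x.
  by rewrite -(fineK zf) lte_fin.
have jump := flow_jump_ge t0 xn wf.
have jump' : fine (lft (fl t) x) + (V t (rlam k))^-1 <= fine (fl t x).
  rewrite -lee_fin EFinD !fineK//; apply: le_trans jump; exact: leeD2l.
rewrite -(fineK ff) -(fineK lf) -EFinB /= ler_pdivlMr//.
have lj' : fine (lft (fl t) x) <= (V t (rlam j))^-1 by rewrite -lee_fin fineK.
have Ck : `|C| * V t (rlam k) <= V t (rlam j).
  by near: t; apply: vinv_ratio_cvgy => //; exact: rlam_gt0.
apply: (@le_trans _ _ (`|C| * fine (lft (fl t) x))); first by rewrite ler_wpM2r ?ler_norm// ltW.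
apply: (@le_trans _ _ (V t (rlam k))^-1); last by rewrite lerBrDl.
apply: le_trans (ler_wpM2l (normr_ge0 C) lj') _.
by rewrite ler_pdivrMr// ler_pdivlMl// mulrC.
Unshelve. all: by end_near. Qed.

Lemma superind_jump x : superind xs ws x -> 0 < x /\ (lft ZZ x < ZZ x)%E.
Proof.
move=> [x0 /cvgryPge sup]; split => //.
have [zf z0] := lftZ_fin x0.
rewrite lt_neqAle lft_Zfun_le andbT; apply/eqP => zz.
have [X xX] := natbound x.
pose z := fine (lft ZZ x).
have ez : lft ZZ x = z%:E by rewrite fineK.
have z0' : 0 < z by rewrite -lte_fin -ez.
have [m xm Zm] : exists2 m, xs m < x & Z m = z%:E.
  apply: contrapT => nm.
  have [n|n xn|z' [z'0 z'z hz']] := @atoms_gap X (fun n => xs n < x) z z0'.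
  - by move=> /ltW xn; exact: le_trans xX.
  - rewrite lt_neqAle -ez lft_Zfun_ge// andbT; apply/eqP => e; apply: nm; exists n => //.
    by rewrite e.
  have : (lft ZZ x <= z'%:E)%E.
    apply: ge_ereal_sup => _ [x' /= + <-]; rewrite in_itv/= => x'x.
    by apply: Zfun_le => [|n xn]; [rewrite lee_fin|apply: hz'; exact: le_lt_trans x'x].
  by rewrite ez lee_fin leNgt z'z.
have [n|n xn|z' [z'0 z'z hz']] := @atoms_gap X (fun n => xs n = x) z z0'.
- by move=> ->.
- rewrite lt_neqAle -ez zz Zfun_ge ?xn// andbT; apply/eqP => e.
  apply: (@ties n m); first by move=> nm; move: xm; rewrite -nm xn ltxx.
  by rewrite e -zz ez Zm.
have [i [j [ji z'i jz]]] := rlam_between z'0 z'z.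
have jm : ((G (rlam j))%:E < Z m)%E by rewrite Zm lte_fin.
suff hF : \forall t \near +oo, t <> t :> R by have [t] := filter_ex hF.
near=> t; exfalso.
have t0 : 0 < t by apply: (@lt_le_trans _ _ 1) => //; near: t; exact: pinf_gt.
have [lf l0] : lft (fl t) x \is a fin_num /\ 0 < fine (lft (fl t) x) by near: t; exact: lft_fin.
have ff : fl t x \is a fin_num by near: t; exact: flow_fin.
have h1 : 2 <= fine (fl t x - lft (fl t) x)%E / fine (lft (fl t) x) by near: t; exact: sup.
have wm : ((V t (rlam j))^-1%:E <= lft (fl t) x)%E.
  by apply: le_trans (lft_flow_ge t0 xm); near: t; exact: atom_eventually_ge.
have hr : (fl t x <= lft (fl t) x + (V t (rlam j))^-1%:E)%E.
  apply: le_trans (flow_jump_le x t0) _; apply: leeD2l.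
  apply: (@le_trans _ _ (rest i X t)); last by near: t; exact: rest_le.
  apply: lee_nneseries => [n _ _|n _]; first by case: ifP => // _; exact: w0.
  case: eqP => [xn|_]; last by case: ifP => // _; exact: w0.
  rewrite xn xX memNset//; apply: atom_notA; apply: le_lt_trans (hz' n xn) _.
  by rewrite lte_fin.
move: h1 hr wm; rewrite -(fineK ff) -(fineK lf) -EFinB -EFinD !lee_fin/= ler_pdivlMr//.
move: (fine (fl t x)) (fine (lft (fl t) x)) ((V t (rlam j))^-1) l0 => a b c b0 h1 h2 h3.
rewrite -lerBlDl in h2.
by have := le_trans h1 (le_trans h2 h3); rewrite mulr_natl mulr2n gerDl leNgt b0.
Unshelve. all: by end_near. Qed.

Lemma superindE : superind xs ws = [set x | 0 < x /\ (0 < ZZ x - lft ZZ x)%E].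
Proof.
apply/seteqP; split => x /=; rewrite sube_gt0; first exact: superind_jump.
by move=> [x0]; exact: jump_superind.
Qed.

End atoms.

Section level_mark.
Context {R : realType}.
Variables (Psi : R -> R) (lam0 : R).
Hypotheses (hP : admissible Psi) (hlam0 : 0 < lam0).
Variables (ell : R -> {measure set (\bar R) -> \bar R}).
Hypothesis hell0 : forall t, 0 < t -> ell t [set z | (z <= 0)%E] = 0%E.
Hypothesis hell : forall t lam v, 0 < t -> 0 < lam -> is_cum Psi t lam v ->
  (\int[ell t]_z (1 - elap lam z)%:E)%E = v%:E.
Variables (K : R -> \bar R -> {measure set (\bar R) -> \bar R}).
Hypothesis hK0 : forall s y, 0 < s -> (0 <= y)%E ->
  K s y [set z | (z < 0)%E] = 0%E /\ K s y setT = 1%E.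
Hypothesis hK : forall s y lam v, 0 < s -> (0 <= y)%E -> 0 < lam -> is_cum Psi s lam v ->
  (\int[K s y]_z (elap lam z)%:E)%E = (elap v y)%:E.
Variable N : {measure set (@Dpath R) -> \bar R}.
Hypothesis hNfdd : forall (t : R) (B : set (\bar R)) (l : seq (R * set (\bar R))),
  0 < t -> measurable B -> B `<=` [set z | (0 < z)%E] ->
  all (fun p => 0 < p.1) l -> (forall p, p \in l -> measurable p.2) ->
  N (((fun w : R -> \bar R => w t) @^-1` B) `&` cyl t l) =
    (\int[ell t]_(y in B) fdd_iter K y l)%E.
Hypothesis Npos : forall t : R, (0 < t)%R -> N [set w : Dpath | (w t < 0)%E] = 0%E.
Hypothesis hNabs : forall s t : R, 0 < s < t ->
  N [set w : R -> \bar R | w s = 0%E /\ w t != 0%E] = 0%E.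
Hypothesis hNnz : N [set w : R -> \bar R | forall q : rat, 0 < q -> w (ratr q) = 0%E] = 0%E.

Local Notation V := (vinv Psi lam0).
Local Notation G := (Gfun Psi lam0).

(* The level y with G(y) = zeta, under which the marks have Lebesgue intensity. *)
Definition level (w : @Dpath R) : R :=
  if 0 < zeta Psi lam0 w then V (- ln (zeta Psi lam0 w)) lam0 else -1.

Lemma Gfun_level w : 0 < zeta Psi lam0 w -> G (level w) = zeta Psi lam0 w.
Proof.
move=> z0; rewrite /level z0 /Gfun oint_vinv//.
have -> : oint Psi lam0 lam0 = 0.
  by rewrite /oint lexx set_itv1 Rintegral_set1.
by rewrite add0r opprK lnK.
Qed.

Lemma level_interval (a b : R) : 0 <= a -> a < b ->
  measurable [set w | a <= level w < b] /\ N [set w | a <= level w < b] = (b - a)%:E.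
Proof.
move=> a0 ab; have b0 : 0 < b := le_lt_trans a0 ab.
pose D y := [set w | G y < zeta Psi lam0 w].
have mD y : measurable (D y).
  rewrite (_ : D y = setT `&` zeta Psi lam0 @^-1` `]G y, +oo[%classic).
    by apply: zeta_measurable.
  by rewrite setTI; apply/seteqP; split => w /=; rewrite in_itv/= andbT.
have ND y : 0 < y -> N (D y) = y%:E.
  by move=> y0; exact: (N_zeta_gt hP hlam0 hell0 hell hK0 hK hNfdd Npos hNabs hNnz).
have lev0 w : 0 < zeta Psi lam0 w -> 0 < level w.
  by move=> z0; rewrite /level z0 vinv_gt0.
have lt_level w y : 0 < y -> (0 <= level w < y) = (G y < zeta Psi lam0 w).
  move=> y0; have [z0|z0] := ltP 0 (zeta Psi lam0 w); last first.
    rewrite /level (ltNge 0) z0/= oppr_ge0 ler10/=; apply/esym/negbTE; rewrite -leNgt.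
    by apply: le_trans z0 _; exact/ltW/Gfun_gt0.
  rewrite (ltW (lev0 _ z0))/= -(Gfun_level z0); apply/idP/idP.
    by apply: Gfun_lt => //; exact: lev0.
  exact: Gfun_lt_inv.
move: a0; rewrite le_eqVlt => /predU1P[<-|a0].
  rewrite subr0 (_ : [set _ | _] = D b); first by split; [exact: mD|exact: ND].
  by apply/seteqP; split => w /=; rewrite /D /= lt_level.
rewrite (_ : [set _ | _] = D b `\` D a).
  split; first exact: measurableD.
  have fb : (N (D b) < +oo)%E by rewrite ND// ltry.
  rewrite (measureD (mD b) (mD a) fb).
  have -> : D b `&` D a = D a.
    by apply/setIidPr => w; rewrite /D /=; apply: lt_trans; exact: Gfun_lt.
  by rewrite EFinB; congr (_ - _)%E; exact: ND.
have DE y w : 0 < y -> D y w <-> 0 <= level w < y by move=> y0; rewrite lt_level.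
apply/seteqP; split => w.
  move=> /andP[h1 h2]; split; first by apply/(DE _ _ b0); rewrite (le_trans (ltW a0) h1) h2.
  by move=> /(DE _ _ a0) /andP[_]; rewrite ltNge h1.
move=> [/(DE _ _ b0) /andP[h1 h2] nD]; rewrite /= h2 andbT leNgt; apply/negP => h3.
by apply: nD; apply/(DE _ _ a0); rewrite h1.
Qed.

End level_mark.

Theorem theorem1p1
  (R : realType)
  (* the branching mechanism Psi *)
  (sigma gamma : R) (pi : {measure set (measurableTypeR R) -> \bar R})
  (Psi : R -> R)
  (hsigma : 0 <= sigma)
  (hpi0 : pi `]-oo, 0]%classic = 0%E)
  (hpi : (\int[pi]_(r in `]0%R, +oo[) (Num.min 1 (r ^+ 2))%:E < +oo)%E)
  (hPsi : Psi = bmech sigma gamma pi)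
  (* Psi'(0+) >= 0 *)
  (hder : exists l : \bar R, (0 <= l)%E /\ ((Psi u / u)%:E @[u --> 0^'+] --> l))
  (* d = lim Psi(u)/u = +oo *)
  (hd : (Psi u / u)%:E @[u --> +oo%R] --> +oo%E)
  (* int^oo du/Psi(u) = +oo *)
  (hgrey : forall a : R, 0 < a ->
     (\int[@lebesgue_measure R]_(u in `[a, +oo[) ((Psi u)^-1)%:E)%E = +oo%E)
  (lam0 : R) (hlam0 : 0 < lam0)
  (* the measures l_t on (0,oo]: v_t(lam) = int l_t(dr) (1 - e^{-lam r}) *)
  (ell : R -> {measure set (\bar R) -> \bar R})
  (hell0 : forall t, 0 < t -> ell t [set z | (z <= 0)%E] = 0%E)
  (hell : forall t lam v, 0 < t -> 0 < lam -> is_cum Psi t lam v ->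
     (\int[ell t]_z (1 - elap lam z)%:E)%E = v%:E)
  (* the CSBP(Psi) transition kernels on [0,oo]: E_y[e^{-lam X_s}] = e^{-y v_s(lam)} *)
  (K : R -> \bar R -> {measure set (\bar R) -> \bar R})
  (hK0 : forall s y, 0 < s -> (0 <= y)%E ->
     K s y [set z | (z < 0)%E] = 0%E /\ K s y setT = 1%E)
  (hK : forall s y lam v, 0 < s -> (0 <= y)%E -> 0 < lam -> is_cum Psi s lam v ->
     (\int[K s y]_z (elap lam z)%:E)%E = (elap v y)%:E)
  (* the sigma-finite measure N_Psi on path space *)
  (N : {measure set (@Dpath R) -> \bar R})
  (hNsf : sigma_finite setT N)
  (* N_Psi(X_{t_1} in B_1, ..., X_{t_n} in B_n) = int_{B_1} l_{t_1}(dy_1) E_{y_1}[...] (Markov) *)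
  (hNfdd : forall (t : R) (B : set (\bar R)) (l : seq (R * set (\bar R))),
     0 < t -> measurable B -> B `<=` [set z | (0 < z)%E] ->
     all (fun p => 0 < p.1) l -> (forall p, p \in l -> measurable p.2) ->
     N (((fun w : R -> \bar R => w t) @^-1` B) `&` cyl t l) =
       (\int[ell t]_(y in B) fdd_iter K y l)%E)
  (* 0 is absorbing under N_Psi, and N_Psi does not charge the zero path *)
  (hNabs : forall s t : R, 0 < s < t ->
     N [set w : R -> \bar R | w s = 0%E /\ w t != 0%E] = 0%E)
  (hNnz : N [set w : R -> \bar R | forall q : rat, 0 < q -> w (ratr q) = 0%E] = 0%E)
  (* the Poisson point process sum_i delta_{(x_i, X^i)} with intensity dx (x) N_Psi *)
  (d : measure_display) (Om : measurableType d) (P : probability Om R)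
  (xs : Om -> nat -> R) (Xs : Om -> nat -> R -> \bar R)
  (hcadlag : forall om n, cadlag_pos (Xs om n))
  (hPPP : is_PPP P
     (fun om n => ((xs om n, Xs om n) : (measurableTypeR R * @Dpath R)%type))
     (fun A => (\int[@lebesgue_measure R]_(x in `[0%R, +oo[) N (xsection A x))%E)) :
  (* a.s. for every i the limit Z_i = lim_{t->oo} e^t G(1/X^i_t) exists *)
  {ae P, forall om, forall n,
     Zlim Psi lam0 (Xs om n) \is a fin_num /\
     (scaledG Psi lam0 t (Xs om n t) @[t --> +oo%R] --> Zlim Psi lam0 (Xs om n))}
  (* M = sum_i delta_{(x_i, Z_i)} is a PPP with intensity dx (x) mu, mu((z,oo)) = G^{-1}(z) *)
  /\ (exists mu : {measure set (measurableTypeR R) -> \bar R},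
        mu `]-oo, 0]%classic = 0%E /\
        (forall z y : R, 0 < z -> 0 < y -> Gfun Psi lam0 y = z -> mu `]z, +oo[%classic = y%:E) /\
        is_PPP P
          (fun om n => ((xs om n, fine (Zlim Psi lam0 (Xs om n)))
                          : (measurableTypeR R * measurableTypeR R)%type))
          (fun A => (\int[@lebesgue_measure R]_(x in `[0%R, +oo[) mu (xsection A x))%E))
  (* a.s., for all x >= 0, e^t G(1/X_t(x)) --> Z(x) = sup_{x_i <= x} Z_i *)
  /\ {ae P, forall om, forall x : R, 0 <= x ->
        (scaledG Psi lam0 t (flow (xs om) (Xs om) t x) @[t --> +oo%R]
           --> Zfun (fun n => Zlim Psi lam0 (Xs om n)) (xs om) x)}
  (* a.s. the super-individuals are exactly the jump locations of Z *)
  /\ {ae P, forall om,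
        superind (xs om) (Xs om) =
        [set x : R | 0 < x /\
           (0 < Zfun (fun n => Zlim Psi lam0 (Xs om n)) (xs om) x
                - lft (Zfun (fun n => Zlim Psi lam0 (Xs om n)) (xs om)) x)%E]}.


Proof.
have hP : admissible Psi.
  rewrite hPsi in hder hd hgrey *; split => //.
  - by move=> a b a0 ab; exact: (bmech_ratio_lt hpi hd a0 ab).
  - by move=> a a0; exact: (bmech_gt0 hpi hd hder).
have hPPP' : is_PPP P (marked_atoms xs (Xs : Om -> nat -> @Dpath R)) (intensity N) := hPPP.
have Npos (t : R) : 0 < t -> N [set w : Dpath | (w t < 0)%E] = 0%E.
  move=> t0; apply: (ppp_void hPPP' hNsf).
    exact: (coord_measurable t0 (measurable_ereal_lt 0%E)).
  by move=> om n /=; have [+ _] := hcadlag om n t t0; rewrite leNgt => /negP.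
have mgood := goodpath_measurable Psi lam0.
have good : {ae P, forall om n, goodpath Psi lam0 (Xs om n)}.
  have := ppp_null_path hPPP' (measurableC mgood)
    (N_ngoodpath hP hlam0 hell0 hell hK0 hK hNfdd Npos hNabs hNnz).
  by apply: filterS => om h n; apply: contrapT => /h.
have pos : {ae P, forall om n, 0 <= xs om n} := ppp_pos hPPP'.
have trim : {ae P, forall om (X i j : nat), rlam j < rlam i :> R -> exists s, forall n k,
   (\sum_(0 <= m <oo) (if (0 <= xs om m <= X%:R)%R then
     if (Xs om m : @Dpath R) \in io (up Psi lam0 (rlam i)) then 0
     else maxe 0 (Xs om m (gr s n k)) else 0) < (vinv Psi lam0 (gr s n k) (rlam j))^-1%:E)%E}.
  apply/ae_foralln => X; apply/ae_foralln => i; apply/ae_foralln => j.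
  have [ji|ji] := pselect (rlam j < rlam i :> R); last by apply: aeW => om /ji.
  have := trimmed_flow_upper hP hlam0 hell0 hell hK0 hK hNfdd Npos hNabs hNnz hNsf hPPP'
    (ler0n R X) (rlam_gt0 i) (rlam_gt0 j) ji.
  by apply: filterS => om h _; exact: h.
have fin : {ae P, forall om (X i : nat),
    finite_set [set n | 0 <= xs om n <= X%:R /\ io (up Psi lam0 (rlam i)) (Xs om n)]}.
  apply/ae_foralln => X; apply/ae_foralln => i; apply: (ppp_finite hPPP') => //.
    by apply: io_measurable => q; exact: up_measurable.
  by rewrite (N_up hP hlam0 hell0 hell hK0 hK hNfdd Npos hNabs hNnz (rlam_gt0 i)) ltry.
have acc : {ae P, forall om (k : nat), exists n, 0 <= xs om n <= k.+1%:R^-1}.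
  apply/ae_foralln => k; apply: (ppp_atom_le hPPP') => [|y]; first by rewrite invr_gt0.
  case: y => [|y]; first by exists set0; split; [exact: measurable0|exact: measure0].
  exists (io (up Psi lam0 y.+1%:R)); split.
    by apply: io_measurable => q; exact: up_measurable.
  by apply: (N_up hP hlam0 hell0 hell hK0 hK hNfdd Npos hNabs hNnz).
have ties0 := ppp_no_ties hPPP'
  (level_interval hP hlam0 hell0 hell hK0 hK hNfdd Npos hNabs hNnz).
have ties : {ae P, forall om n m, n <> m -> Zlim Psi lam0 (Xs om n) <> Zlim Psi lam0 (Xs om m)}.
  apply: filterS2 good ties0 => om gd h n m nm e.
  have ez : zeta Psi lam0 (Xs om n) = zeta Psi lam0 (Xs om m).
    by rewrite -!(fine_Zlim hP hlam0)// e.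
  have z0 : 0 < zeta Psi lam0 (Xs om n).
    have [pw w0 wy] := gd n; rewrite /zeta asboolT//; apply: fine_gt0; by rewrite w0.
  apply: (h n m nm); last by rewrite /level ez.
  by rewrite /level z0; exact/ltW/vinv_gt0.
split; [|split; [|split]].
- apply: filterS good => om gd n.
  by have [_ h1 h2] := Zlim_good hP hlam0 (hcadlag om) gd n; split.
- have mz : measurable_fun setT (zeta Psi lam0 : @Dpath R -> measurableTypeR R).
    exact: zeta_measurable.
  pose mu : {measure set (measurableTypeR R) -> \bar R} :=
    measure_function_pushforward__canonical__measure_function_Measure N mz.
  exists mu; split; [|split].
  + rewrite -(N_zeta_le0 hP hlam0 hell0 hell hK0 hK hNfdd Npos hNabs hNnz).
    by congr (N _); apply/seteqP; split => w /=; rewrite in_itv.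
  + move=> z y z0 y0 <-.
    rewrite -(N_zeta_gt hP hlam0 hell0 hell hK0 hK hNfdd Npos hNabs hNnz y0).
    by congr (N _); apply/seteqP; split => w /=; rewrite in_itv/= andbT.
  + apply: (ppp_map hPPP' mz) => om n; exact: (fine_Zlim hP hlam0).
- near=> om => x x0; apply: (flow_cvg hP hlam0) => //; near: om.
  + exact: pos.
  + exact: good.
  + exact: trim.
- near=> om; apply: (superindE hP hlam0) => //; near: om.
  + exact: pos.
  + exact: good.
  + exact: trim.
  + exact: fin.
  + exact: acc.
  + exact: ties.
Unshelve. all: by end_near. Qed.
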